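(* Fix $\delta,\varepsilon>0$ and $h\in(0,h_0]$, and let $v_h^0\in\mathcal{K}_h$ be an initial guess. Then there exists a collection of time steps $\tau_n$ such that $$0<\gamma\le\tau_n\le(1+c^n)^{-1}\qquad\forall n>0,$$ where $c^n$ is the constant of the energy-monotonicity property recalled in the context and $\gamma$ depends on the data and possibly on $h$ (but not on $n$), for which the following holds: the corresponding sequence $(v_h^n)_n\subset\mathcal{K}_h$ generated by the scheme $$\frac1{\tau_n}\int_\Omega(v_h^{n+1}-v_h^n)(\omega_h-v_h^{n+1})+\int_\Omega(\mathbb{C}_0-\mathbb{C}_1)(\omega_h-v_h^{n+1})\widehat\nabla u_h^n:\widehat\nabla p_h^n+2\widetilde\alpha\varepsilon\int_\Omega\nabla v_h^{n+1}\cdot\nabla(\omega_h-v_h^{n+1})+\frac{\widetilde\alpha}\varepsilon\int_\Omega(1-2v_h^n)(\omega_h-v_h^{n+1})\ge0\quad\forall\omega_h\in\mathcal{K}_h,\ n\ge0,$$ has a subsequence (still denoted $v_h^n$) converging in $W^{1,\infty}(\Omega)$, $$v_h^n\to v_h,\qquad n\to+\infty,$$ where $v_h\in\mathcal{K}_h$ satisfies the discrete optimality condition $$J'_{\delta,\varepsilon,h}(v_h)[\omega_h-v_h]\ge0\qquad\forall\omega_h\in\mathcal{K}_h.$$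
   Context: $d\in\{2,3\}$; $\widehat\nabla u$ is the symmetric part of $\nabla u$; $\widehat A=\frac12(A+A^T)$, $A:B=\sum_{i,j}a_{ij}b_{ij}$, $|A|=\sqrt{A:A}$. $\Omega\subset\mathbb{R}^d$ is a bounded polygonal ($d=2$) or polyhedral ($d=3$) domain with Lipschitz boundary $\partial\Omega=\Sigma_N\cup\Sigma_D$, $|\Sigma_N|,|\Sigma_D|>0$, $\Sigma_D$ closed; $d_0>0$ is fixed and $\Omega^{d_0/2}=\{x\in\Omega:\mathrm{dist}(x,\partial\Omega)\le d_0/2\}$. $\mathbb{C}_0(x)$ is a fourth-order tensor on $\Omega$ with $(\mathbb{C}_0)_{ijkh}=(\mathbb{C}_0)_{jikh}=(\mathbb{C}_0)_{khij}$, uniformly bounded, with $\mathbb{C}_0(x)\widehat A:\widehat A\ge\xi_0|\widehat A|^2$ a.e. in $\Omega$ for all matrices $A$, $\xi_0>0$. $\mathbb{C}_1=\delta\mathbb{C}_0$, $\mathbb{C}_\delta(v)=\mathbb{C}_0+(\mathbb{C}_1-\mathbb{C}_0)v$; $\widetilde\alpha=\frac4\pi\alpha$, $\alpha>0$. $H^1_{\Sigma_D}(\Omega)$: $\mathbb{R}^d$-valued $H^1$ functions with zero trace on $\Sigma_D$. $\mathcal{K}=\{v\in H^1(\Omega)\text{ scalar}: 0\le v\le1\text{ a.e. in }\Omega,\ v=0\text{ a.e. in }\Omega^{d_0/2}\}$. Discretization. $(\mathcal{T}_h)_{0<h\le h_0}$ is a regular triangulation of $\Omega$; $\mathcal{V}_h$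 is the space of functions continuous on $\overline\Omega$ and polynomial of first degree on each element of $\mathcal{T}_h$; $\mathcal{K}_h=\mathcal{V}_h\cap\mathcal{K}$; $\mathcal{V}_{h,\Sigma_D}$ is the space of $\mathbb{R}^d$-valued functions with components in $\mathcal{V}_h$ that belong to $H^1_{\Sigma_D}(\Omega)$. $g_h$ and $u_{meas,h}$ are ($\mathbb{R}^d$-valued, $L^2(\Sigma_N)$) approximations of given data $g,u_{meas}\in L^2(\Sigma_N)$. For $v_h\in\mathcal{K}_h$, $u_h(v_h)\in\mathcal{V}_{h,\Sigma_D}$ solves the discrete forward problem $\int_\Omega\mathbb{C}_\delta(v_h)\widehat\nabla u_h:\widehat\nabla\varphi_h=\int_{\Sigma_N}g_h\cdot\varphi_h$ for all $\varphi_h\in\mathcal{V}_{h,\Sigma_D}$, and $p_h(v_h)\in\mathcal{V}_{h,\Sigma_D}$ solves the discrete adjoint problem $\int_\Omega\mathbb{C}_\delta(v_h)\widehat\nabla p_h:\widehat\nabla\psi_h=\int_{\Sigma_N}(u_h(v_h)-u_{meas,h})\cdot\psi_h$ for all $\psi_h\in\mathcal{V}_{h,\Sigma_D}$. In the scheme, $\tau_n>0$ is the time step, $u_h^n=u_h(v_h^n)$, $p_h^n=p_h(v_h^n)$. $J_{\delta,\varepsilon,h}(v_h)=\frac12\|u_h(v_h)-u_{meas,h}\|^2_{L^2(\Sigma_N)}+\widetilde\alpha\int_\Omega\big(\varepsilon|\nabla v_h|^2+\frac1\varepsilon v_h(1-v_h)\big)$, and the discrete optimality condition reads $$\int_\Omega(\mathbb{C}_0-\mathbb{C}_1)(\omega_h-v_h)\widehat\nabla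 u_h(v_h):\widehat\nabla p_h(v_h)+2\widetilde\alpha\varepsilon\int_\Omega\nabla v_h\cdot\nabla(\omega_h-v_h)+\frac{\widetilde\alpha}\varepsilon\int_\Omega(1-2v_h)(\omega_h-v_h)\ge0\quad\forall\omega_h\in\mathcal{K}_h.$$ The constants $c^n$. For each $n$ there is a constant $c^n>0$ of the form $c^n=c^n(\Omega,\delta,\xi_0,h,\|\mathbb{C}_0-\mathbb{C}_1\|_{L^\infty(\Omega)},\|p_h^n\|_{W^{1,\infty}(\Omega)},\|u_h^n\|_{W^{1,\infty}(\Omega)})$ (i.e. depending only on these quantities) such that $\tau_n\le(1+c^n)^{-1}$ implies $\|v_h^{n+1}-v_h^n\|^2_{L^2(\Omega)}+J_{\delta,\varepsilon,h}(v_h^{n+1})\le J_{\delta,\varepsilon,h}(v_h^n)$. The theorem is understood as: such constants $c^n$, a number $\gamma>0$ and time steps $\tau_n$ can be chosen so that the conclusion holds. *)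

(* Defs.v *)
From HB Require Import structures.
From mathcomp Require Import all_boot all_order all_algebra.
From mathcomp Require Import all_classical all_reals all_analysis.
From mathcomp Require Import ess_sup_inf.

Set Implicit Arguments.
Unset Strict Implicit.
Unset Printing Implicit Defensive.
Import Order.TTheory GRing.Theory Num.Theory.
Import numFieldNormedType.Exports.

Local Open Scope classical_set_scope.
Local Open Scope ring_scope.

(* The coordinates generate the Borel sigma-algebra of 'rV[R]_n. *)
Definition rV_display : measure_display.
Proof. exact: default_measure_display. Qed.

Section measurable_rV.
Context (R : realType) (n : nat).

Definition rV_coord (i : 'I_n) (x : 'rV[R]_n) : measurableTypeR R := x 0 i.

Let rV_set0 : g_sigma_preimage rV_coord set0.
Proof. exact: sigma_algebra0. Qed.

Let rV_setC A : g_sigma_preimage rV_coord A -> g_sigma_preimage rV_coord (~` A).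
Proof. exact: sigma_algebraC. Qed.

Let rV_bigcup (F : _^nat) : (forall i, g_sigma_preimage rV_coord (F i)) ->
  g_sigma_preimage rV_coord (\bigcup_i (F i)).
Proof. exact: sigma_algebra_bigcup. Qed.

HB.instance Definition _ := @isMeasurable.Build rV_display
  'rV[R]_n (g_sigma_preimage rV_coord) rV_set0 rV_setC rV_bigcup.

End measurable_rV.

Section lebesgue_step.
Local Open Scope ereal_scope.
Context (R : realType) (n : nat).
Variable m : {sigma_finite_measure set 'rV[R]_n -> \bar R}.

Definition rV_cons (p : measurableTypeR R * 'rV[R]_n) : 'rV[R]_n.+1 :=
  row_mx (const_mx p.1 : 'rV_1) p.2.

Definition rV_uncons (x : 'rV[R]_n.+1) : measurableTypeR R * 'rV[R]_n :=
  ((x : 'rV_(1 + n)) 0%R (lshift n ord0), rsubmx (x : 'rV_(1 + n))).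

Lemma rV_consK : cancel rV_cons rV_uncons.
Proof.
by case=> a y; rewrite /rV_uncons /rV_cons/= row_mxEl row_mxKr mxE.
Qed.

Lemma rV_unconsK : cancel rV_uncons rV_cons.
Proof.
move=> x; rewrite -[RHS](@hsubmxK _ 1 1 n x) /rV_cons/=.
by rewrite (_ : const_mx _ = lsubmx (x : 'rV_(1 + n)))//;
  apply/rowP => i; rewrite !mxE/= (ord1 i).
Qed.

Lemma measurable_rV_coord k (i : 'I_k) : measurable_fun setT (@rV_coord R k i).
Proof.
move=> _ B mB; rewrite setTI; apply: sub_sigma_algebra => /=.
rewrite -bigcup_seq/=; exists i => /=; first by rewrite mem_index_enum.
by exists B => //; rewrite setTI.
Qed.

Lemma measurable_rVP d (T : measurableType d) k (f : T -> 'rV[R]_k) :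
  (forall i, measurable_fun setT (@rV_coord R k i \o f)) ->
  measurable_fun setT f.
Proof.
move=> mf.
suff prefS : g_sigma_preimage (fun i => @rV_coord R k i \o f) `<=` measurable.
  move=> _ A mA; apply: prefS.
  by rewrite g_sigma_preimage_comp; exists A.
apply: smallest_sub; first exact: sigma_algebra_measurable.
case: k => [|k] in f mf *; first by rewrite big_ord0.
rewrite -bigcup_mkord_ord; apply: bigcup_sub => i Ii.
by move=> A [B mB <-]; exact: mf.
Qed.

Lemma measurable_rV_cons : measurable_fun setT rV_cons.
Proof.
apply: measurable_rVP => i; case: (split_ordP (i : 'I_(1 + n))) => j ->.
- rewrite (_ : _ \o _ = fst); first exact: measurable_fst.
  apply/funext => p; rewrite /rV_coord/=.
  by transitivity ((const_mx p.1 : 'rV[R]_1) 0%R j); [exact: row_mxEl|rewrite mxE].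
- rewrite (_ : _ \o _ = @rV_coord R n j \o snd).
    by apply: measurableT_comp; [exact: measurable_rV_coord|exact: measurable_snd].
  by apply/funext => p; rewrite /rV_coord/=; exact: row_mxEr.
Qed.

Lemma measurable_rV_uncons : measurable_fun setT rV_uncons.
Proof.
apply: measurable_fun_pair.
  exact: (@measurable_rV_coord (1 + n) (lshift n ord0)).
apply: measurable_rVP => i.
rewrite (_ : _ \o _ = @rV_coord R (1 + n) (rshift 1 i)).
  exact: measurable_rV_coord.
by apply/funext => x; rewrite /rV_coord/= mxE.
Qed.

Definition lebesgue_step : set 'rV[R]_n.+1 -> \bar R :=
  pushforward (@lebesgue_measure R \x m) rV_cons.

Let lebesgue_step0 : lebesgue_step set0 = 0.
Proof. by rewrite /lebesgue_step /pushforward preimage_set0 measure0. Qed.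

Let lebesgue_step_ge0 A : 0 <= lebesgue_step A.
Proof. by rewrite /lebesgue_step /pushforward measure_ge0. Qed.

Let lebesgue_step_sigma_additive : semi_sigma_additive lebesgue_step.
Proof.
move=> F mF tF mUF; rewrite /lebesgue_step /pushforward preimage_bigcup.
apply: measure_semi_sigma_additive.
- by move=> k; rewrite -[X in measurable X]setTI; exact: measurable_rV_cons.
- apply/trivIsetP => /= i j _ _ ij; rewrite -preimage_setI.
  by move/trivIsetP : tF => /(_ _ _ _ _ ij) ->//; rewrite preimage_set0.
- rewrite -preimage_bigcup -[X in measurable X]setTI.
  exact: measurable_rV_cons.
Qed.

HB.instance Definition _ := isMeasure.Build _ _ _ lebesgue_step
  lebesgue_step0 lebesgue_step_ge0 lebesgue_step_sigma_additive.

Let lebesgue_step_sigma_finite : sigma_finite setT lebesgue_step.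
Proof.
have /sigma_finiteP[F [TF ndF Foo]] := sigma_finiteT (@lebesgue_measure R).
have /sigma_finiteP[G [TG ndG Goo]] := sigma_finiteT m.
exists (fun k => rV_uncons @^-1` (F k `*` G k)).
  rewrite -preimage_bigcup (_ : \bigcup_k _ = setT) ?preimage_setT//.
  rewrite -setXTT TF TG predeqE => -[x y]; split; first by move=> [k _ []]; split; exists k.
  move=> [/= [k _ Fkx] [l _ Gly]]; exists (maxn k l) => //; split.
  - by move: x Fkx; exact/subsetPset/ndF/leq_maxl.
  - by move: y Gly; exact/subsetPset/ndG/leq_maxr.
move=> k; have [? ?] := Foo k; have [? ?] := Goo k; split.
  rewrite -[X in measurable X]setTI; apply: measurable_rV_uncons => //.
  exact: measurableX.
rewrite /lebesgue_step /pushforward -comp_preimage.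
rewrite (_ : _ \o _ = id); last by apply/funext => p; exact: rV_consK.
by rewrite preimage_id product_measure1E// lte_mul_pinfty// ge0_fin_numE.
Qed.

HB.instance Definition _ := Measure_isSigmaFinite.Build _ _ _ lebesgue_step
  lebesgue_step_sigma_finite.

End lebesgue_step.

Section lebesgue_rV.
Context (R : realType).

Let dirac_sigma_finite : sigma_finite setT (@dirac _ 'rV[R]_0 0 R).
Proof.
by apply: fin_num_fun_sigma_finite => [|A _]; rewrite ?dirac0// /dirac.
Qed.

HB.instance Definition _ := Measure_isSigmaFinite.Build _ _ _
  (@dirac _ 'rV[R]_0 0 R) dirac_sigma_finite.

Fixpoint borel_lebesgue (n : nat) :
    {sigma_finite_measure set 'rV[R]_n -> \bar R} :=
  match n with
  | 0 => @dirac _ 'rV[R]_0 0 R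
  | k.+1 => lebesgue_step (borel_lebesgue k)
  end.

Definition lebesgue_rV (n : nat) :
    set (caratheodory_type (borel_lebesgue n)^*%mu) -> \bar R :=
  @completed_measure_extension _ _ R (borel_lebesgue n).

HB.instance Definition _ n := Measure.on (@lebesgue_rV n).

End lebesgue_rV.
Arguments lebesgue_rV : clear implicits.

Section frobenius.
Context (R : realType).

Definition ddot m n (A B : 'M[R]_(m, n)) : R := \sum_i \sum_j A i j * B i j.

Definition frob m n (A : 'M[R]_(m, n)) : R := Num.sqrt (ddot A A).

End frobenius.

Section hausdorff.
Local Open Scope ereal_scope.
Context (R : realType) (d : nat).

Definition ediam (A : set 'rV[R]_d) : \bar R :=
  maxe 0 (ereal_sup [set (frob (x - y))%:E | x in A & y in A]).

(* 1, 2, pi, 4 pi / 3, ... *)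
Fixpoint unit_ball_volume (s : nat) : R :=
  match s with
  | 0 => 1
  | 1 => 2
  | k.+2 => 2 * pi / k.+2%:R * unit_ball_volume k
  end.

(* The value +oo rules out the covers by sets of diameter > r. *)
Definition hausdorff_gauge (s : nat) (r : R)
    (A : set (g_sigma_algebraType (@discrete_measurable 'rV[R]_d))) : \bar R :=
  if A == set0 then 0 else if ediam A <= r%:E
  then (unit_ball_volume s / 2 ^+ s)%:E * ediam A ^+ s else +oo.

(* Every set is measurable in [discrete_measurable], so [mu_ext] is the infimum
   over all countable covers. *)
Definition hausdorff (s : nat) (A : set 'rV[R]_d) : \bar R :=
  ereal_sup [set mu_ext (hausdorff_gauge s r) A | r in [set r : R | (0 < r)%R]].

Lemma unit_ball_volume_ge0 s : (0 <= unit_ball_volume s)%R.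
Proof.
have [n] := ubnP s; elim: n s => // n IH [|[|s]]//= sn.
by rewrite !mulr_ge0 ?pi_ge0// IH// ltnW.
Qed.

Lemma hausdorff_gauge_ge0 s r A : 0 <= hausdorff_gauge s r A.
Proof.
rewrite /hausdorff_gauge; case: ifPn => // _; case: ifPn => // _.
apply: mule_ge0; first by rewrite lee_fin divr_ge0 ?unit_ball_volume_ge0.
by apply: expe_ge0; rewrite le_max lexx.
Qed.

Lemma hausdorff_gauge0 s r : hausdorff_gauge s r set0 = 0.
Proof. by rewrite /hausdorff_gauge eqxx. Qed.

Let hausdorff_set0 s : hausdorff s set0 = 0.
Proof.
apply/eqP; rewrite eq_le; apply/andP; split.
  apply: ge_ereal_sup => _ [r _ <-].
  by rewrite mu_ext0//; [exact: hausdorff_gauge0|exact: hausdorff_gauge_ge0].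
apply: ereal_sup_ubound; exists 1%R => /=; first exact: ltr01.
by rewrite mu_ext0//; [exact: hausdorff_gauge0|exact: hausdorff_gauge_ge0].
Qed.

Let hausdorff_ge0 s A : 0 <= hausdorff s A.
Proof.
apply: (@le_trans _ _ (mu_ext (hausdorff_gauge s 1) A)).
  by apply: mu_ext_ge0; exact: hausdorff_gauge_ge0.
by apply: ereal_sup_ubound; exists 1%R => //=; exact: ltr01.
Qed.

Let le_hausdorff s : {homo hausdorff s : A B / A `<=` B >-> A <= B}.
Proof.
move=> A B AB; apply: ge_ereal_sup => _ [r r0 <-].
apply: (@le_trans _ _ (mu_ext (hausdorff_gauge s r) B)); first exact: le_mu_ext.
by apply: ereal_sup_ubound; exists r.
Qed.

Let hausdorff_sigma_subadditive s : sigma_subadditive (hausdorff s).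
Proof.
move=> F; apply: ge_ereal_sup => _ [r r0 <-].
apply: (le_trans (@mu_ext_sigma_subadditive _ _ _ _
  (@hausdorff_gauge_ge0 s r) F)).
apply: lee_nneseries => i _.
  by move=> _; apply: mu_ext_ge0; exact: hausdorff_gauge_ge0.
by apply: ereal_sup_ubound; exists r.
Qed.

HB.instance Definition _ s := isOuterMeasure.Build R _ (hausdorff s)
  (hausdorff_set0 s) (hausdorff_ge0 s) (@le_hausdorff s)
  (@hausdorff_sigma_subadditive s).

Definition hausdorff_measure (s : nat) :
  set (caratheodory_type (hausdorff s)) -> \bar R := hausdorff s.

HB.instance Definition _ s := isMeasure.Build _ _ _ (@hausdorff_measure s)
  (@caratheodory_measure0 _ _ (hausdorff s))
  (@caratheodory_measure_ge0 _ _ (hausdorff s))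
  (@caratheodory_measure_sigma_additive _ _ (hausdorff s)).

End hausdorff.
Arguments hausdorff_measure : clear implicits.

Notation lebesgue_measurable_type R d :=
  (caratheodory_type (borel_lebesgue R d)^*%mu).

Section geometry.
Context (R : realType) (d : nat).
Implicit Types (Om A : set 'rV[R]_d) (K : 'M[R]_(d.+1, d)) (x : 'rV[R]_d).

Definition boundary A : set 'rV[R]_d := closure A `&` closure (~` A).

Definition distance x A : R := inf [set frob (x - y) | y in A].

(* The rows of K are the vertices, l are barycentric coordinates. *)
Definition barycentric (l : 'rV[R]_d.+1) : Prop :=
  (forall i, 0 <= l 0 i) /\ \sum_i l 0 i = 1.

Definition simplex K : set 'rV[R]_d :=
  [set x | exists2 l, barycentric l & x = l *m K].

Definition affinely_independent K : Prop :=
  forall l : 'rV[R]_d.+1, \sum_i l 0 i = 0 -> l *m K = 0 -> l = 0.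

Definition common_face K K' : set 'rV[R]_d :=
  [set x | exists2 l, barycentric l /\
     (forall i, l 0 i != 0 -> exists j, row i K = row j K') & x = l *m K].

Definition covers_by_simplices (s : seq 'M[R]_(d.+1, d)) A : Prop :=
  (forall K, K \in s -> affinely_independent K) /\
  A = [set x | exists2 K, K \in s & simplex K x].

Definition polyhedral Om : Prop := exists s, covers_by_simplices s (closure Om).

(* Near each boundary point Om lies above the graph, in a direction e, of a
   Lipschitz function of the component orthogonal to e. *)
Definition lipschitz_boundary Om : Prop :=
  forall x0, boundary Om x0 ->
  exists (r L : R) (e : 'rV[R]_d) (gam : 'rV[R]_d -> R),
    [/\ 0 < r, frob e = 1,
        forall x y, `|gam x - gam y| <= L * frob (x - y),
        forall x t, gam (x + t *: e) = gam x &
        forall x, frob (x - x0) < r -> (Om x <-> gam x < ddot x e)].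

Definition polyhedral_domain Om : Prop :=
  [/\ open Om, connected Om, bounded_set Om, polyhedral Om &
      lipschitz_boundary Om].

Definition conforming_triangulation Om (Th : seq 'M[R]_(d.+1, d)) : Prop :=
  covers_by_simplices Th (closure Om) /\
  forall K K', K \in Th -> K' \in Th ->
    simplex K `&` simplex K' = common_face K K'.

Definition diam A : R := fine (ediam A).

(* Mesh size at most h, and the ratio of the diameter of an element to that of
   its largest inscribed ball is bounded uniformly in h. *)
Definition regular_triangulations Om (h0 : R)
    (T : R -> seq 'M[R]_(d.+1, d)) : Prop :=
  exists2 sigma : R, 0 < sigma &
  forall h, 0 < h <= h0 ->
    conforming_triangulation Om (T h) /\
    forall K, K \in T h ->
      diam (simplex K) <= h /\
      exists c, forall y,
        frob (y - c) <= diam (simplex K) / (2 * sigma) -> simplex K y.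

End geometry.

Section spaces.
Context (R : realType) (d : nat).
Implicit Types (Om D : set 'rV[R]_d) (f v : 'rV[R]_d -> R)
  (u : 'rV[R]_d -> 'rV[R]_d).

Definition partial (j : 'I_d) f (x : 'rV[R]_d) : R := 'D_(delta_mx 0 j) f x.

(* Pointwise derivatives; for a continuous piecewise affine f they exist and
   agree with the weak ones outside a null set. *)
Definition grad f (x : 'rV[R]_d) : 'rV[R]_d := \row_j partial j f x.

Definition jac u (x : 'rV[R]_d) : 'M[R]_d :=
  \matrix_(i, j) partial j (fun y => u y 0 i) x.

Definition symm (A : 'M[R]_d) : 'M[R]_d := 2^-1 *: (A + A^T).

Definition symgrad u (x : 'rV[R]_d) : 'M[R]_d := symm (jac u x).

Definition L2 dd (T : measurableType dd) (mu : {measure set T -> \bar R})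
    (D : set T) (f : T -> R) : Prop :=
  measurable_fun D f /\ (\int[mu]_(x in D) ((f x) ^+ 2)%:E < +oo)%E.

Fixpoint Ck (k : nat) f : Prop :=
  match k with
  | 0 => continuous f
  | m.+1 => (forall x, differentiable f x) /\ forall j, Ck m (partial j f)
  end.

Definition test_function Om f : Prop :=
  [/\ forall k, Ck k f,
      compact (closure [set x | f x != 0]) &
      closure [set x | f x != 0] `<=` Om].

Definition H1 Om f : Prop :=
  L2 (lebesgue_rV R d) Om f /\
  forall j, exists2 G, L2 (lebesgue_rV R d) Om G &
    forall phi, test_function Om phi ->
      \int[lebesgue_rV R d]_(x in Om) (f x * partial j phi x) =
      - \int[lebesgue_rV R d]_(x in Om) (G x * phi x).

(* The trace of an H1 function on a Lipschitz boundary is, almost everywhere,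
   this limit of means over small balls. *)
Definition has_trace Om u (x t : 'rV[R]_d) : Prop :=
  \int[lebesgue_rV R d]_(y in Om `&` [set y | (frob (y - x) < r)%R])
    frob (u y - t) /
  fine (lebesgue_rV R d (Om `&` [set y | (frob (y - x) < r)%R]))
  @[r --> 0^'+] --> (0 : R).

Definition H1_zero_trace Om SigD u : Prop :=
  (forall i, H1 Om (fun x => u x 0 i)) /\
  hausdorff d.-1 (SigD `&` [set x | ~ has_trace Om u x 0]) = 0%E.

Definition Linf Om f : \bar R :=
  ess_sup (lebesgue_rV R d) ((fun x => `|f x|%:E) \_ Om).

Definition W1inf Om f : \bar R :=
  (Linf Om f + Linf Om (fun x => frob (grad f x)))%E.

Definition W1inf_vec Om u : \bar R :=
  (Linf Om (fun x => frob (u x)) + Linf Om (fun x => frob (jac u x)))%E.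

Definition P1 Om (Th : seq 'M[R]_(d.+1, d)) f : Prop :=
  {within closure Om, continuous f} /\
  forall K, K \in Th -> exists a b, forall x, simplex K x -> f x = ddot x a + b.

Definition P1_zero_trace Om SigD Th u : Prop :=
  (forall i, P1 Om Th (fun x => u x 0 i)) /\ H1_zero_trace Om SigD u.

Definition admissible Om (d0 : R) v : Prop :=
  [/\ H1 Om v,
      {ae lebesgue_rV R d, forall x, Om x -> 0 <= v x <= 1} &
      {ae lebesgue_rV R d, forall x, Om x ->
        distance x (boundary Om) <= d0 / 2 -> v x = 0}].

Definition P1_admissible Om d0 Th v : Prop := P1 Om Th v /\ admissible Om d0 v.

End spaces.

Section tensors.
Context (R : realType) (d : nat).

Definition tensor4 := 'I_d -> 'I_d -> 'I_d -> 'I_d -> R.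

Implicit Types (C : 'rV[R]_d -> tensor4) (Om : set 'rV[R]_d).

Definition tapp (C : tensor4) (A : 'M[R]_d) : 'M[R]_d :=
  \matrix_(i, j) \sum_k \sum_h C i j k h * A k h.

Definition tnorm (C : tensor4) : R :=
  Num.sqrt (\sum_i \sum_j \sum_k \sum_h C i j k h ^+ 2).

Definition elasticity_tensor Om (xi0 : R) C : Prop :=
  [/\ forall x, Om x -> forall i j k h,
        C x i j k h = C x j i k h /\ C x i j k h = C x k h i j,
      forall i j k h, measurable_fun
        (Om : set (lebesgue_measurable_type R d)) (fun x => C x i j k h),
      exists M, forall x, Om x -> forall i j k h, `|C x i j k h| <= M &
      {ae lebesgue_rV R d, forall x, Om x -> forall A : 'M[R]_d,
        xi0 * frob (symm A) ^+ 2 <= ddot (tapp (C x) (symm A)) (symm A)}].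

End tensors.

Record problem (R : realType) (d : nat) := Problem {
  domain : set 'rV[R]_d;
  SigmaD : set 'rV[R]_d;
  SigmaN : set 'rV[R]_d;
  mesh : seq 'M[R]_(d.+1, d);
  d0 : R;
  C0 : 'rV[R]_d -> tensor4 R d;
  delta : R;
  eps : R;
  alpha : R;
  gh : 'rV[R]_d -> 'rV[R]_d;
  umeas : 'rV[R]_d -> 'rV[R]_d
}.

Section discrete.
Context (R : realType) (d : nat) (P : problem R d).
Implicit Types (v w : 'rV[R]_d -> R) (u p phi psi : 'rV[R]_d -> 'rV[R]_d).

Local Notation "\int_Omega f" := (\int[lebesgue_rV R d]_(x in domain P) f x)
  (at level 36, f at level 8).
Local Notation "\int_SigmaN f" :=
  (\int[hausdorff_measure R d d.-1]_(x in SigmaN P) f x)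
  (at level 36, f at level 8).

Definition Kh v : Prop := P1_admissible (domain P) (d0 P) (mesh P) v.

Definition VhD u : Prop := P1_zero_trace (domain P) (SigmaD P) (mesh P) u.

Definition C1 (x : 'rV[R]_d) : tensor4 R d :=
  fun i j k h => delta P * C0 P x i j k h.

Definition C0_sub_C1 (x : 'rV[R]_d) : tensor4 R d :=
  fun i j k h => C0 P x i j k h - C1 x i j k h.

Definition Cdelta v (x : 'rV[R]_d) : tensor4 R d :=
  fun i j k h => C0 P x i j k h + (C1 x i j k h - C0 P x i j k h) * v x.

Definition talpha : R := 4 / pi * alpha P.

Definition bilinear v u phi : R :=
  \int_Omega (fun x => ddot (tapp (Cdelta v x) (symgrad u x)) (symgrad phi x)).

(* Elements of VhD are continuous up to the boundary: their traces on SigmaN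
   are their values. *)
Definition forward_problem v u : Prop :=
  VhD u /\ forall phi, VhD phi ->
    bilinear v u phi = \int_SigmaN (fun x => ddot (gh P x) (phi x)).

Definition uh v : 'rV[R]_d -> 'rV[R]_d :=
  xget (fun=> 0) [set u | forward_problem v u].

Definition adjoint_problem v p : Prop :=
  VhD p /\ forall psi, VhD psi ->
    bilinear v p psi =
    \int_SigmaN (fun x => ddot (uh v x - umeas P x) (psi x)).

Definition ph v : 'rV[R]_d -> 'rV[R]_d :=
  xget (fun=> 0) [set p | adjoint_problem v p].

Definition Jh v : R :=
  2^-1 * \int_SigmaN (fun x => frob (uh v x - umeas P x) ^+ 2) +
  talpha * \int_Omega (fun x =>
    eps P * frob (grad v x) ^+ 2 + (eps P)^-1 * (v x * (1 - v x))).

Definition misfit_derivative v w : R :=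
  \int_Omega (fun x => w x *
    ddot (tapp (C0_sub_C1 x) (symgrad (uh v) x)) (symgrad (ph v) x)).

Definition Jh_derivative v w : R :=
  misfit_derivative v w +
  2 * talpha * eps P * \int_Omega (fun x => ddot (grad v x) (grad w x)) +
  talpha / eps P * \int_Omega (fun x => (1 - 2 * v x) * w x).

Definition optimal v : Prop := forall w, Kh w -> 0 <= Jh_derivative v (w \- v).

Definition scheme_step (tau : R) v v' : Prop :=
  forall w, Kh w -> 0 <=
    tau^-1 * \int_Omega (fun x => (v' x - v x) * (w x - v' x)) +
    misfit_derivative v (w \- v') +
    2 * talpha * eps P *
      \int_Omega (fun x => ddot (grad v' x) (grad (w \- v') x)) +
    talpha / eps P * \int_Omega (fun x => (1 - 2 * v x) * (w x - v' x)).

Definition generated (tau : nat -> R) v0 (v : nat -> 'rV[R]_d -> R) : Prop :=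
  [/\ v 0%N = v0, forall n, Kh (v n) &
      forall n, scheme_step (tau n) (v n) (v n.+1)].

Definition energy_monotone v (c : R) : Prop :=
  forall (tau : R) v', 0 < tau <= (1 + c)^-1 -> Kh v' ->
    scheme_step tau v v' ->
    \int_Omega (fun x => (v' x - v x) ^+ 2) + Jh v' <= Jh v.

(* The value, at the iterate v, of a constant depending only on the three norms
   once the domain, the mesh, delta and xi0 are fixed. *)
Definition step_constant (c : R -> R -> R -> R) v : R :=
  c (fine (Linf (domain P) (fun x => tnorm (C0_sub_C1 x))))
    (fine (W1inf_vec (domain P) (ph v)))
    (fine (W1inf_vec (domain P) (uh v))).

End discrete.

(* Main.v *)
Require Import Defs.
From mathcomp Require Import all_boot all_order all_algebra.
From mathcomp Require Import all_classical all_reals all_analysis.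
From mathcomp Require Import ess_sup_inf measurable_realfun ring lra.
Import Order.TTheory GRing.Theory Num.Theory.
Import numFieldNormedType.Exports.
Set Implicit Arguments.
Unset Strict Implicit.
Unset Printing Implicit Defensive.
Local Open Scope classical_set_scope.
Local Open Scope ring_scope.

(** The P1 spaces are finite dimensional, so the scheme is an iteration on
    coordinate vectors in a compact convex set. Korn's uniqueness (a rigid motion
    that vanishes on a set of positive H^(d-1) measure is zero, because the zero
    set of a nonzero one has codimension at least 2) makes the discrete problems
    uniformly coercive; hence u_h and p_h are bounded and Lipschitz in v_h, and
    the trace on Sigma_N is controlled by the strain energy with a constant K.
    Expanding the misfit to second order and using Young's inequality gives the
    energy inequality with
      c = 1 + (N Q)^2 / 2 + (1 + K) (N U)^2 / (2 xi^2),  xi = xi0 min(1, delta),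
    where N, Q, U are the norms of C0 - C1, p_h and u_h. The latter are bounded
    over K_h, so a constant time step works. The energies decrease, so the
    increments tend to 0, and passing to the limit along a convergent subsequence
    of the coordinates yields the optimality condition. *)

(** The constant [c] must be fixed before [C0], [eps], [alpha] and the data. The trace constant
    therefore compares the boundary form with the plain strain energy, so that it depends on the
    mesh and the boundary pieces only; the coefficients enter through [xi] and the norms. The step
    takes the convex Dirichlet term implicitly and the concave term [v (1 - v)] explicitly. Both
    linearisation errors then have a favourable sign, and only the misfit has to be paid for by
    [tau^-1]. Discrete functions live on the whole space, but coordinates determine them on the
    closure of [Om] only, and [uh], [ph] are chosen by [xget]. Hence the many congruence lemmas, and
    hence existence in coordinates, which certifies that the chosen functions are solutions.
    Hausdorff measure enters in two ways: integrals over [SigN] need measurable sublevel sets and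
    faces of finite measure, and the zero trace needs affine pieces of low dimension to be null. *)

Section lebesgue_rV_facts.
Variable R : realType.
Implicit Types n : nat.

(** * Lebesgue measure on row vectors: hyperplanes, cubes, completeness *)

Lemma borel_measurable_lebesgue n (A : set 'rV[R]_n) : measurable A ->
  measurable (A : set (lebesgue_measurable_type R n)).
Proof. exact: caratheodory_measurable_mu_ext. Qed.

Lemma lebesgue_rVE n (A : set 'rV[R]_n) : measurable A ->
  lebesgue_rV R n A = borel_lebesgue R n A.
Proof. by move=> mA; rewrite /lebesgue_rV /completed_measure_extension measurable_mu_extE. Qed.

Lemma ddot_rowE n (x a : 'rV[R]_n) : ddot x a = \sum_i x 0 i * a 0 i.
Proof. by rewrite /ddot big_ord1. Qed.

Lemma borel_ddot n (a : 'rV[R]_n) :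
  measurable_fun [set: 'rV[R]_n] (fun x => ddot x a).
Proof.
rewrite (_ : (fun x => _) = (fun x => \sum_i a 0 i * rV_coord i x)); last first.
  by apply/funext => x; rewrite ddot_rowE; apply: eq_bigr => i _; rewrite mulrC.
apply: measurable_sum => i; apply: measurable_funM => //.
exact: measurable_rV_coord.
Qed.

Lemma borel_hyperplane n (a : 'rV[R]_n) b :
  measurable [set x : 'rV[R]_n | ddot x a = b].
Proof.
rewrite (_ : [set _ | _] = setT `&` (fun x => ddot x a) @^-1` [set b]).
  exact: borel_ddot.
by rewrite setTI.
Qed.

(** Induction on the dimension, splitting off the first coordinate. If the remaining part [a'] of
    the normal is 0, the hyperplane is a point times a space; otherwise each slice is a hyperplane
    of lower dimension, and Fubini concludes. *)
Lemma borel_hyperplane0 n (a : 'rV[R]_n) b : a != 0 ->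
  borel_lebesgue R n [set x | ddot x a = b] = 0%E.
Proof.
elim: n a b => [a b|n IH a b a0].
  by rewrite (_ : a = 0) ?eqxx//; apply/rowP => -[].
pose a1 := (a : 'rV_(1 + n)) 0 (lshift n ord0).
pose a' := rsubmx (a : 'rV_(1 + n)).
have dE t (y : 'rV[R]_n) : ddot (rV_cons (t, y)) a = t * a1 + ddot y a'.
  rewrite !ddot_rowE (@big_split_ord _ _ _ 1 n) big_ord1; congr (_ + _).
    by rewrite -/a1 /rV_cons [X in X * _](@row_mxEl _ 1 1 n) mxE.
  by apply: eq_bigr => i _; rewrite /rV_cons [X in X * _](@row_mxEr _ 1 1 n) /a' mxE.
rewrite /= /lebesgue_step /pushforward.
have -> : @rV_cons R n @^-1` [set x | ddot x a = b] =
    [set p | p.1 * a1 + ddot p.2 a' = b].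
  by apply/seteqP; split => -[t y] /=; rewrite -dE.
have [a'0|a'0] := eqVneq a' 0.
  have a10 : a1 != 0.
    apply: contra_neq a0 => a10; apply/rowP => i; rewrite mxE.
    case: (split_ordP (i : 'I_(1 + n))) => j ->; first by rewrite (ord1 j).
    by have /rowP/(_ j) := a'0; rewrite !mxE.
  rewrite (_ : [set p | _] = [set b / a1] `*` setT); last first.
    apply/seteqP; split => -[t y] /=.
      rewrite a'0 (_ : ddot y 0 = 0) ?addr0; last first.
        by rewrite ddot_rowE big1// => i _; rewrite mxE mulr0.
      by move=> <-; split => //; rewrite mulfK.
    move=> [-> _]; rewrite a'0 divfK// (_ : ddot y 0 = 0) ?addr0//.
    by rewrite ddot_rowE big1// => i _; rewrite mxE mulr0.
  rewrite product_measure1E//.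
  rewrite [X in (X * _)%E](_ : _ = 0%E) ?mul0e//; exact: lebesgue_measure_set1.
rewrite /product_measure1 /=; apply: integral0_eq => t _ /=.
rewrite (_ : xsection _ _ = [set y | ddot y a' = b - t * a1]); first exact: IH.
apply/seteqP; split => y; rewrite /xsection/= inE/=.
  by move=> <-; rewrite addrC addKr.
by move=> ->; rewrite addrCA subrr addr0.
Qed.

Lemma hyperplane_null n (a : 'rV[R]_n) b : a != 0 ->
  lebesgue_rV R n [set x | ddot x a = b] = 0%E.
Proof.
by move=> a0; rewrite lebesgue_rVE; [exact: borel_hyperplane0|exact: borel_hyperplane].
Qed.

(** These cubes are the balls of the topology on row vectors ([ballE_box]), and their volume is a
    product of lengths. *)
Definition box n (c : 'rV[R]_n) (r : R) : set 'rV[R]_n :=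
  [set x | forall i, `|x 0 i - c 0 i| < r].

Lemma borel_box n (c : 'rV[R]_n) r : measurable (box c r).
Proof.
rewrite (_ : box c r =
  \bigcap_(i in [set: 'I_n]) (rV_coord i @^-1` [set t | `|t - c 0 i| < r])); last first.
  apply/seteqP; split => x /= h i; first by move=> _; exact: h.
  exact: h.
apply: fin_bigcap_measurable => // i _.
rewrite -[X in measurable X]setTI; apply: measurable_rV_coord => //.
rewrite (_ : [set t | _] = `](c 0 i - r), (c 0 i + r)[%classic) //.
by apply/seteqP; split => t /=; rewrite in_itv/= ltr_distl.
Qed.

Lemma borel_lebesgue_box n (c : 'rV[R]_n) r : 0 < r ->
  borel_lebesgue R n (box c r) = ((2 * r) ^+ n)%:E.
Proof.
move=> r0; elim: n c => [c|n IH c].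
  by rewrite /= diracE mem_set// => -[].
rewrite /= /lebesgue_step /pushforward.
pose c1 := (c : 'rV_(1 + n)) 0 (lshift n ord0).
pose c' := rsubmx (c : 'rV_(1 + n)).
rewrite (_ : _ @^-1` _ = `](c1 - r), (c1 + r)[%classic `*` box c' r).
  rewrite product_measure1E//; last exact: borel_box.
  rewrite [X in (X * _)%E = _]lebesgue_measure_itv/= lte_fin.
  rewrite [X in (_ * X)%E = _]IH ifT; last by lra.
  rewrite -EFinB -EFinM exprS; congr (_%:E); congr (_ * _); lra.
apply/seteqP; split => -[t y] /=.
  move=> h; split.
    have := h (lshift n ord0 : 'I_(1 + n)); rewrite /rV_cons in_itv/= -ltr_distl.
    by rewrite -/c1 [X in `|X - _|](@row_mxEl _ 1 1 n) mxE.
  move=> i; have := h (rshift 1 i : 'I_(1 + n)).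
  by rewrite /rV_cons [X in `|X - _|](@row_mxEr _ 1 1 n) /c' mxE.
rewrite in_itv/= -ltr_distl => -[h1 h2] i.
case: (split_ordP (i : 'I_(1 + n))) => j ->.
  by rewrite /rV_cons [X in `|X - _|](@row_mxEl _ 1 1 n) mxE (ord1 j).
rewrite /rV_cons [X in `|X - _|](@row_mxEr _ 1 1 n).
by have := h2 j; rewrite /c' mxE.
Qed.

Lemma lebesgue_box n (c : 'rV[R]_n) r : 0 < r ->
  lebesgue_rV R n (box c r) = ((2 * r) ^+ n)%:E.
Proof. by move=> r0; rewrite lebesgue_rVE ?borel_lebesgue_box//; exact: borel_box. Qed.

Lemma ballE_box n (c : 'rV[R]_n) r : 0 < r -> ball c r = box c r.
Proof.
move=> r0; apply/seteqP; split => x; rewrite /ball/= /mx_ball.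
  by move=> [_ h] i; have := h 0 i; rewrite /ball/= distrC.
move=> h; split => // i j; rewrite (ord1 i) /ball/= distrC.
exact: h.
Qed.

(** Completeness of the measure. It settles the measurability of sets and functions that are
    controlled only off the hyperplanes of the mesh. *)
Lemma lebesgue_negligible_measurable n (A : set 'rV[R]_n) :
  (lebesgue_rV R n).-negligible A -> measurable (A : set (lebesgue_measurable_type R n)).
Proof. exact: measure_is_complete_caratheodory. Qed.

End lebesgue_rV_facts.

(** * The Frobenius inner product *)

Section frobenius_facts.
Variable R : realType.

Section ddot_mx.
Variables m n : nat.
Implicit Types A B C : 'M[R]_(m, n).

Lemma ddotC A B : ddot A B = ddot B A.
Proof. by apply: eq_bigr => i _; apply: eq_bigr => j _; rewrite mulrC. Qed.

Lemma ddotDl A B C : ddot (A + B) C = ddot A C + ddot B C.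
Proof.
rewrite /ddot -big_split; apply: eq_bigr => i _; rewrite -big_split.
by apply: eq_bigr => j _; rewrite mxE mulrDl.
Qed.

Lemma ddotZl a A B : ddot (a *: A) B = a * ddot A B.
Proof.
rewrite /ddot mulr_sumr; apply: eq_bigr => i _; rewrite mulr_sumr.
by apply: eq_bigr => j _; rewrite mxE mulrA.
Qed.

Lemma ddotDr A B C : ddot C (A + B) = ddot C A + ddot C B.
Proof. by rewrite ddotC ddotDl !(ddotC C). Qed.

Lemma ddotZr a A B : ddot A (a *: B) = a * ddot A B.
Proof. by rewrite ddotC ddotZl ddotC. Qed.

Lemma ddotNl A B : ddot (- A) B = - ddot A B.
Proof. by rewrite -scaleN1r ddotZl mulN1r. Qed.

Lemma ddotNr A B : ddot A (- B) = - ddot A B.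
Proof. by rewrite ddotC ddotNl ddotC. Qed.

Lemma ddotBl A B C : ddot (A - B) C = ddot A C - ddot B C.
Proof. by rewrite ddotDl ddotNl. Qed.

Lemma ddotBr A B C : ddot C (A - B) = ddot C A - ddot C B.
Proof. by rewrite ddotDr ddotNr. Qed.

Lemma ddot0l A : ddot 0 A = 0.
Proof. by rewrite -(scale0r (0 : 'M[R]_(m, n))) ddotZl mul0r. Qed.

Lemma ddot0r A : ddot A 0 = 0.
Proof. by rewrite ddotC ddot0l. Qed.

Lemma ddot_ge0 A : 0 <= ddot A A.
Proof. by apply: sumr_ge0 => i _; apply: sumr_ge0 => j _; rewrite -expr2 sqr_ge0. Qed.

Lemma entry_sqr_le_ddot A i j : A i j ^+ 2 <= ddot A A.
Proof.
rewrite /ddot (bigD1 i)//= (bigD1 j)//= -expr2 -addrA lerDl addr_ge0//.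
  by apply: sumr_ge0 => ? _; rewrite -expr2 sqr_ge0.
by apply: sumr_ge0 => ? _; apply: sumr_ge0 => ? _; rewrite -expr2 sqr_ge0.
Qed.

Lemma ddot_eq0 A : ddot A A = 0 -> A = 0.
Proof.
move=> A0; apply/matrixP => i j; rewrite mxE; apply/eqP.
by rewrite -sqrf_eq0 eq_le sqr_ge0 andbT -A0 entry_sqr_le_ddot.
Qed.

Lemma frob_ge0 A : 0 <= frob A. Proof. exact: sqrtr_ge0. Qed.

Lemma frob_sqr A : frob A ^+ 2 = ddot A A.
Proof. by rewrite sqr_sqrtr// ddot_ge0. Qed.

Lemma frob0 : frob (0 : 'M[R]_(m, n)) = 0.
Proof. by rewrite /frob ddot0l sqrtr0. Qed.

Lemma frob_eq0 A : frob A = 0 -> A = 0.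
Proof. by move=> A0; apply: ddot_eq0; rewrite -frob_sqr A0 expr0n. Qed.

Lemma frobN A : frob (- A) = frob A.
Proof. by rewrite /frob ddotNl ddotNr opprK. Qed.

Lemma frobC A B : frob (A - B) = frob (B - A).
Proof. by rewrite -frobN opprB. Qed.

Lemma frobZ a A : frob (a *: A) = `|a| * frob A.
Proof.
by rewrite /frob ddotZl ddotZr mulrA -expr2 sqrtrM ?sqr_ge0// sqrtr_sqr.
Qed.

Lemma entry_le_frob A i j : `|A i j| <= frob A.
Proof. by rewrite -sqrtr_sqr ler_wsqrtr// entry_sqr_le_ddot. Qed.

Lemma ddot_le_frob A B : `|ddot A B| <= frob A * frob B.
Proof.
rewrite -(@ler_pXn2r _ 2) ?nnegrE ?mulr_ge0 ?frob_ge0// exprMn !frob_sqr real_normK ?num_real//.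
set a := ddot A A; set b := ddot B B; set c := ddot A B.
have [b0|b0] := eqVneq b 0.
  by rewrite /c (ddot_eq0 b0) ddot0r expr0n b0 mulr0.
have b_gt0 : 0 < b by rewrite lt_neqAle eq_sym b0 ddot_ge0.
(* The square of [b A - c B] equals [b (a b - c^2)], and [b] is positive here. *)
have := ddot_ge0 (b *: A - c *: B).
rewrite ddotBl !ddotBr !ddotZl !ddotZr (ddotC B A) -/a -/b -/c.
rewrite (_ : _ - _ = b * (a * b - c ^+ 2)); last by ring.
by rewrite pmulr_rge0// subr_ge0.
Qed.

Lemma frobD A B : frob (A + B) <= frob A + frob B.
Proof.
rewrite -(@ler_pXn2r _ 2) ?nnegrE ?addr_ge0 ?frob_ge0// frob_sqr sqrrD !frob_sqr.
rewrite ddotDl !ddotDr (ddotC B A).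
have := ler_norm (ddot A B); have := ddot_le_frob A B; lra.
Qed.

Lemma frob_le_sum A : frob A <= \sum_i \sum_j `|A i j|.
Proof.
have s0 : 0 <= \sum_i \sum_j `|A i j| by do 2 apply: sumr_ge0 => ? _.
rewrite -[leRHS]ger0_norm// -sqrtr_sqr ler_wsqrtr// expr2 [leRHS]mulr_suml.
apply: ler_sum => i _; rewrite mulr_suml; apply: ler_sum => j _.
apply: (le_trans (ler_norm _)); rewrite normrM ler_wpM2l//.
rewrite (bigD1 i)//= (bigD1 j)//= -addrA lerDl addr_ge0//.
  exact: sumr_ge0.
by do 2 apply: sumr_ge0 => ? _.
Qed.

Lemma frob_le_entries A t : (forall i j, `|A i j| <= t) -> frob A <= m%:R * n%:R * t.
Proof.
move=> h; apply: (le_trans (frob_le_sum A)).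
apply: (@le_trans _ _ (\sum_(i < m) \sum_(j < n) t)).
  by apply: ler_sum => i _; apply: ler_sum => j _.
by rewrite !sumr_const !card_ord -mulrnA -[leLHS]mulr_natl natrM (mulrC n%:R).
Qed.

Lemma ddot_suml I (r : seq I) (F : I -> 'M[R]_(m, n)) B :
  ddot (\sum_(i <- r) F i) B = \sum_(i <- r) ddot (F i) B.
Proof. by elim/big_rec2: _ => [|i y x _ <-]; rewrite ?ddot0l// ddotDl. Qed.

Lemma ddot_sumr I (r : seq I) (F : I -> 'M[R]_(m, n)) B :
  ddot B (\sum_(i <- r) F i) = \sum_(i <- r) ddot B (F i).
Proof. by rewrite ddotC ddot_suml; apply: eq_bigr => i _; rewrite ddotC. Qed.

End ddot_mx.

Lemma ddot_mulmx m n (y : 'rV[R]_m) (D : 'M[R]_(m, n)) (a : 'rV[R]_n) :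
  ddot (y *m D) a = ddot y (a *m D^T).
Proof.
rewrite /ddot !big_ord1.
under eq_bigr do rewrite mxE mulr_suml.
rewrite exchange_big/=; apply: eq_bigr => i _; rewrite mxE mulr_sumr.
by apply: eq_bigr => j _; rewrite mxE; ring.
Qed.

Lemma frob_mulmx_le m n (D : 'M[R]_(m, n)) : exists2 L, 0 <= L &
  forall (y : 'rV[R]_m) t, (forall i, `|y 0 i| <= t) -> frob (y *m D) <= L * t.
Proof.
exists (n%:R * \sum_i \sum_j `|D i j|) => [|y t yt].
  by rewrite mulr_ge0//; do 2 apply: sumr_ge0 => ? _.
have -> : n%:R * (\sum_i \sum_j `|D i j|) * t =
  1%:R * n%:R * ((\sum_i \sum_j `|D i j|) * t) by ring.
apply: frob_le_entries => i j; rewrite (ord1 i) mxE.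
apply: (le_trans (ler_norm_sum _ _ _)); rewrite mulr_suml; apply: ler_sum => k _.
rewrite normrM mulrC; apply: ler_pM => //.
by rewrite (bigD1 j)//= lerDl sumr_ge0.
Qed.

Lemma ddot_delta n (a : 'rV[R]_n) j : ddot (delta_mx 0 j) a = a 0 j.
Proof.
rewrite /ddot big_ord1 (bigD1 j)//= mxE !eqxx mul1r big1 ?addr0// => i ij.
by rewrite mxE (negPf ij) andbF mul0r.
Qed.

Lemma frob_delta n j : frob (delta_mx 0 j : 'rV[R]_n) = 1.
Proof. by rewrite /frob ddot_delta mxE !eqxx sqrtr1. Qed.

End frobenius_facts.

(** * Hausdorff measure: separated sets, Lipschitz sublevel sets, affine pieces *)

Section hausdorff_facts.
Variables (R : realType) (d : nat).
Implicit Types (A B : set 'rV[R]_d) (s : nat).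

Lemma ediam_ge (A : set 'rV[R]_d) x y : A x -> A y ->
  ((frob (x - y))%:E <= ediam A)%E.
Proof.
move=> Ax Ay; rewrite /ediam le_max; apply/orP; right.
by apply: ereal_sup_ubound; exists x => //; exists y.
Qed.

Lemma ediam_le (A : set 'rV[R]_d) (t : R) : 0 <= t ->
  (forall x y, A x -> A y -> frob (x - y) <= t) -> (ediam A <= t%:E)%E.
Proof.
move=> t0 h; rewrite /ediam ge_max lee_fin t0/=.
by apply: ge_ereal_sup => _ [x Ax [y Ay <-]]; rewrite lee_fin h.
Qed.

Local Notation gauge := (@hausdorff_gauge R d).
Local Notation pre s r := (mu_ext (@hausdorff_gauge R d s r)).

Lemma hausdorff_discrete_measurable (A : set (g_sigma_algebraType (@discrete_measurable 'rV[R]_d))) :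
  measurable A.
Proof. exact: sub_sigma_algebra. Qed.

Lemma pre_le_gauge s r A : (pre s r A <= gauge s r A)%E.
Proof.
apply: ereal_inf_lbound.
exists (fun k => if k is 0%N return set (g_sigma_algebraType (@discrete_measurable 'rV[R]_d)) then A else set0).
  split=> [i|]; first exact: hausdorff_discrete_measurable.
  by move=> x Ax; exists 0%N.
rewrite (nneseries_split 0 1)/= ?add0n ?big_nat1 ?eseries0 ?adde0//.
- by move=> [|i]// _ _; rewrite hausdorff_gauge0.
- by move=> k _; exact: hausdorff_gauge_ge0.
Qed.

Lemma pre_subU s r A B : (pre s r (A `|` B) <= pre s r A + pre s r B)%E.
Proof.
pose F k := if k is 0%N then A else if k is 1%N then B else set0.
have := mu_ext_sigma_subadditive (@hausdorff_gauge_ge0 R d s r) F.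
rewrite (nneseries_split 0 2)/=; last by move=> k _; exact: mu_ext_ge0 (@hausdorff_gauge_ge0 R d s r) _.
rewrite add0n big_nat_recr//= big_nat1 eseries0 ?adde0 => [|[|[|i]]// _ _]; last first.
  by rewrite mu_ext0//; [exact: hausdorff_gauge0|exact: hausdorff_gauge_ge0].
apply: le_trans; apply: le_mu_ext => x [Ax|Bx]; [by exists 0%N|by exists 1%N].
Qed.

Lemma pre_le_sum s r (I : finType) (C : I -> set 'rV[R]_d) A :
  A `<=` [set x | exists i, C i x] ->
  (pre s r A <= \sum_i gauge s r (C i))%E.
Proof.
move=> AC.
suff h (l : seq I) : (pre s r [set x | exists2 i, i \in l & C i x] <=
    \sum_(i <- l) gauge s r (C i))%E.
  apply: le_trans (h (index_enum I)); apply: le_mu_ext => x /AC[i Ci].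
  by exists i => //; rewrite mem_index_enum.
elim: l => [|i l IH].
  rewrite big_nil (_ : [set _ | _] = set0); last by apply/seteqP; split => x //= -[].
  by rewrite mu_ext0//; [exact: hausdorff_gauge0|exact: hausdorff_gauge_ge0].
rewrite big_cons; apply: (@le_trans _ _ (pre s r (C i `|` [set x | exists2 i, i \in l & C i x]))).
  apply: le_mu_ext => x [j]; rewrite inE => /predU1P[->|jl] Cj; first by left.
  by right; exists j.
by apply: (le_trans (pre_subU _ _ _ _)); apply: leeD => //; exact: pre_le_gauge.
Qed.

(** A set of diameter at most [r < rho] cannot meet both [A] and [B], and a larger one has infinite
    gauge. So a cover of the union splits into a cover of [A] and a cover of [B]. *)
Lemma pre_separated s r rho A B : r < rho ->
  (forall x y, A x -> B y -> rho <= frob (x - y)) ->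
  (pre s r A + pre s r B <= pre s r (A `|` B))%E.
Proof.
move=> rrho AB; apply: le_ereal_inf_tmp => _ [F [mF ABF] <-].
pose G D k := if `[< F k `&` D !=set0 >] then F k else set0.
have preG D : D `<=` A `|` B -> (pre s r D <= \sum_(k <oo) gauge s r (G D k))%E.
  move=> DAB; apply: ereal_inf_lbound; exists (G D) => //; split=> [i|x Dx].
    exact: hausdorff_discrete_measurable.
  have [k _ Fk] := ABF _ (DAB _ Dx); exists k => //.
  by rewrite /G; case: asboolP => // -[]; exists x.
apply: (le_trans (leeD (preG A _) (preG B _))) => //; try by move=> x; [left|right].
rewrite -nneseriesD; try by move=> *; exact: hausdorff_gauge_ge0.
apply: lee_nneseries => [i _ _|k _]; first by rewrite adde_ge0// hausdorff_gauge_ge0.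
rewrite /G; case: asboolP => [[x [Fx Ax]]|_]; last first.
  by rewrite hausdorff_gauge0 add0e; case: ifP => // _; rewrite hausdorff_gauge0 hausdorff_gauge_ge0.
case: asboolP => [[y [Fy By]]|_]; last by rewrite hausdorff_gauge0 adde0.
rewrite {3}/hausdorff_gauge ifF; last by apply/eqP => F0; rewrite F0 in Fx.
rewrite ifF ?leey//; apply/negP => h.
have := le_trans (ediam_ge Fx Fy) h; rewrite lee_fin => h'.
by have := AB _ _ Ax By; lra.
Qed.

Lemma le_pre s r r' A : r' <= r -> (pre s r A <= pre s r' A)%E.
Proof.
move=> rr'; apply: le_ereal_inf_tmp => _ [F [mF AF] <-].
apply: (@le_trans _ _ (\sum_(k <oo) gauge s r (F k))%E).
  by apply: ereal_inf_lbound; exists F.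
apply: lee_nneseries => [*|k _]; first exact: hausdorff_gauge_ge0.
rewrite /hausdorff_gauge; case: ifPn => // _.
case: ifPn => h1; case: ifPn => h2//; first by rewrite leey.
by move: h1; rewrite (le_trans h2) ?lee_fin.
Qed.

(** The metric outer measure property, from which Caratheodory's criterion is derived below. *)
Lemma hausdorff_separated s rho A B : 0 < rho ->
  (forall x y, A x -> B y -> rho <= frob (x - y)) ->
  (hausdorff s A + hausdorff s B <= hausdorff s (A `|` B))%E.
Proof.
move=> rho0 AB.
have [->|foo] := eqVneq (hausdorff s (A `|` B)) +oo%E; first by rewrite leey.
have finAB : hausdorff s (A `|` B) \is a fin_num.
  by rewrite ge0_fin_numE ?outer_measure_ge0// lt_neqAle foo leey.
have finB : hausdorff s B \is a fin_num.
  rewrite ge0_fin_numE ?outer_measure_ge0//.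
  apply: (@le_lt_trans _ _ (hausdorff s (A `|` B))).
    by apply: le_outer_measure => x; right.
  by rewrite -ge0_fin_numE ?outer_measure_ge0.
rewrite -leeBrDr//; apply: ge_ereal_sup => _ [r1 r10 <-].
rewrite leeBrDr//.
have pre_ge0 r E : (0 <= pre s r E)%E by exact: mu_ext_ge0 (@hausdorff_gauge_ge0 R d s r) _.
have pre_le r E : 0 < r -> (pre s r E <= hausdorff s E)%E.
  by move=> r0; apply: ereal_sup_ubound; exists r.
have finA1 : pre s r1 A \is a fin_num.
  rewrite ge0_fin_numE//; apply: (@le_lt_trans _ _ (hausdorff s (A `|` B))).
    apply: (le_trans (pre_le _ _ r10)).
    by apply: le_outer_measure => x; left.
  by rewrite -ge0_fin_numE ?outer_measure_ge0.
rewrite addeC -leeBrDr//; apply: ge_ereal_sup => _ [r2 r20 <-].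
rewrite leeBrDr//.
(* At a scale below [r1], [r2] and [rho] the premeasures have only grown and are additive on the two
   sets. *)
pose r := Num.min (Num.min r1 r2) (rho / 2).
have r0 : 0 < r by rewrite !lt_min r10 r20/= divr_gt0.
apply: le_trans (pre_le _ _ r0).
have h : (pre s r A + pre s r B <= pre s r (A `|` B))%E.
  apply: (@pre_separated _ _ rho) => //.
  by apply: (@le_lt_trans _ _ (rho / 2)); [rewrite ge_min lexx orbT|lra].
apply: le_trans h; rewrite addeC; apply: leeD; apply: le_pre.
  by rewrite !ge_min lexx.
by rewrite !ge_min lexx orbT.
Qed.

Section lipschitz_measurable.
Variables (s : nat) (f : 'rV[R]_d -> R) (L : R).
Hypothesis L0 : 0 < L.
Hypothesis fL : forall x y, `|f x - f y| <= L * frob (x - y).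

Let H := @hausdorff R d s.

Lemma hausdorff_gap X a b : a < b ->
  (H (X `&` [set x | (f x <= a)%R]) + H (X `&` [set x | (b <= f x)%R]) <=
   H (X `&` [set x | (f x <= a)%R] `|` X `&` [set x | (b <= f x)%R]))%E.
Proof.
move=> ab; apply: (@hausdorff_separated _ ((b - a) / L)).
  by rewrite divr_gt0// subr_gt0.
move=> x y [_ /= fx] [_ /= fy]; rewrite ler_pdivrMr//.
have := fL x y; rewrite distrC => h; rewrite mulrC; apply: le_trans h.
apply: le_trans (ler_norm _); lra.
Qed.

(** Every other layer is kept, so consecutive ones are separated in level by the gap between
    [a (2i+2)] and [a (2i+1)], and [hausdorff_gap] adds them up. *)
Lemma hausdorff_layers X (a : nat -> R) n :
  (forall i j, (i < j)%N -> a j < a i) ->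
  (\sum_(i < n) H (X `&` [set x | (a i.*2.+1 <= f x <= a i.*2)%R]) <= H X)%E.
Proof.
move=> a_decr.
(* The induction needs the level above which the first [n] layers lie, so that the next layer is
   separated from all of them. *)
suff : (\sum_(i < n) H (X `&` [set x | (a i.*2.+1 <= f x <= a i.*2)%R]) <=
    H (X `&` [set x | (a n.*2.-1 <= f x)%R]))%E.
  by move=> /le_trans; apply; apply: le_outer_measure => x [].
elim: n => [|n IH]; first by rewrite big_ord0 outer_measure_ge0.
rewrite big_ord_recr/=.
have [n0|n0] := posnP n.
  rewrite n0 big_ord0 add0e; apply: le_outer_measure => x [Xx /= /andP[h _]].
  by split.
have lt_gap : a n.*2 < a n.*2.-1 by apply: a_decr; rewrite prednK// double_gt0.
have := hausdorff_gap (X `&` [set x | (a n.*2.+1 <= f x)%R]) lt_gap.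
set Y1 := (X in (H X + _ <= _)%E); set Y2 := (X in (_ + H X <= _)%E) => h.
rewrite addeC; apply: (@le_trans _ _ (H Y1 + H Y2)%E).
  apply: leeD.
    by apply: le_outer_measure => x [Xx /= /andP[h1 h2]]; split.
  apply: (le_trans IH); apply: le_outer_measure => x [Xx /= h1]; split => //; split => //=.
  by apply: le_trans h1; apply: ltW; apply: a_decr; rewrite (leq_ltn_trans (leq_pred _)).
apply: (le_trans h); apply: le_outer_measure => x [[[Xx h1] _]|[[Xx h1] _]]; by split.
Qed.

(** Caratheodory's criterion, run on the levels of a Lipschitz function: the part of [X] above level
    [c] is approximated from inside by parts at a positive distance from the sublevel set. *)
Lemma caratheodory_sublevel c : H.-caratheodory [set x | f x <= c].
Proof.
apply: le_caratheodory_measurable => X.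
suff : (H (X `&` [set x | (f x <= c)%R]) + H (X `&` ~` [set x | (f x <= c)%R]) <= H X)%E by [].
have [->|foo] := eqVneq (H X) +oo%E; first by rewrite leey.
have finX : H X \is a fin_num.
  by rewrite ge0_fin_numE ?outer_measure_ge0// lt_neqAle foo leey.
(* Levels decreasing to [c]; [Rg k] is the layer of [X] between two consecutive ones. *)
pose a (k : nat) : R := c + k.+1%:R^-1.
have a_decr i j : (i < j)%N -> a j < a i.
  by move=> ij; rewrite /a ltrD2l ltf_pV2 ?posrE ?ltr0n// ltr_nat ltnS.
pose Rg k := X `&` [set x | (a k.+1 <= f x <= a k)%R].
(* Layers of equal parity are separated, so each parity contributes at most [H X]. *)
have sumR : (\sum_(0 <= k <oo) H (Rg k) <= H X + H X)%E.
  apply: lime_le; first by apply: is_cvg_nneseries => *; exact: outer_measure_ge0.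
  apply: nearW => n; rewrite big_mkord.
  have up : (\sum_(i < n) H (Rg i) <= \sum_(i < n.*2) H (Rg i))%E.
    rewrite -!(big_mkord xpredT (fun i => H (Rg i))) [leRHS](@big_cat_nat _ _ _ n)//=; last first.
      by rewrite -addnn leq_addr.
    by apply: leeDl; apply: sume_ge0 => *; exact: outer_measure_ge0.
  apply: (le_trans up).
  have -> : (\sum_(i < n.*2) H (Rg i) =
     \sum_(i < n) H (Rg i.*2) + \sum_(i < n) H (Rg i.*2.+1))%E.
    elim: n {up} => [|n IH]; first by rewrite !big_ord0 adde0.
    by rewrite doubleS !big_ord_recr/= IH addeACA addeA.
  apply: leeD; first exact: (hausdorff_layers X n a_decr).
  by apply: (hausdorff_layers X n (a := fun k => a k.+1)) => i j ij; apply: a_decr; rewrite ltnS.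
set A := [set x | f x <= c].
(* Above level [a n] the set is separated from [A]; the rest of the complement lies in the layers of
   index at least [n], whose sum tends to 0. *)
have step n : (H (X `&` A) + H (X `&` ~` A) <= H X + \sum_(n <= k <oo) H (Rg k))%E.
  have h1 : (H (X `&` ~` A) <= H (X `&` [set x | (a n <= f x)%R]) +
      \sum_(n <= k <oo) H (Rg k))%E.
    apply: (@le_trans _ _ (H (X `&` [set x | (a n <= f x)%R] `|` \bigcup_k (Rg (k + n)%N)))).
      apply: le_outer_measure => x [Xx /negP]; rewrite -ltNge => cx.
      have [h|h] := lerP (a n) (f x); [by left|right].
      have [m mP] : exists m, a m < f x.
        have /archi_boundP : 0 <= (f x - c)^-1 by rewrite invr_ge0 subr_ge0 ltW.
        set N := Num.bound _ => hN; exists N.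
        rewrite /a -ltrBrDl invf_plt ?posrE ?subr_gt0//.
        by apply: (lt_le_trans hN); rewrite ler_nat.
      have nm : (n < m)%N.
        rewrite ltnNge; apply/negP => mn.
        have : a n <= a m by case: (ltngtP m n) mn => // [/a_decr/ltW|->].
        by move=> /le_lt_trans/(_ mP)/(lt_trans h); rewrite ltxx.
      (* The least level index not above [f x] locates the layer of [x]. *)
      have [k kP kmin] := ex_minnP (ex_intro (fun m => a m <= f x) m (ltW mP)).
      have nk : (n < k)%N.
        rewrite ltnNge; apply/negP => kn.
        have : a n <= a k by case: (ltngtP k n) kn => // [/a_decr/ltW|->].
        by move=> /le_trans/(_ kP); rewrite leNgt h.
      exists (k.-1 - n)%N => //; rewrite subnK; last by rewrite -ltnS prednK// (leq_ltn_trans _ nk).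
      split => //=; rewrite prednK ?kP/=; last by rewrite (leq_ltn_trans _ nk).
      rewrite leNgt; apply/negP => /ltW/kmin.
      by rewrite leqNgt prednK ?leqnn// (leq_ltn_trans _ nk).
    apply: (le_trans (outer_measureU2 _ _ _)); apply: leeD => //.
    rewrite -nneseries_addn; last by move=> *; exact: outer_measure_ge0.
    exact: outer_measure_sigma_subadditive.
  apply: (le_trans (leeD (lexx _) h1)); rewrite addeA; apply: leeD => //.
  have ca : c < a n by rewrite /a ltrDl invr_gt0 ltr0n.
  apply: (le_trans (hausdorff_gap X ca)); apply: le_outer_measure => x.
  by case=> -[].
have tail0 := nneseries_tail_cvg (le_lt_trans sumR _) (fun k _ => outer_measure_ge0 _ (Rg k)).
have {}tail0 : (\sum_(n <= k <oo) H (Rg k))%E @[n --> \oo] --> 0%E.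
  by apply: tail0; rewrite -ge0_fin_numE ?fin_numD ?finX// adde_ge0 ?outer_measure_ge0.
have : (H X + \sum_(n <= k <oo) H (Rg k))%E @[n --> \oo] --> (H X + 0)%E.
  apply: cvgeD => //; last exact: cvg_cst.
  by rewrite fin_num_adde_defr.
rewrite adde0 => /cvg_lim <-//; apply: lime_ge; last by apply: nearW.
apply/cvg_ex; exists (H X + 0)%E; apply: cvgeD => //; last exact: cvg_cst.
by rewrite fin_num_adde_defr.
Qed.

End lipschitz_measurable.

Lemma hausdorff_ddot s (a : 'rV[R]_d) :
  measurable_fun [set: caratheodory_type (@hausdorff R d s)] (fun x => ddot x a).
Proof.
move=> _; apply: (measurability _ (RGenCInfty.measurableE R)) => //.
move=> _ [_ [c ->] <-]; rewrite setTI.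
rewrite (_ : _ @^-1` _ = [set x | - ddot x a <= - c]); last first.
  by apply/seteqP; split => x /=; rewrite in_itv/= andbT lerN2.
(* Adding 1 keeps the Lipschitz constant positive when [a] is 0. *)
apply: (@caratheodory_sublevel s (fun x => - ddot x a) (frob a + 1)).
  by have := frob_ge0 a; lra.
move=> x y; rewrite -opprD normrN -ddotBl.
apply: (le_trans (ddot_le_frob _ _)); rewrite mulrC ler_wpM2r ?frob_ge0//; lra.
Qed.

Section affine_pieces.
Variables (m : nat) (x0 : 'rV[R]_d) (D : 'M[R]_(m, d)) (rho : R).
Hypothesis rho0 : 0 <= rho.

Let piece := [set x | exists2 y : 'rV[R]_m, (forall i, `|y 0 i| <= rho) & x = x0 + y *m D].

(** The parameter cube is cut into [N^m] cells of edge [2 rho / N]. The linear map [D] sends each to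
    a set of diameter at most [C / N], where [C] is [2 rho] times the bound [L] of [D]; this set is
    admissible at scale [r] once [C <= r N]. *)
Lemma hausdorff_piece_bound s : exists2 C : R, 0 <= C & forall r N, 0 < r -> (0 < N)%N ->
  C <= r * N%:R -> (pre s r piece <= (N%:R ^+ m * (unit_ball_volume R s / 2 ^+ s * (C / N%:R) ^+ s))%:E)%E.
Proof.
have [L L0 HL] := frob_mulmx_le D.
exists (L * (2 * rho)) => [|r N r0 N0 CN]; first by rewrite !mulr_ge0.
have N0' : 0 < N%:R :> R by rewrite ltr0n.
(* Midpoints of the [N] cells of the interval from [-rho] to [rho]. *)
pose c (j : 'I_N) : R := - rho + (2 * j%:R + 1) * (rho / N%:R).
pose C (g : {ffun 'I_m -> 'I_N}) : set 'rV[R]_d :=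
  [set x | exists2 y : 'rV[R]_m, (forall i, `|y 0 i - c (g i)| <= rho / N%:R) & x = x0 + y *m D].
have cover t : `|t| <= rho -> exists j, `|t - c j| <= rho / N%:R.
  rewrite ler_norml => /andP[t1 t2].
  have [rho_eq0|rho_neq0] := eqVneq rho 0.
    exists (Ordinal N0); rewrite /c rho_eq0 mul0r mulr0 addr0 oppr0 subr0.
    by rewrite rho_eq0 oppr0 in t1 t2; rewrite (_ : t = 0) ?normr0//; lra.
  have rho_gt0 : 0 < rho by lra.
  pose z := (t + rho) / (2 * rho) * N%:R.
  have z0 : 0 <= z by rewrite !mulr_ge0 ?invr_ge0//; lra.
  have tE : t = - rho + 2 * z * (rho / N%:R).
    by rewrite /z; field; rewrite rho_neq0 lt0r_neq0.
  have zN : z <= N%:R.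
    by rewrite /z ler_piMl// ler_pdivrMr; lra.
  have zt := truncn_itv z0.
  have [zlt|zge] := ltnP (Num.truncn z) N.
    exists (Ordinal zlt); rewrite /c tE /=.
    rewrite (_ : _ - _ = (2 * (z - (Num.truncn z)%:R) - 1) * (rho / N%:R)); last by ring.
    rewrite normrM (ger0_norm (_ : 0 <= rho / N%:R)) ?divr_ge0//.
    rewrite ler_piMl ?divr_ge0// ler_norml.
    by move: zt => /andP[]; rewrite -natr1; lra.
  (* Only the right end point [t = rho] escapes the half-open cells; it goes into the last one. *)
  have z_eq : z = N%:R.
    apply/eqP; rewrite eq_le zN/=; move: zt => /andP[+ _]; apply: le_trans.
    by rewrite ler_nat.
  have Np : (N.-1 < N)%N by rewrite prednK.
  exists (Ordinal Np); rewrite /c tE z_eq /=.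
  have -> : N%:R = N.-1%:R + 1 :> R by rewrite natr1 prednK.
  rewrite (_ : _ - _ = (rho / (N.-1%:R + 1))); last by ring.
  by rewrite ger0_norm// divr_ge0// addr_ge0.
have pieceC : piece `<=` [set x | exists g, C g x].
  move=> x [y yrho ->]; have := fun i => cover _ (yrho i).
  by move=> /choice[g hg]; exists [ffun i => g i], y => // i; rewrite ffunE.
apply: (le_trans (pre_le_sum s r pieceC)).
have gC g : (gauge s r (C g) <= (unit_ball_volume R s / 2 ^+ s * (L * (2 * rho) / N%:R) ^+ s)%:E)%E.
  have dC : (ediam (C g) <= (L * (2 * rho) / N%:R)%:E)%E.
    apply: ediam_le => [|_ _ [y1 h1 ->] [y2 h2 ->]]; first by rewrite !mulr_ge0 ?invr_ge0.
    rewrite opprD addrACA subrr add0r -mulmxBl -mulrA; apply: HL => i.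
    rewrite !mxE; have := h1 i; have := h2 i.
    rewrite !ler_norml; set q := rho / _; rewrite -mulrA -/q; lra.
  rewrite /hausdorff_gauge; case: ifPn => _.
    rewrite lee_fin mulr_ge0 ?divr_ge0 ?unit_ball_volume_ge0// exprn_ge0//.
    by rewrite !mulr_ge0 ?invr_ge0.
  rewrite ifT; last first.
    by apply: (le_trans dC); rewrite lee_fin ler_pdivrMr.
  have d0 : (0 <= ediam (C g))%E by rewrite /ediam le_max lexx.
  have dfin : ediam (C g) \is a fin_num.
    by rewrite ge0_fin_numE// (le_lt_trans dC)// ltey.
  rewrite -(fineK dfin) -EFin_expe -EFinM lee_fin.
  apply: ler_wpM2l; first by rewrite divr_ge0 ?unit_ball_volume_ge0.
  by apply: lerXn2r; rewrite ?nnegrE ?fine_ge0 ?mulr_ge0 ?invr_ge0// -lee_fin fineK.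
apply: (le_trans (lee_sum _ (fun g _ => gC g))).
have cE : #|{ffun 'I_m -> 'I_N}| = (N ^ m)%N by rewrite card_ffun !card_ord.
by rewrite sumEFin lee_fin sumr_const cE -[leLHS]mulr_natl natrX.
Qed.

Lemma hausdorff_piece_lty : (hausdorff m piece < +oo)%E.
Proof.
have [C C0 h] := hausdorff_piece_bound m.
apply: (@le_lt_trans _ _ (unit_ball_volume R m / 2 ^+ m * C ^+ m)%:E); last exact: ltey.
apply: ge_ereal_sup => _ [r r0 <-].
pose N := (Num.bound (C / r)).+1.
have N0 : 0 < N%:R :> R by rewrite ltr0n.
apply: (le_trans (h r N r0 _ _)) => //.
  rewrite mulrC -ler_pdivrMr//; apply: ltW; apply: lt_le_trans (archi_boundP _) _.
    by rewrite divr_ge0// ltW.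
  by rewrite ler_nat.
have Nm : N%:R ^+ m != 0 :> R by rewrite expf_neq0 ?lt0r_neq0.
by rewrite lee_fin expr_div_n mulrCA [X in _ * X]mulrCA divff// mulr1.
Qed.

(** The [N^m] cells contribute a multiple of [N^-s] each, and [m < s] leaves a factor of at most
    [1 / N]. *)
Lemma hausdorff_piece0 s : (m < s)%N -> hausdorff s piece = 0%E.
Proof.
move=> ms; apply/eqP; rewrite eq_le outer_measure_ge0 andbT.
have [C C0 h] := hausdorff_piece_bound s.
apply: ge_ereal_sup => _ [r r0 <-].
pose K := unit_ball_volume R s / 2 ^+ s * C ^+ s.
have K0 : 0 <= K by rewrite mulr_ge0 ?exprn_ge0// divr_ge0 ?unit_ball_volume_ge0.
apply/lee_addgt0Pr => e e0; rewrite add0e.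
(* The first bound makes the cells admissible at scale [r], the second makes [K / N] at most [e]. *)
pose N := (maxn (Num.bound (C / r)) (Num.bound (K / e))).+1.
have N1 : 1 <= N%:R :> R by rewrite ler1n.
have N0 : 0 < N%:R :> R by rewrite ltr0n.
apply: (le_trans (h r N r0 _ _)) => //.
  rewrite mulrC -ler_pdivrMr//; apply: ltW; apply: lt_le_trans (archi_boundP _) _.
    by rewrite divr_ge0// ltW.
  by rewrite ler_nat leqW// leq_maxl.
rewrite lee_fin expr_div_n.
rewrite (_ : _ * _ = K * (N%:R ^+ m / N%:R ^+ s)); last by rewrite /K; ring.
rewrite -(subnK ms) addnS -addSn exprD invfM mulrCA.
have Nk : N%:R <= N%:R ^+ (s - m.+1).+1 :> R.
  by rewrite exprS ler_peMr ?exprn_ege1// ltW.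
rewrite mulrCA [X in _ * X]mulrCA divff ?mulr1 ?expf_neq0 ?lt0r_neq0//.
apply: (@le_trans _ _ (K / N%:R)).
  by rewrite ler_wpM2l// lef_pV2 ?posrE ?exprn_gt0.
rewrite ler_pdivrMr// mulrC -ler_pdivrMr//; apply: ltW; apply: lt_le_trans (archi_boundP _) _.
  by rewrite divr_ge0// ltW.
by rewrite ler_nat leqW// leq_maxr.
Qed.

End affine_pieces.

End hausdorff_facts.

(** * Neighbourhoods and continuity in the Frobenius norm *)

Section affine_functions.
Variables (R : realType) (d : nat).
Implicit Types (x y a : 'rV[R]_d).

(** The topology comes from the maximum norm. The two norms are equivalent with factor [d]; the
    [d + 1] in the radius avoids a division by 0. *)
Lemma nbhs_frobP x (U : set 'rV[R]_d) :
  nbhs x U <-> exists2 r, 0 < r & forall y, frob (y - x) < r -> U y.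
Proof.
split=> [/nbhs_ballP[r /= r0 rU]|[r r0 rU]].
  exists r => // y yr; apply: rU; rewrite ballE_box// => i.
  by apply: le_lt_trans yr; have := entry_le_frob (y - x) 0 i; rewrite !mxE.
apply/nbhs_ballP; exists (r / (d%:R + 1)) => /=; first by rewrite divr_gt0 ?ltr_wpDl.
move=> y; rewrite ballE_box ?divr_gt0 ?ltr_wpDl// => h; apply: rU.
apply: (@le_lt_trans _ _ (1%:R * d%:R * (r / (d%:R + 1)))).
  by apply: frob_le_entries => i j; rewrite (ord1 i) !mxE ltW.
rewrite mul1r mulrCA gtr_pMr// ltr_pdivrMr ?ltr_wpDl// mul1r; lra.
Qed.

Lemma lipschitz_frob_continuous (f : 'rV[R]_d -> R) L : 0 <= L ->
  (forall x y, `|f x - f y| <= L * frob (x - y)) -> continuous f.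
Proof.
move=> L0 fL x U /nbhs_ballP[e /= e0 eU]; apply/nbhs_frobP.
exists (e / (L + 1)) => [|y yx]; first by rewrite divr_gt0// ltr_wpDl.
apply: eU; rewrite /ball/=; apply: (le_lt_trans (fL _ _)); rewrite frobC mulrC.
move: yx; rewrite ltr_pdivlMr ?ltr_wpDl// => yx; apply: le_lt_trans yx.
by rewrite ler_wpM2l ?frob_ge0// lerDl.
Qed.

Lemma ddot_lipschitz a x y : `|ddot x a - ddot y a| <= frob a * frob (x - y).
Proof. by rewrite -ddotBl mulrC; exact: ddot_le_frob. Qed.

Lemma entry_le_norm x i : `|x 0 i| <= `|x|.
Proof.
by rewrite [leRHS]mx_normrE; apply: (@le_bigmax _ _ _ 0 (fun p => `|x p.1 p.2|) (0, i)).
Qed.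

End affine_functions.

Lemma eq_le_ereal (R : realType) (x y : \bar R) : x = y -> (x <= y)%E.
Proof. by move=> ->. Qed.

(** * Open sets and continuous functions are Borel *)

Section continuous_borel.
Variables (R : realType) (d : nat).

(** The sigma-algebra is generated by the coordinates. An open set belongs to it as the union of the
    countably many cubes with rational centre and radius [1 / (n + 1)] that it contains. *)
Lemma open_borel (U : set 'rV[R]_d) : open U -> measurable U.
Proof.
move=> oU; pose c (p : 'rV[rat]_d * nat) : 'rV[R]_d := map_mx ratr p.1.
pose F p := if `[< box (c p) p.2.+1%:R^-1 `<=` U >] then box (c p) p.2.+1%:R^-1 else set0.
rewrite (_ : U = \bigcup_p F p).
  apply: countable_bigcupT_measurable => [|p]; first exact: countableP.
  by rewrite /F; case: asboolP => _; [exact: borel_box|exact: measurable0].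
apply/seteqP; split => [x Ux|x [p _]]; last by rewrite /F; case: asboolP => // h; exact: h.
have /nbhs_ballP[e /= e0 eU] : nbhs x U by exact: open_nbhs_nbhs.
have [n ne] : exists n : nat, n.+1%:R^-1 < e / 2.
  have e2 : 0 <= (e / 2)^-1 by rewrite invr_ge0 ltW// divr_gt0.
  exists (Num.bound (e / 2)^-1); rewrite invf_plt ?posrE ?divr_gt0//.
  by apply: (lt_le_trans (archi_boundP e2)); rewrite ler_nat.
have n0 : 0 < n.+1%:R^-1 :> R by rewrite invr_gt0 ltr0n.
have /choice[q qP] : forall i, exists q : rat, `|x 0 i - ratr q| < n.+1%:R^-1.
  have lt_pm (a w : R) : 0 < w -> a - w < a + w by lra.
  move=> i; have /rat_in_itvoo[q] := lt_pm (x 0 i) _ n0; rewrite in_itv/= => qi; exists q.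
  by rewrite distrC ltr_distl.
exists (\row_i q i, n) => //; rewrite /F.
have -> : `[< box (c (\row_i q i, n)) n.+1%:R^-1 `<=` U >].
  apply/asboolP => y yq; apply: eU; rewrite ballE_box// => i.
  move: (yq i) (qP i) ne; rewrite /c !mxE !ltr_distl; move: (n.+1%:R^-1) => v; lra.
by move=> i; rewrite /c !mxE.
Qed.

Lemma continuous_borel (f : 'rV[R]_d -> R) : continuous f ->
  measurable_fun [set: 'rV[R]_d] f.
Proof.
move=> cf; apply: (measurability _ (RGenOInfty.measurableE R)) => //.
move=> _ [_ [a ->] <-]; rewrite setTI; apply: open_borel.
apply: (@open_comp 'rV[R]_d R) => [x _|]; first exact: cf.
exact: interval_open.
Qed.

Lemma ae_exists (A : set 'rV[R]_d) (P : 'rV[R]_d -> Prop) :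
  measurable (A : set (lebesgue_measurable_type R d)) -> (0 < lebesgue_rV R d A)%E ->
  {ae lebesgue_rV R d, forall x, P x} -> exists2 x, A x & P x.
Proof.
move=> mA A0 [N [mN N0 PN]]; apply: contrapT => h.
have : (lebesgue_rV R d A <= lebesgue_rV R d N)%E.
  apply: le_measure; rewrite ?inE// => x Ax; apply: PN => Px; apply: h.
  by exists x.
by rewrite N0 leNgt A0.
Qed.

Lemma lebesgue_open_gt0 (U : set 'rV[R]_d) : measurable (U : set (lebesgue_measurable_type R d)) ->
  open U -> U !=set0 -> (0 < lebesgue_rV R d U)%E.
Proof.
move=> mU oU [x Ux]; have /nbhs_ballP[r /= r0 rU] : nbhs x U by exact: open_nbhs_nbhs.
apply: (@lt_le_trans _ _ (lebesgue_rV R d (box x r))).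
  by rewrite lebesgue_box// lte_fin exprn_gt0// mulr_gt0.
apply: le_measure; rewrite ?inE//; last by rewrite -ballE_box.
by apply: borel_measurable_lebesgue; exact: borel_box.
Qed.

End continuous_borel.

(** * Barycentric coordinates and simplices *)

Section simplices.
Variables (R : realType) (d : nat).
Implicit Types (K : 'M[R]_(d.+1, d)) (x : 'rV[R]_d).

(** Homogeneous coordinates: the column of ones turns affine independence of the vertices into
    invertibility, see [augment_unit]. *)
Definition augment K : 'M[R]_(d.+1, 1 + d) := row_mx (const_mx 1) K.

(* Barycentric coordinates with respect to the rows of K, as affine functions
   of x on the whole space. *)
Definition bary_slope K (i : 'I_d.+1) : 'rV[R]_d :=
  (col i (dsubmx (invmx (augment K) : 'M[R]_(1 + d, d.+1))))^T.

Definition bary K x (i : 'I_d.+1) : R :=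
  ddot x (bary_slope K i) + (usubmx (invmx (augment K) : 'M[R]_(1 + d, d.+1))) 0 i.

Lemma bary_rowE K x :
  \row_i bary K x i = (row_mx (const_mx 1) x : 'rV_(1 + d)) *m invmx (augment K).
Proof.
apply/rowP => i; rewrite mxE /bary -[invmx _ in RHS](@vsubmxK _ 1 d).
rewrite mul_row_col [RHS]mxE [RHS]addrC; congr (_ + _); last first.
  by rewrite [RHS]mxE big_ord1 !mxE mul1r.
by rewrite ddot_rowE [RHS]mxE; apply: eq_bigr => j _; rewrite !mxE.
Qed.

Lemma augment_unit K : affinely_independent K -> augment K \in unitmx.
Proof.
move=> indK; rewrite -row_free_unit -kermx_eq0; apply/eqP/row_matrixP => i.
rewrite row0; set l := row i _.
have : l *m augment K = row_mx 0 0 by rewrite row_mx0 /l -row_mul mulmx_ker row0.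
rewrite /augment mul_mx_row => /eq_row_mx[l1 l2]; apply: indK => //.
have /rowP/(_ 0) := l1; rewrite !mxE => e; rewrite -[RHS]e.
by apply: eq_bigr => j _; rewrite [const_mx _ _ _]mxE mulr1.
Qed.

Lemma mul_augment K (l : 'rV[R]_d.+1) : \sum_i l 0 i = 1 ->
  l *m augment K = row_mx (const_mx 1) (l *m K).
Proof.
move=> l1; rewrite /augment mul_mx_row; congr row_mx.
apply/rowP => j; rewrite !mxE (ord1 j) -[RHS]l1.
by apply: eq_bigr => i _; rewrite mxE mulr1.
Qed.

Lemma bary_mulmx K (l : 'rV[R]_d.+1) i : affinely_independent K ->
  \sum_i l 0 i = 1 -> bary K (l *m K) i = l 0 i.
Proof.
move=> indK l1; have /rowP/(_ i) := bary_rowE K (l *m K).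
by rewrite mxE => ->; rewrite -mul_augment// mulmxK// augment_unit.
Qed.

Lemma bary_combination K x : affinely_independent K ->
  \sum_i bary K x i = 1 /\ (\row_i bary K x i) *m K = x.
Proof.
move=> indK; have : (\row_i bary K x i) *m augment K = row_mx (const_mx 1) x.
  by rewrite bary_rowE mulmxKV// augment_unit.
rewrite /augment mul_mx_row => /eq_row_mx[l1 ->]; split => //.
have /rowP/(_ 0) := l1; rewrite !mxE => <-.
by apply: eq_bigr => j _; rewrite !mxE mulr1.
Qed.

Lemma bary_vertex K i j : affinely_independent K ->
  bary K (row i K) j = (i == j)%:R.
Proof.
move=> indK; rewrite -[row i K]mulmx1 rowE mulmx1 bary_mulmx//.
  by rewrite mxE eqxx eq_sym.
rewrite (bigD1 i)//= mxE !eqxx big1 ?addr0// => k ki.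
by rewrite mxE (negPf ki) andbF.
Qed.

Lemma simplexP K x : affinely_independent K ->
  simplex K x <-> forall i, 0 <= bary K x i.
Proof.
move=> indK; have [b1 bK] := bary_combination x indK; split.
  by move=> [l [l0 l1] ->] i; rewrite bary_mulmx.
move=> b0; exists (\row_i bary K x i) => //; split => [i|]; first by rewrite mxE.
by rewrite -b1; apply: eq_bigr => i _; rewrite mxE.
Qed.

(** The coordinate is 1 at vertex [i] and 0 at another vertex, which exists as [d] is positive; so
    it is not constant. *)
Lemma bary_slope_neq0 K i : (0 < d)%N -> affinely_independent K ->
  bary_slope K i != 0.
Proof.
move=> d_gt0 indK; apply/eqP => s0.
have [j ji] : exists j : 'I_d.+1, j != i.
  have [->|i0] := eqVneq i ord0; last by exists ord0; rewrite eq_sym.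
  by exists ord_max; rewrite -val_eqE/= -lt0n.
have := bary_vertex j i indK; have := bary_vertex i i indK.
rewrite /bary s0 !ddot0r !add0r eqxx (negPf ji) => ->.
by move=> /eqP; rewrite oner_eq0.
Qed.

Lemma continuous_bary K i : continuous (fun x => bary K x i).
Proof.
apply: (@lipschitz_frob_continuous _ _ _ (frob (bary_slope K i))) => [|x y].
  exact: frob_ge0.
by rewrite /bary opprD addrACA subrr addr0; exact: ddot_lipschitz.
Qed.

(** Strict inequalities make openness immediate; a P1 function is affine in a neighbourhood of each
    of these points. *)
Definition inner_simplex K : set 'rV[R]_d := [set x | forall i, 0 < bary K x i].

Lemma open_inner_simplex K : open (inner_simplex K).
Proof.
rewrite openE => x Kx; apply: (@filter_forall _ _ _ _ (nbhs_filter x)) => i.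
exact: (cvgr_gt _ (@continuous_bary K i x) _ (Kx i)).
Qed.

Lemma inner_simplex_sub K : affinely_independent K -> inner_simplex K `<=` simplex K.
Proof. by move=> indK x h; apply/(simplexP x indK) => i; exact/ltW. Qed.

Lemma inner_simplex_neq0 K : affinely_independent K -> inner_simplex K !=set0.
Proof.
move=> indK; pose l : 'rV[R]_d.+1 := const_mx d.+1%:R^-1.
exists (l *m K) => i; rewrite bary_mulmx//; first by rewrite mxE invr_gt0 ltr0n.
under eq_bigr do rewrite mxE.
by rewrite sumr_const card_ord -[LHS]mulr_natl mulfV// pnatr_eq0.
Qed.

Section measurable_simplices.
Context dd (T : measurableType dd) (g : T -> 'rV[R]_d).
Hypothesis mg : forall a, measurable_fun setT (fun t => ddot (g t) a).

(** [g] is later the identity, read from the Borel sigma-algebra or from Caratheodory sets, so one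
    proof serves both measures. *)
Lemma measurable_bary K i : measurable_fun setT (fun t => bary K (g t) i).
Proof. by apply: measurable_funD => //; exact: mg. Qed.

Lemma measurable_bary_preimage K (Y : set R) : measurable Y ->
  measurable [set t | forall i, Y (bary K (g t) i)].
Proof.
move=> mY; rewrite (_ : [set t | _] =
    \bigcap_(i in [set: 'I_d.+1]) ((fun t => bary K (g t) i) @^-1` Y)).
  apply: fin_bigcap_measurable => // i _.
  by rewrite -[X in measurable X]setTI; exact: measurable_bary.
by apply/seteqP; split => t h i; [move=> _; exact: h|exact: h].
Qed.

Lemma measurable_simplex K : affinely_independent K -> measurable (g @^-1` simplex K).
Proof.
move=> indK; rewrite (_ : _ @^-1` _ = [set t | forall i, `[0, +oo[%classic (bary K (g t) i)]).
  exact: measurable_bary_preimage.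
by apply/seteqP; split => t /=; rewrite (simplexP _ indK) => h i; have := h i;
  rewrite in_itv/= andbT.
Qed.

Lemma measurable_inner_simplex K : measurable (g @^-1` inner_simplex K).
Proof.
rewrite (_ : _ @^-1` _ = [set t | forall i, `]0, +oo[%classic (bary K (g t) i)]).
  exact: measurable_bary_preimage.
by apply/seteqP; split => t /= h i; have := h i; rewrite in_itv/= andbT.
Qed.

End measurable_simplices.

Definition face K i : set 'rV[R]_d :=
  [set x | exists2 l, barycentric l /\ l 0 i = 0 & x = l *m K].

End simplices.

(** With the first remaining vertex as origin, the other barycentric coordinates parametrise the
    face affinely by part of a unit cube of dimension [d - 1]. *)
Lemma hausdorff_face_lty (R : realType) d (K : 'M[R]_(d.+1, d)) i : (0 < d)%N ->
  (hausdorff d.-1 (face K i) < +oo)%E.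
Proof.
case: d K i => // m K i _ /=.
pose F := row' i K; pose D : 'M[R]_(m, m.+1) := \matrix_(j < m) (row (lift ord0 j) F - row ord0 F).
apply: (le_lt_trans _ (@hausdorff_piece_lty R m.+1 m (row ord0 F) D 1 ler01)).
apply: le_outer_measure => _ [l [[l0 l1] li] ->].
have sumF : l *m K = \sum_(j < m.+1) l 0 (lift i j) *: row j F.
  rewrite mulmx_sum_row (bigD1_ord i)//= li scale0r add0r.
  by apply: eq_bigr => j _; rewrite row_rowsub.
have sum1 : \sum_(j < m.+1) l 0 (lift i j) = 1.
  by rewrite -l1 (bigD1_ord i)//= li add0r.
exists (\row_j l 0 (lift i (lift ord0 j))) => [j|].
  rewrite mxE ger0_norm// -sum1 (bigD1 (lift ord0 j))//= lerDl.
  exact: sumr_ge0.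
rewrite sumF mulmx_sum_row big_ord_recl.
under [in RHS]eq_bigr => j _ do rewrite mxE rowK scalerBr.
rewrite big_split/= sumrN -scaler_suml.
rewrite addrA addrAC -{2}(scale1r (row ord0 F)) -scalerBl.
by rewrite -[in RHS]sum1 big_ord_recl addrK.
Qed.

Section null_and_finite_unions.
Local Open Scope ereal_scope.

Lemma outer_measure_seq_lty (R : realType) T (mu : {outer_measure set T -> \bar R})
    (I : eqType) (l : seq I) (A : I -> set T) :
  (forall i, i \in l -> mu (A i) < +oo) ->
  mu [set x | exists2 i, i \in l & A i x] < +oo.
Proof.
elim: l => [|i l IH] h.
  rewrite (_ : [set _ | _] = set0) ?outer_measure0 ?ltey//.
  by apply/seteqP; split => x // -[].
apply: (@le_lt_trans _ _ (mu (A i `|` [set x | exists2 i, i \in l & A i x]))).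
  apply: le_outer_measure => x [j]; rewrite inE => /predU1P[->|jl] Aj; [by left|right].
  by exists j.
apply: (le_lt_trans (outer_measureU2 _ _ _)); apply: lte_add_pinfty.
  by apply: h; rewrite mem_head.
by apply: IH => j jl; apply: h; rewrite inE jl orbT.
Qed.

Lemma negligible_seq d (T : measurableType d) (R : realType)
    (mu : {measure set T -> \bar R}) (I : eqType) (l : seq I) (A : I -> set T) :
  (forall i, i \in l -> mu.-negligible (A i)) ->
  mu.-negligible [set x | exists2 i, i \in l & A i x].
Proof.
elim: l => [|i l IH] h.
  rewrite (_ : [set _ | _] = set0); first exact: negligible_set0.
  by apply/seteqP; split => x // -[].
apply: (@negligibleS _ _ _ _ (A i `|` [set x | exists2 i, i \in l & A i x])).
  move=> x [j]; rewrite inE => /predU1P[->|jl] Aj; [by left|right].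
  by exists j.
apply: negligibleU; first by apply: h; rewrite mem_head.
by apply: IH => j jl; apply: h; rewrite inE jl orbT.
Qed.

Lemma measurable_union_seq dd (T : measurableType dd) (I : eqType) (l : seq I) (A : I -> set T) :
  (forall i, i \in l -> measurable (A i)) -> measurable [set x | exists2 i, i \in l & A i x].
Proof.
elim: l => [|i l IH] h.
  by rewrite (_ : [set _ | _] = set0)//; apply/seteqP; split => x // -[].
rewrite (_ : [set _ | _] = A i `|` [set x | exists2 i, i \in l & A i x]).
  apply: measurableU; first by apply: h; rewrite mem_head.
  by apply: IH => j jl; apply: h; rewrite inE jl orbT.
apply/seteqP; split => x.
  move=> [j]; rewrite inE => /predU1P[->|jl] Aj; [by left|right].
  by exists j.
by move=> [Ai|[j jl Aj]]; [exists i; rewrite ?mem_head|exists j; rewrite ?inE ?jl ?orbT].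
Qed.

End null_and_finite_unions.

(** * Essentially bounded and square integrable functions *)

Section bounded_integrands.
Context dd (T : measurableType dd) (R : realType) (mu : {measure set T -> \bar R}).
Variable D : set T.
Hypotheses (mD : measurable D) (muD : (mu D < +oo)%E).
Implicit Types f g : T -> R.

(** On a set of finite measure these functions form an algebra of integrable functions. The volume
    integrands built from P1 functions, their derivatives and [C0] all belong to it. *)
Definition essbdd f : Prop :=
  measurable_fun D f /\ exists M, {ae mu, forall x, D x -> `|f x| <= M}.

Lemma essbdd_integrable f : essbdd f -> mu.-integrable D (EFin \o f).
Proof.
move=> [mf [M fM]]; apply/integrableP; split; first exact/measurable_EFinP.
apply: (@le_lt_trans _ _ (\int[mu]_(x in D) (cst `|M|%:E x))%E); last first.
  by rewrite integral_cst// lte_mul_pinfty.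
apply: ae_ge0_le_integral => //.
- by apply: measurableT_comp => //; exact/measurable_EFinP.
- by move=> x _; rewrite lee_fin.
- by move: fM; apply: filterS => x h Dx; rewrite lee_fin (le_trans (h Dx))// ler_norm.
Qed.

Lemma essbdd_cst c : essbdd (fun=> c).
Proof. by split => //; exists `|c|; apply: aeW. Qed.

Lemma essbddD f g : essbdd f -> essbdd g -> essbdd (fun x => f x + g x).
Proof.
move=> [mf [M fM]] [mg [N gN]]; split; first exact: measurable_funD.
exists (M + N); move: fM gN; apply: filterS2 => x h1 h2 Dx.
by apply: (le_trans (ler_normD _ _)); apply: lerD; auto.
Qed.

Lemma essbddM f g : essbdd f -> essbdd g -> essbdd (fun x => f x * g x).
Proof.
move=> [mf [M fM]] [mg [N gN]]; split; first exact: measurable_funM.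
exists (`|M| * `|N|); move: fM gN; apply: filterS2 => x h1 h2 Dx.
rewrite normrM; apply: ler_pM => //.
  by apply: (le_trans (h1 Dx)); exact: ler_norm.
by apply: (le_trans (h2 Dx)); exact: ler_norm.
Qed.

Lemma essbddZ c f : essbdd f -> essbdd (fun x => c * f x).
Proof. by apply: essbddM; exact: essbdd_cst. Qed.

Lemma essbddB f g : essbdd f -> essbdd g -> essbdd (fun x => f x - g x).
Proof.
move=> bf bg; under eq_fun do rewrite -mulN1r.
by apply: essbddD => //; exact: essbddZ.
Qed.

Lemma essbdd_sum (I : Type) (r : seq I) (F : I -> T -> R) :
  (forall i, essbdd (F i)) -> essbdd (fun x => \sum_(i <- r) F i x).
Proof.
move=> bF; elim: r => [|i r IH].
  by under eq_fun do rewrite big_nil; exact: essbdd_cst.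
by under eq_fun do rewrite big_cons; exact: essbddD.
Qed.

Lemma essbdd_sqr f : essbdd f -> essbdd (fun x => f x ^+ 2).
Proof. by move=> bf; exact: essbddM. Qed.

Lemma ae_le_Rintegral f g : mu.-integrable D (EFin \o f) -> mu.-integrable D (EFin \o g) ->
  {ae mu, forall x, D x -> f x <= g x} ->
  \int[mu]_(x in D) f x <= \int[mu]_(x in D) g x.
Proof.
move=> intf intg fg.
have /measurable_EFinP mf := measurable_int _ intf.
have /measurable_EFinP mg := measurable_int _ intg.
rewrite -subr_ge0 -RintegralB//.
(* The difference is nonnegative only almost everywhere; its positive part agrees with it there and
   is nonnegative everywhere. *)
rewrite [leRHS](_ : _ = \int[mu]_(x in D) Num.max 0 (g x - f x)).
  by apply: Rintegral_ge0 => x _; rewrite le_max lexx.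
congr fine; apply: ae_eq_integral => //.
- by apply/measurable_EFinP; exact: measurable_funB.
- apply/measurable_EFinP; apply: measurable_maxr => //; exact: measurable_funB.
- move: fg; apply: filterS => x h Dx; rewrite max_r// subr_ge0; exact: h.
Qed.

Lemma ae_eq_Rintegral f g : measurable_fun D f -> measurable_fun D g ->
  {ae mu, forall x, D x -> f x = g x} ->
  \int[mu]_(x in D) f x = \int[mu]_(x in D) g x.
Proof.
move=> mf mg fg; congr fine; apply: ae_eq_integral => //; try exact/measurable_EFinP.
by move: fg; apply: filterS => x h Dx; rewrite h.
Qed.

Lemma Rintegral_eq0_ae f : mu.-integrable D (EFin \o f) -> (forall x, D x -> 0 <= f x) ->
  \int[mu]_(x in D) f x = 0 -> {ae mu, forall x, D x -> f x = 0}.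
Proof.
move=> intf f0 int0; have mf := measurable_int _ intf.
have : (\int[mu]_(x in D) `|(EFin \o f) x| = 0)%E.
  rewrite (eq_integral (EFin \o f)); last first.
    by move=> x; rewrite inE => Dx /=; rewrite ger0_norm// f0.
  by rewrite -[LHS]fineK ?(integrable_fin_num _ intf)//; congr (_%:E).
move=> /(ae_eq_integral_abs mu mD mf); apply: filterS => x h Dx.
by have := h Dx; move=> /= /eqP; rewrite eqe => /eqP.
Qed.

Lemma L2_sqr_integrable f : L2 mu D f -> mu.-integrable D (EFin \o (fun x => f x ^+ 2)).
Proof.
move=> [mf fi]; apply/integrableP; split.
  by apply/measurable_EFinP; exact: measurable_funX.
rewrite (eq_integral (fun x => ((f x) ^+ 2)%:E))// => x _ /=.
by rewrite ger0_norm// sqr_ge0.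
Qed.

Lemma L2_integrableM f g : L2 mu D f -> L2 mu D g ->
  mu.-integrable D (EFin \o (fun x => f x * g x)).
Proof.
move=> Lf Lg; have [mf _] := Lf; have [mg _] := Lg.
have := integrableD mD (L2_sqr_integrable Lf) (L2_sqr_integrable Lg).
apply: (le_integrable mD).
  by apply/measurable_EFinP; exact: measurable_funM.
move=> x Dx; rewrite /= lee_fin normrM (ger0_norm (addr_ge0 (sqr_ge0 _) (sqr_ge0 _))).
have := sqr_ge0 (`|f x| - `|g x|); rewrite sqrrB !real_normK ?num_real//.
have := mulr_ge0 (normr_ge0 (f x)) (normr_ge0 (g x)); lra.
Qed.

Lemma L2_lin k f g : L2 mu D f -> L2 mu D g -> L2 mu D (fun x => k * f x + g x).
Proof.
move=> Lf Lg; have [mf _] := Lf; have [mg _] := Lg; split.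
  by apply: measurable_funD => //; exact: measurable_funM.
have I1 := L2_sqr_integrable Lf; have I2 := L2_integrableM Lf Lg.
have I3 := L2_sqr_integrable Lg.
have := integrableD mD (integrableD mD (integrableZl mD (k ^+ 2) I1)
  (integrableZl mD (2 * k) I2)) I3.
move=> /integrableP[_]; apply: le_lt_trans; apply: ge0_le_integral => //=.
- by move=> x _; rewrite lee_fin sqr_ge0.
- apply/measurable_EFinP; apply: measurable_funX; apply: measurable_funD => //; exact: measurable_funM.
- apply/measurable_EFinP; apply: measurableT_comp => //.
  apply: measurable_funD; last exact: measurable_funX.
  apply: measurable_funD; apply: measurable_funM => //; [exact: measurable_funX|exact: measurable_funM].
- move=> x _; rewrite lee_fin; apply: le_trans (ler_norm _); rewrite le_eqVlt; apply/orP; left.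
  by apply/eqP; ring.
Qed.

Lemma essbdd_L2 f : essbdd f -> L2 mu D f.
Proof.
move=> bf; split; first by case: bf.
have /integrableP[_] := essbdd_integrable (essbdd_sqr bf).
by under eq_integral do rewrite /= ger0_norm ?sqr_ge0//.
Qed.

End bounded_integrands.

Lemma measurable_fun_sqrt (R : realType) dd (T : measurableType dd) (D : set T) (f : T -> R) :
  measurable_fun D f -> measurable_fun D (fun x => Num.sqrt (f x)).
Proof.
move=> mf; apply: (@measurable_comp _ _ _ _ _ _ setT (@Num.sqrt R)) => //.
by apply: continuous_measurable_fun; exact: sqrt_continuous.
Qed.

Lemma measurable_frob (R : realType) dd (T : measurableType dd) m n (D : set T)
    (A : T -> 'M[R]_(m, n)) :
  (forall i j, measurable_fun D (fun x => A x i j)) -> measurable_fun D (fun x => frob (A x)).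
Proof.
move=> mA; apply: measurable_fun_sqrt; apply: measurable_sum => i.
by apply: measurable_sum => j; exact: measurable_funM.
Qed.

Lemma partial_affine (R : realType) d (f : 'rV[R]_d -> R) x a j :
  (\forall y \near x, f y = f x + ddot (y - x) a) -> partial j f x = a 0 j.
Proof.
move=> /nbhs_frobP[r r0 fE]; rewrite /partial /derive.
apply: cvg_lim => //; apply: (@cvg_near_cst R^o).
near=> t.
have t0 : t != 0 by near: t; exact: nbhs_dnbhs_neq.
rewrite /= fE; last first.
  rewrite addrK frobZ frob_delta mulr1.
  near: t; apply: dnbhs0_lt; exact: r0.
by rewrite addrK addrC addKr ddotZl ddot_delta scalerA mulVf// scale1r.
Unshelve. all: by end_near. Qed.

Section almost_everywhere_lebesgue.
Variables (R : realType) (d : nat).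
Implicit Types P Q : 'rV[R]_d -> Prop.

Lemma ae_lebesgue_imp P Q : (forall x, P x -> Q x) ->
  {ae lebesgue_rV R d, forall x, P x} -> {ae lebesgue_rV R d, forall x, Q x}.
Proof.
move=> PQ [A [mA A0 PA]]; exists A; split => // x nQx.
by apply: PA => Px; apply: nQx; exact: PQ.
Qed.

Lemma ae_lebesgue_imp2 P1 P2 Q : (forall x, P1 x -> P2 x -> Q x) ->
  {ae lebesgue_rV R d, forall x, P1 x} -> {ae lebesgue_rV R d, forall x, P2 x} ->
  {ae lebesgue_rV R d, forall x, Q x}.
Proof.
move=> PQ a1 a2; apply: (negligibleS _ (negligibleU a1 a2)) => x nQx.
have [Px|] := pselect (P1 x); last by left.
by right => P2x; apply: nQx; exact: PQ.
Qed.

End almost_everywhere_lebesgue.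

(** * Finite bases of function spaces given by predicates *)

Section finite_dimension.
Variables (R : realType) (X : Type).
Implicit Types (f g : X -> R).

Definition lincomb r (e : 'I_r -> X -> R) (c : 'rV[R]_r) : X -> R :=
  fun x => \sum_i c 0 i * e i x.

Lemma lincomb_lin r (e : 'I_r -> X -> R) k c c' :
  lincomb e (k *: c + c') = (fun x => k * lincomb e c x + lincomb e c' x).
Proof.
apply/funext => x; rewrite /lincomb mulr_sumr -big_split/=; apply: eq_bigr => i _.
by rewrite !mxE mulrDl mulrA.
Qed.

Lemma lincomb_delta r (e : 'I_r -> X -> R) i : lincomb e (delta_mx 0 i) = e i.
Proof.
apply/funext => x; rewrite /lincomb (bigD1 i)//= mxE !eqxx mul1r big1 ?addr0// => j ji.
by rewrite mxE (negPf ji) andbF mul0r.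
Qed.

Variable V : (X -> R) -> Prop.
Hypothesis V0 : V (fun=> 0).
Hypothesis VD : forall k f g, V f -> V g -> V (fun x => k * f x + g x).

Lemma lincomb_closed r (e : 'I_r -> X -> R) c : (forall i, V (e i)) -> V (lincomb e c).
Proof.
move=> Ve; rewrite /lincomb; elim: (index_enum _) => [|i s IH].
  by rewrite (_ : (fun x => _) = (fun=> 0))//; apply/funext => x; rewrite big_nil.
rewrite (_ : (fun x => _) = (fun x => c 0 i * e i x + \sum_(j <- s) c 0 j * e j x)).
  exact: VD.
by apply/funext => x; rewrite big_cons.
Qed.

Variables (N : nat) (q : (X -> R) -> 'rV[R]_N).
Hypothesis qD : forall k f g, q (fun x => k * f x + g x) = k *: q f + q g.

Lemma lincomb_image r (e : 'I_r -> X -> R) c :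
  q (lincomb e c) = c *m \matrix_i q (e i).
Proof.
have q0 : q (fun=> 0) = 0.
  have := qD 1 (fun=> 0) (fun=> 0); rewrite mulr0 addr0 scale1r.
  by move=> /eqP; rewrite -subr_eq0 opprD addNKr oppr_eq0 => /eqP.
rewrite mulmx_sum_row; under eq_bigr do rewrite rowK.
rewrite /lincomb; elim: (index_enum _) => [|i s IH].
  by rewrite big_nil -q0; congr q; apply/funext => x; rewrite big_nil.
rewrite big_cons -IH -qD; congr q.
by apply/funext => x; rewrite big_cons.
Qed.

Lemma row_free_injective m n (A : 'M[R]_(m, n)) :
  (forall c : 'rV[R]_m, c *m A = 0 -> c = 0) -> row_free A.
Proof.
move=> h; rewrite -kermx_eq0; apply/eqP/row_matrixP => i.
by rewrite row0; apply: h; rewrite -row_mul mulmx_ker row0.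
Qed.

(** A family in [V] with independent images under [q] has at most [N] members, so there is one of
    maximal size. A function whose image escaped the span could be added to it. *)
Lemma finite_basis : exists r (e : 'I_r -> X -> R),
  [/\ forall i, V (e i), forall f, V f -> exists c, q f = q (lincomb e c) &
      forall c, q (lincomb e c) = 0 -> c = 0].
Proof.
pose P n := `[< exists e : 'I_n -> X -> R, (forall i, V (e i)) /\
  row_free (\matrix_i q (e i)) >].
have P0 : exists n, P n.
  exists 0%N; apply/asboolP; exists (fun _ _ => 0); split => [[]//|].
  by rewrite /row_free flatmx0 mxrank0.
have PN n : P n -> (n <= N)%N.
  by move=> /asboolP[e [_ /eqP <-]]; exact: rank_leq_col.
have [n /asboolP[e [Ve fe]] nmax] := ex_maxnP P0 PN.
exists n, e; split => // [f Vf|c]; last first.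
  rewrite lincomb_image => cM; apply: (row_free_inj fe).
  by rewrite /mulmxr cM mul0mx.
have [/submxP[c cE]|fM] := boolP (q f <= \matrix_i q (e i))%MS.
  by exists c; rewrite lincomb_image.
exfalso; suff /nmax : P n.+1 by rewrite ltnn.
pose e' (i : 'I_n.+1) := if unlift ord0 i is Some j then e j else f.
apply/asboolP; exists e'; split => [i|].
  by rewrite /e'; case: unliftP.
have -> : \matrix_i q (e' i) = (col_mx (q f) (\matrix_i q (e i)) : 'M[R]_(1 + n, N)).
  apply/row_matrixP => i; rewrite rowK /e'; case: (split_ordP (i : 'I_(1 + n))) => j ->.
    rewrite (ord1 j) [RHS]rowKu row_id.
    by rewrite (_ : lshift n 0 = ord0) ?unlift_none//; apply/val_inj.
  rewrite [RHS]rowKd rowK.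
  by rewrite (_ : rshift 1 j = lift ord0 j) ?liftK//; apply/val_inj.
apply: row_free_injective => c cE.
pose a := lsubmx (c : 'M[R]_(1, 1 + n)); pose c' := rsubmx (c : 'M[R]_(1, 1 + n)).
have h : a *m q f + c' *m \matrix_i q (e i) = 0.
  by rewrite -[LHS](@mul_row_col _ 1 1 n N a c') hsubmxK.
rewrite -[c](@hsubmxK _ 1 1 n c) -/a -/c'.
have a0 : a = 0.
  apply/eqP; apply: contraNT fM => a0.
  have a00 : a 0 0 != 0.
    by apply: contra_neq a0 => a00; apply/rowP => i; rewrite (ord1 i) a00 mxE.
  have : (a 0 0)^-1 *: (a *m q f + c' *m \matrix_i q (e i)) = 0 by rewrite h scaler0.
  rewrite (mx11_scalar a) mul_scalar_mx mxE eqxx mulr1n scalerDr scalerA mulVf// scale1r.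
  move=> /eqP; rewrite addr_eq0 => /eqP ->.
  by rewrite eqmx_opp scalemx_sub// submxMl.
move: h; rewrite a0 mul0mx add0r => h.
suff -> : c' = 0 by rewrite row_mx0.
by apply: (row_free_inj fe); rewrite /mulmxr h mul0mx.
Qed.

End finite_dimension.

(** The values at the finitely many points [pt] play the role of [q]. They determine a function on
    [A] only, hence the span and the freeness are stated on [A]. *)
Lemma function_basis (R : realType) (X : Type) (V : (X -> R) -> Prop) (A : set X)
    (I : finType) (pt : I -> X) :
  V (fun=> 0) -> (forall k f g, V f -> V g -> V (fun x => k * f x + g x)) ->
  (forall i, A (pt i)) ->
  (forall f, V f -> (forall i, f (pt i) = 0) -> forall x, A x -> f x = 0) ->
  exists r (e : 'I_r -> X -> R),
    [/\ forall i, V (e i),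
        forall f, V f -> exists c, forall x, A x -> f x = lincomb e c x &
        forall c, (forall x, A x -> lincomb e c x = 0) -> c = 0].
Proof.
move=> V0 VD Apt Vpt; pose q (f : X -> R) : 'rV[R]_#|I| := \row_k f (pt (enum_val k)).
have qD k f g : q (fun x => k * f x + g x) = k *: q f + q g.
  by apply/rowP => i; rewrite !mxE.
have [r [e [Ve sp fr]]] := finite_basis V0 qD.
exists r, e; split => // [f Vf|c c0]; last first.
  by apply: fr; apply/rowP => k; rewrite !mxE; exact: c0.
have [c fc] := sp f Vf; exists c => x Ax; apply/eqP; rewrite -subr_eq0 addrC -mulN1r.
apply/eqP; apply: (Vpt (fun x => -1 * lincomb e c x + f x)) => // [|i].
  by apply: (VD) => //; exact: (lincomb_closed V0 VD).
have /rowP/(_ (enum_rank i)) := fc; rewrite !mxE enum_rankK => ->.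
by rewrite mulN1r addNr.
Qed.

Section vector_combinations.
Variables (R : realType) (X : Type) (d r : nat).
Variable E : 'I_r -> X -> 'rV[R]_d.

Definition vcomb (b : 'rV[R]_r) : X -> 'rV[R]_d := fun x => \sum_i b 0 i *: E i x.

Lemma vcomb_lin k b b' : vcomb (k *: b + b') = (fun x => k *: vcomb b x + vcomb b' x).
Proof.
apply/funext => x; rewrite /vcomb scaler_sumr -big_split/=; apply: eq_bigr => i _.
by rewrite !mxE scalerDl scalerA.
Qed.

Lemma vcomb_delta i : vcomb (delta_mx 0 i) = E i.
Proof.
apply/funext => x; rewrite /vcomb (bigD1 i)//= mxE !eqxx scale1r big1 ?addr0// => j ji.
by rewrite mxE (negPf ji) andbF scale0r.
Qed.

Lemma vcomb_closed (V : (X -> 'rV[R]_d) -> Prop) b : V (fun=> 0) ->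
  (forall k u w, V u -> V w -> V (fun x => k *: u x + w x)) ->
  (forall i, V (E i)) -> V (vcomb b).
Proof.
move=> V0 VD VE; rewrite /vcomb; elim: (index_enum _) => [|i s IH].
  by rewrite (_ : (fun x => _) = (fun=> 0))//; apply/funext => x; rewrite big_nil.
rewrite (_ : (fun x => _) = (fun x => b 0 i *: E i x + \sum_(j <- s) b 0 j *: E j x)).
  exact: VD.
by apply/funext => x; rewrite big_cons.
Qed.

End vector_combinations.

(** * Bilinear forms, minimisation and compactness in coordinates *)

Section coordinates.
Variable R : realType.

Lemma linear_ddot r (f : 'rV[R]_r -> R) :
  (forall k a b, f (k *: a + b) = k * f a + f b) ->
  forall a, f a = ddot a (\row_i f (delta_mx 0 i)).
Proof.
move=> fD a.
have f0 : f 0 = 0.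
  have := fD 1 0 0; rewrite scaler0 addr0 mul1r.
  by move=> /eqP; rewrite -subr_eq0 opprD addNKr oppr_eq0 => /eqP.
rewrite [in LHS](row_sum_delta a) ddot_rowE.
elim: (index_enum _) => [|i s IH]; first by rewrite !big_nil.
by rewrite !big_cons fD IH mxE.
Qed.

Lemma symmetric_form_matrix r (f : 'rV[R]_r -> 'rV[R]_r -> R) :
  (forall a b, f a b = f b a) ->
  (forall k a a' b, f (k *: a + a') b = k * f a b + f a' b) ->
  exists M : 'M[R]_r, forall a b, f a b = ddot (a *m M) b.
Proof.
move=> fC fD; exists (\matrix_(i, j) f (delta_mx 0 i) (delta_mx 0 j)) => a b.
rewrite fC (linear_ddot (f := f^~ a)) => [|k b1 b2]; last exact: fD.
rewrite ddotC; congr ddot; apply/rowP => j; rewrite !mxE fC.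
rewrite (linear_ddot (f := f^~ (delta_mx 0 j))) => [|k a1 a2]; last exact: fD.
by rewrite ddot_rowE; apply: eq_bigr => i _; rewrite !mxE.
Qed.

Lemma frob_mulmx_lip m n (D : 'M[R]_(m, n)) : exists2 L, 0 <= L &
  forall y : 'rV[R]_m, frob (y *m D) <= L * frob y.
Proof.
have [L L0 h] := frob_mulmx_le D; exists L => // y; apply: h => i.
exact: entry_le_frob.
Qed.

Lemma continuous_ddot r (l : 'rV[R]_r) : continuous (fun x => ddot x l).
Proof.
apply: (@lipschitz_frob_continuous _ _ _ (frob l)) => [|x y]; first exact: frob_ge0.
exact: ddot_lipschitz.
Qed.

Lemma continuous_quadratic r (E : 'M[R]_r) (l : 'rV[R]_r) k :
  continuous (fun x : 'rV[R]_r => ddot (x *m E) x + k * ddot l x).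
Proof.
have -> : (fun x : 'rV[R]_r => ddot (x *m E) x + k * ddot l x) = (fun x =>
    \sum_i ddot x (col i E)^T * ddot x (delta_mx 0 i) + k * ddot x l).
  apply/funext => x; rewrite (ddotC l) ddot_rowE; congr (_ + _).
  apply: eq_bigr => i _; rewrite (ddotC x (delta_mx 0 i)) ddot_delta; congr (_ * _).
  by rewrite mxE ddot_rowE; apply: eq_bigr => j _; rewrite !mxE.
have cM (a b : 'rV[R]_r) : continuous (fun x => ddot x a * ddot x b).
  by move=> x; apply: (@cvgM R _ _ (nbhs_filter x)); exact: continuous_ddot.
have cS : continuous (fun x : 'rV[R]_r => \sum_i ddot x (col i E)^T * ddot x (delta_mx 0 i)).
  apply: continuous_big => [|i _]; last exact: cM.
  by move=> z; apply: (@cvgD R R^o _ (nbhs z) _ fst snd z.1 z.2); [exact: cvg_fst|exact: cvg_snd].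
move=> x; apply: (@cvgD _ R^o _ _ (nbhs_filter x)); first exact: cS.
by apply: (@cvgM R _ _ (nbhs_filter x)); [exact: cvg_cst|exact: continuous_ddot].
Qed.

Lemma continuous_frob r : continuous (@frob R 1 r).
Proof.
apply: (@lipschitz_frob_continuous _ _ _ 1) => // x y; rewrite mul1r ler_norml.
have := frobD (x - y) y; have := frobD (y - x) x; rewrite !subrK (frobC y x); lra.
Qed.

Lemma frob_bounded_closed_compact r (A : set 'rV[R]_r) B :
  (forall x, A x -> frob x <= B) -> closed A -> compact A.
Proof.
move=> AB cA; apply: bounded_closed_compact => //.
exists `|B|; split => // M BM x Ax /=; rewrite [leLHS]mx_normrE.
apply: bigmax_le => [|[i j] _ /=]; first by apply: ltW; apply: le_lt_trans BM.
apply: (le_trans (entry_le_frob _ _ _)); apply: (le_trans (AB _ Ax)).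
by apply: ltW; apply: (le_lt_trans (ler_norm _)).
Qed.

(** The constant is the minimum of the form on the compact unit sphere; homogeneity does the
    rest. *)
Lemma posdef_coercive r (E : 'M[R]_r) :
  (forall b : 'rV[R]_r, b != 0 -> 0 < ddot (b *m E) b) ->
  exists2 k, 0 < k & forall b : 'rV[R]_r, k * frob b ^+ 2 <= ddot (b *m E) b.
Proof.
move=> Epos; pose S : set 'rV[R]_r := [set b | frob b = 1].
have scale (b : 'rV[R]_r) : b != 0 -> S ((frob b)^-1 *: b).
  move=> b0; have fb : frob b != 0 by apply: contra_neq b0 => /frob_eq0.
  by rewrite /S/= frobZ ger0_norm ?invr_ge0 ?frob_ge0// mulVf.
(* An empty sphere means that 0 is the only vector, and then any constant will do. *)
have [S0|S0] := pselect (S !=set0); last first.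
  exists 1 => // b; have [->|b0] := eqVneq b 0; first by rewrite frob0 expr0n mulr0 ddot0r.
  by exfalso; apply: S0; exists ((frob b)^-1 *: b); exact: scale.
have cS : compact S.
  apply: (@frob_bounded_closed_compact _ _ 1) => [x ->//|].
  rewrite (_ : S = @frob R 1 r @^-1` [set 1])//.
  by apply: (@preimage_closed 'rV[R]_r R) => [x _|]; [exact: continuous_frob|exact: closed_eq].
have cf : continuous (fun x : 'rV[R]_r => ddot (x *m E) x + 0 * ddot 0 x).
  exact: continuous_quadratic.
have [c cS' cmin] := compact_EVT_min S0 cS (continuous_subspaceT cf).
move: cS'; rewrite inE => cS'.
have c0 : c != 0.
  by apply/eqP => c0; move: cS'; rewrite /S/= c0 frob0 => /esym/eqP; rewrite oner_eq0.
exists (ddot (c *m E) c) => [|b]; first exact: Epos.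
have [->|b0] := eqVneq b 0; first by rewrite frob0 expr0n mulr0 ddot0r.
have fb : 0 < frob b by rewrite lt_neqAle frob_ge0 andbT eq_sym; apply: contra_neq b0 => /frob_eq0.
have := cmin ((frob b)^-1 *: b); rewrite inE => /(_ (scale _ b0)).
rewrite !mul0r !addr0 -scalemxAl ddotZl ddotZr mulrA -expr2 exprVn.
by rewrite mulrC ler_pdivlMr ?exprn_gt0.
Qed.

(** For symmetric [Q] the function [(x Q) . x + 2 l . x] has gradient [2 (x Q + l)]; the claim is
    the first-order condition at its minimiser over the compact convex set. *)
Lemma quadratic_minimum r (K : set 'rV[R]_r) (Q : 'M[R]_r) (l : 'rV[R]_r) :
  compact K -> K !=set0 ->
  (forall a b t, K a -> K b -> 0 <= t <= 1 -> K (a + t *: (b - a))) ->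
  (forall x y : 'rV[R]_r, ddot (x *m Q) y = ddot (y *m Q) x) ->
  exists2 a, K a & forall w, K w -> 0 <= ddot (a *m Q + l) (w - a).
Proof.
move=> cK K0 convK symQ.
have cf : continuous (fun x : 'rV[R]_r => ddot (x *m Q) x + 2 * ddot l x).
  exact: continuous_quadratic.
have [a] := compact_EVT_min K0 cK (continuous_subspaceT cf).
rewrite inE => Ka amin; exists a => // w Kw; set g := w - a.
rewrite leNgt; apply/negP => neg.
pose s := - ddot (a *m Q + l) g; pose q := ddot (g *m Q) g.
have s0 : 0 < s by rewrite oppr_gt0.
(* So small that the quadratic contribution [t q] is at most [s], against the linear one [- 2 s]. *)
pose t := Num.min 1 (s / (`|q| + 1)).
have t0 : 0 < t by rewrite lt_min ltr01 divr_gt0// ltr_wpDl.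
have t1 : t <= 1 by rewrite ge_min lexx.
have := amin (a + t *: g); rewrite inE => /(_ (convK _ _ _ Ka Kw _)).
rewrite (ltW t0) t1 => /(_ isT).
rewrite mulmxDl -scalemxAl ddotDl !ddotDr ddotZl !ddotZl !ddotZr (symQ g a) -/q.
rewrite leNgt => /negP; apply.
rewrite (_ : _ + _ + _ + _ = ddot (a *m Q) a + 2 * ddot l a + t * (- 2 * s + t * q)); last first.
  rewrite /s ddotDl; ring.
rewrite gtrDl pmulr_rlt0//.
have : t * q <= s.
  apply: (@le_trans _ _ (t * (`|q| + 1))).
    by rewrite ler_pM2l// (le_trans (ler_norm _))// lerDl.
  by rewrite -ler_pdivlMr ?ltr_wpDl// /t ge_min lexx orbT.
lra.
Qed.

Lemma increasing_ge (k : nat -> nat) : {homo k : m n / (m < n)%N >-> (m < n)%N} ->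
  forall n, (n <= k n)%N.
Proof. by move=> kh; elim=> // n IH; apply: leq_ltn_trans IH (kh _ _ _). Qed.

Lemma increasing_cvg (k : nat -> nat) : {homo k : m n / (m < n)%N >-> (m < n)%N} ->
  k @ \oo --> \oo.
Proof.
move=> kh A [N _ NA]; exists N => // n /= Nn; apply: NA => /=.
exact: leq_trans Nn (increasing_ge kh n).
Qed.

Lemma bounded_subsequence r (a : nat -> 'rV[R]_r) B : (forall n, frob (a n) <= B) ->
  exists (k : nat -> nat) (l : 'rV[R]_r),
    {homo k : m n / (m < n)%N >-> (m < n)%N} /\ frob (a (k n) - l) @[n --> \oo] --> (0 : R).
Proof.
move=> aB.
(* Bolzano-Weierstrass is applied to one more coordinate at a time, each time along a further
   subsequence. *)
have step m : (m <= r)%N -> exists k : nat -> nat, {homo k : m n / (m < n)%N >-> (m < n)%N} /\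
    forall i : 'I_r, (i < m)%N -> cvgn (fun n => a (k n) 0 i).
  elim: m => [_|m IH mr]; first by exists id; split.
  have [k [kh kc]] := IH (ltnW mr).
  have [|f finc fc] := @bolzano_weierstrass R (fun n => a (k n) 0 (Ordinal mr)).
    exists B; split; first exact: num_real.
    move=> M BM n _ /=; apply: (le_trans (entry_le_frob _ _ _)).
    exact: le_trans (aB _) (ltW BM).
  have fh : {homo f : m n / (m < n)%N >-> (m < n)%N}.
    by move=> p n; rewrite !ltnNge -!leEnat finc.
  exists (k \o f); split => [p n /fh/kh//|i].
  rewrite ltnS leq_eqVlt => /predU1P[im|im].
    by rewrite (_ : i = Ordinal mr) //; apply/val_inj.
  apply/cvg_ex; have /cvg_ex[l li] := kc _ im; exists l.
  by apply: (cvg_comp f (fun n => a (k n) 0 i)) li; exact: increasing_cvg.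
have [k [kh kc]] := step r (leqnn r).
exists k, (\row_i lim (a (k n) 0 i @[n --> \oo])); split => //.
apply/cvgrPdist_le => e e0.
have e1 : 0 < e / (r%:R + 1) by rewrite divr_gt0// ltr_wpDl.
have : \forall n \near \oo, forall i : 'I_r, `|a (k n) 0 i - lim (a (k n) 0 i @[n --> \oo])| <= e / (r%:R + 1).
  apply: filter_forall => i; have /cvgrPdist_le/(_ _ e1) := kc i (ltn_ord i).
  by apply: filterS => n; rewrite distrC.
apply: filterS => n h; rewrite sub0r normrN ger0_norm ?frob_ge0//.
apply: (@le_trans _ _ (1%:R * r%:R * (e / (r%:R + 1)))).
  by apply: frob_le_entries => i j; rewrite (ord1 i) !mxE.
rewrite mul1r mulrCA ler_piMr ?(ltW e0)// ler_pdivrMr ?ltr_wpDl// mul1r; lra.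
Qed.

Lemma seq_closed_closed r (A : set 'rV[R]_r) :
  (forall (a : nat -> 'rV[R]_r) l, (forall n, A (a n)) ->
     frob (a n - l) @[n --> \oo] --> (0 : R) -> A l) -> closed A.
Proof.
move=> h l cl.
have /choice[a aP] : forall n : nat, exists x, A x /\ frob (x - l) < n.+1%:R^-1.
  move=> n; have /cl[x [Ax /= xl]] : nbhs l [set x | frob (x - l) < n.+1%:R^-1].
    by apply/nbhs_frobP; exists n.+1%:R^-1 => //; rewrite invr_gt0 ltr0n.
  by exists x.
apply: (h a) => [n|]; first by case: (aP n).
apply: (@squeeze_cvgr _ _ _ _ (fun=> 0) (fun n => n.+1%:R^-1)).
- by near=> n; rewrite frob_ge0/= ltW//; case: (aP n).
- exact: cvg_cst.
- exact: cvg_harmonic.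
Unshelve. all: by end_near. Qed.

End coordinates.

(** * The scheme as an iteration on coordinate vectors *)

Section coordinate_scheme.
Variable R : realType.

(** The part of the stiffness matrix that is linear in the coordinates [a] of the phase field; the
    whole matrix is [A0 - trilin T a]. *)
Definition trilin s r (T : 'I_s -> 'M[R]_r) (a : 'rV[R]_s) : 'M[R]_r :=
  \sum_i a 0 i *: T i.

Lemma trilinB s r (T : 'I_s -> 'M[R]_r) a b :
  trilin T (a - b) = trilin T a - trilin T b.
Proof.
by rewrite /trilin -sumrB; apply: eq_bigr => i _; rewrite !mxE scalerBl.
Qed.

Lemma ddot_mulmx_le r (E : 'M[R]_r) : exists2 L, 0 <= L &
  forall x y : 'rV[R]_r, `|ddot (x *m E) y| <= L * frob x * frob y.
Proof.
have [L L0 h] := frob_mulmx_lip E; exists L => // x y.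
by apply: (le_trans (ddot_le_frob _ _)); rewrite ler_wpM2r ?frob_ge0.
Qed.

Lemma trilin_le s r (T : 'I_s -> 'M[R]_r) : exists2 L, 0 <= L &
  forall a (x y : 'rV[R]_r), `|ddot (x *m trilin T a) y| <= L * frob a * frob x * frob y.
Proof.
have /choice[L LP] : forall i, exists L, 0 <= L /\
    forall x y : 'rV[R]_r, `|ddot (x *m T i) y| <= L * frob x * frob y.
  by move=> i; have [L L0 h] := ddot_mulmx_le (T i); exists L.
exists (\sum_i L i) => [|a x y]; first by apply: sumr_ge0 => i _; case: (LP i).
rewrite /trilin mulmx_sumr ddot_suml; apply: (le_trans (ler_norm_sum _ _ _)).
rewrite !mulr_suml; apply: ler_sum => i _; have [L0 h] := LP i.
rewrite -scalemxAr ddotZl normrM.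
apply: (@le_trans _ _ (frob a * (L i * frob x * frob y))).
  by apply: ler_pM => //; exact: entry_le_frob.
by rewrite le_eqVlt; apply/orP; left; apply/eqP; ring.
Qed.

Definition bounded_on s r (K : set 'rV[R]_s) (g : 'rV[R]_s -> 'rV[R]_r) : Prop :=
  exists2 C, 0 <= C & forall a, K a -> frob (g a) <= C.

Definition lipschitz_on s r (K : set 'rV[R]_s) (g : 'rV[R]_s -> 'rV[R]_r) : Prop :=
  exists2 L, 0 <= L & forall a b, K a -> K b -> frob (g a - g b) <= L * frob (a - b).

(** Coercivity turns a bound on the right-hand side into one on the solution. The difference
    [u a - u b] solves the system at [a] with right-hand side [g a - g b + u b *m trilin T (a - b)],
    which is of the order of [a - b]. *)
Lemma lipschitz_solution s r (K : set 'rV[R]_s) (A0 : 'M[R]_r) (T : 'I_s -> 'M[R]_r)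
    (g u : 'rV[R]_s -> 'rV[R]_r) k :
  0 < k ->
  (forall a (b : 'rV[R]_r), K a -> k * frob b ^+ 2 <= ddot (b *m (A0 - trilin T a)) b) ->
  bounded_on K g -> lipschitz_on K g ->
  (forall a, K a -> u a *m (A0 - trilin T a) = g a) ->
  bounded_on K u /\ lipschitz_on K u.
Proof.
move=> k0 coer [Cg Cg0 gC] [Lg Lg0 gL] sol.
have div_frob (x : 'rV[R]_r) c : 0 <= c -> k * frob x ^+ 2 <= c * frob x -> frob x <= c / k.
  move=> c0; have [->|x0] := eqVneq x 0; first by rewrite frob0 divr_ge0// ltW.
  have fx : 0 < frob x by rewrite lt_neqAle frob_ge0 andbT eq_sym; apply: contra_neq x0 => /frob_eq0.
  by rewrite expr2 mulrA ler_pM2r// ler_pdivlMr// mulrC.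
have uC a : K a -> frob (u a) <= Cg / k.
  move=> Ka; apply: div_frob => //; apply: (le_trans (coer _ _ Ka)); rewrite sol//.
  apply: (le_trans (ler_norm _)); apply: (le_trans (ddot_le_frob _ _)).
  by rewrite ler_wpM2r ?frob_ge0// gC.
split; first by exists (Cg / k) => //; rewrite divr_ge0// ltW.
have [Lt Lt0 tL] := trilin_le T.
have k0' := ltW k0.
exists ((Lg + Lt * (Cg / k)) / k).
  by rewrite divr_ge0// addr_ge0// mulr_ge0// divr_ge0.
move=> a b Ka Kb.
rewrite mulrAC; apply: div_frob.
  by rewrite mulr_ge0 ?frob_ge0// addr_ge0// mulr_ge0// divr_ge0.
apply: (le_trans (coer a _ Ka)).
have -> : (u a - u b) *m (A0 - trilin T a) = (g a - g b) + u b *m trilin T (a - b).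
  rewrite mulmxBl sol// -(sol b)// trilinB !mulmxBr.
  move: (g a) (u b *m A0) (u b *m trilin T a) (u b *m trilin T b) => x1 x2 x3 x4.
  by apply/rowP => i; rewrite !mxE; ring.
rewrite ddotDl !mulrDl; apply: lerD.
  apply: (le_trans (ler_norm _)); apply: (le_trans (ddot_le_frob _ _)).
  by rewrite ler_wpM2r ?frob_ge0// gL.
apply: (le_trans (ler_norm _)); apply: (le_trans (tL _ _ _)).
rewrite ler_wpM2r ?frob_ge0// mulrAC ler_wpM2r ?frob_ge0// ler_wpM2l//.
exact: uC.
Qed.

Lemma bounded_on_affine s r (K : set 'rV[R]_s) (u : 'rV[R]_s -> 'rV[R]_r)
    (S : 'M[R]_r) (m : 'rV[R]_r) :
  bounded_on K u -> bounded_on K (fun a => u a *m S - m).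
Proof.
move=> [C C0 uC]; have [L L0 h] := frob_mulmx_lip S.
exists (L * C + frob m) => [|a Ka]; first by rewrite addr_ge0 ?mulr_ge0 ?frob_ge0.
apply: (le_trans (frobD _ _)); rewrite frobN lerD2r; apply: (le_trans (h _)).
by rewrite ler_wpM2l// uC.
Qed.

Lemma lipschitz_on_affine s r (K : set 'rV[R]_s) (u : 'rV[R]_s -> 'rV[R]_r)
    (S : 'M[R]_r) (m : 'rV[R]_r) :
  lipschitz_on K u -> lipschitz_on K (fun a => u a *m S - m).
Proof.
move=> [C C0 uC]; have [L L0 h] := frob_mulmx_lip S.
exists (L * C) => [|a b Ka Kb]; first by rewrite mulr_ge0.
rewrite opprB addrA subrK -mulmxBl; apply: (le_trans (h _)).
by rewrite -mulrA ler_wpM2l// uC.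
Qed.

Lemma lipschitz_on_forms s r (K : set 'rV[R]_s) (T : 'I_s -> 'M[R]_r)
    (u p : 'rV[R]_s -> 'rV[R]_r) :
  bounded_on K u -> lipschitz_on K u -> bounded_on K p -> lipschitz_on K p ->
  lipschitz_on K (fun a => \row_i ddot (u a *m T i) (p a)).
Proof.
move=> [Cu Cu0 uC] [Lu Lu0 uL] [Cp Cp0 pC] [Lp Lp0 pL].
have /choice[L LP] : forall i, exists L, 0 <= L /\
    forall x y : 'rV[R]_r, `|ddot (x *m T i) y| <= L * frob x * frob y.
  by move=> i; have [L L0 h] := ddot_mulmx_le (T i); exists L.
exists (\sum_i L i * (Lu * Cp + Cu * Lp)) => [|a b Ka Kb].
  by apply: sumr_ge0 => i _; have [L0 _] := LP i; rewrite mulr_ge0// addr_ge0// mulr_ge0.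
apply: (le_trans (frob_le_sum _)); rewrite big_ord1 mulr_suml; apply: ler_sum => i _.
have [L0 h] := LP i; rewrite !mxE.
rewrite (_ : _ - _ = ddot ((u a - u b) *m T i) (p a) + ddot (u b *m T i) (p a - p b)); last first.
  by rewrite mulmxBl ddotBl ddotBr; ring.
apply: (le_trans (ler_normD _ _)).
apply: (@le_trans _ _ (L i * (Lu * frob (a - b)) * Cp + L i * Cu * (Lp * frob (a - b)))).
  apply: lerD; apply: (le_trans (h _ _)).
    apply: ler_pM; rewrite ?mulr_ge0 ?frob_ge0//; last exact: pC.
    by rewrite ler_wpM2l// uL.
  apply: ler_pM; rewrite ?mulr_ge0 ?frob_ge0//; last exact: pL.
  by rewrite ler_wpM2l// uC.
by rewrite le_eqVlt; apply/orP; left; apply/eqP; ring.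
Qed.

Section limit.
Variables (s : nat) (K : set 'rV[R]_s) (M G : 'M[R]_s) (D : 'rV[R]_s -> 'rV[R]_s).
Variables (J : 'rV[R]_s -> R) (tau k1 k2 kappa B : R) (ell : 'rV[R]_s).

(** The left-hand side of the scheme as a functional of the test direction: [M] is the mass matrix,
    [G] the Dirichlet matrix, [D] the misfit derivative, [ell] the integrals of the basis functions.
    On the diagonal the first term drops out and the derivative of the functional is left. *)
Definition scheme_vector (a a' : 'rV[R]_s) : 'rV[R]_s :=
  tau^-1 *: ((a' - a) *m M) + D a + k1 *: (a' *m G) + k2 *: (ell - 2 *: (a *m M)).

Hypothesis K_bounded : forall a, K a -> frob a <= B.
Hypothesis K_closed : forall (a : nat -> 'rV[R]_s) l, (forall n, K (a n)) ->
  frob (a n - l) @[n --> \oo] --> (0 : R) -> K l.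
Hypothesis D_lipschitz : lipschitz_on K D.
Hypothesis kappa_gt0 : 0 < kappa.
Hypothesis M_coercive : forall b : 'rV[R]_s, kappa * frob b ^+ 2 <= ddot (b *m M) b.
Hypothesis J_ge0 : forall a, K a -> 0 <= J a.
Variable a : nat -> 'rV[R]_s.
Hypothesis aK : forall n, K (a n).
Hypothesis energy : forall n,
  ddot ((a n.+1 - a n) *m M) (a n.+1 - a n) + J (a n.+1) <= J (a n).
Hypothesis step : forall n w, K w -> 0 <= ddot (scheme_vector (a n) (a n.+1)) (w - a n.+1).

(** The energies decrease and are bounded below, so their drops tend to 0; each drop dominates
    [kappa] times the squared increment. *)
Lemma increments_vanish : frob (a n.+1 - a n) @[n --> \oo] --> (0 : R).
Proof.
have dJ : J (a n) - J (a n.+1) @[n --> \oo] --> (0 : R).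
  have cJ : cvgn (fun n => J (a n)).
    apply: nonincreasing_is_cvgn.
      apply/nonincreasing_seqP => n; apply: le_trans (energy n).
      rewrite lerDr; apply: le_trans (M_coercive _).
      by rewrite mulr_ge0 ?(ltW kappa_gt0) ?sqr_ge0.
    by exists 0 => _ [n _ <-]; exact: J_ge0.
  rewrite -(subrr (lim (J (a n) @[n --> \oo]))).
  by apply: cvgB => //; rewrite -(cvg_shiftS (fun n => J (a n))) in cJ *.
apply/cvgrPdist_le => e e0.
have ke : 0 < kappa * e ^+ 2 by rewrite mulr_gt0// exprn_gt0.
have /cvgrPdist_le/(_ _ ke) := dJ; apply: filterS => n.
rewrite !sub0r !normrN => h; rewrite ger0_norm ?frob_ge0//.
rewrite -(@ler_pXn2r _ 2) ?nnegrE ?frob_ge0 ?(ltW e0)// -(ler_pM2l kappa_gt0).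
apply: (le_trans (M_coercive _)); apply: le_trans h; apply: le_trans (ler_norm _).
by have := energy n; lra.
Qed.

Lemma scheme_vector_lipschitz : exists2 C, 0 <= C &
  forall x x' l, K x -> K x' -> K l ->
    frob (scheme_vector x x' - scheme_vector l l) <= C * (frob (x - l) + frob (x' - l)).
Proof.
have [L L0 DL] := D_lipschitz.
have [LM LM0 hM] := frob_mulmx_lip M; have [LG LG0 hG] := frob_mulmx_lip G.
pose t := `|tau^-1|; have t0 : 0 <= t by rewrite /t.
exists (t * LM + L + `|k1| * LG + `|k2| * 2 * LM).
  by rewrite !addr_ge0 ?mulr_ge0.
move=> x x' l Kx Kx' Kl; rewrite /scheme_vector.
have -> : tau^-1 *: ((x' - x) *m M) + D x + k1 *: (x' *m G) + k2 *: (ell - 2 *: (x *m M)) -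
    (tau^-1 *: ((l - l) *m M) + D l + k1 *: (l *m G) + k2 *: (ell - 2 *: (l *m M))) =
    tau^-1 *: ((x' - x) *m M) + (D x - D l) + k1 *: ((x' - l) *m G)
      + (k2 * 2) *: ((l - x) *m M).
  rewrite subrr mul0mx scaler0 add0r !mulmxBl !scalerBr !scalerA.
  apply/rowP => i; rewrite !mxE; ring.
have xx : frob (x' - x) <= frob (x - l) + frob (x' - l).
  rewrite -(subrK l x') -[X in frob X]addrA; apply: (le_trans (frobD _ _)).
  by rewrite (frobC l x) subrK addrC.
apply: (le_trans (frobD _ _)); rewrite !mulrDl; apply: lerD; last first.
  rewrite frobZ normrM (ger0_norm (ler0n _ 2)) -[leRHS]mulrA; apply: ler_wpM2l.
    by rewrite mulr_ge0.
  apply: (le_trans (hM _)); rewrite ler_wpM2l// frobC lerDl frob_ge0//.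
apply: (le_trans (frobD _ _)); apply: lerD; last first.
  rewrite frobZ -mulrA; apply: ler_wpM2l => //.
  by apply: (le_trans (hG _)); rewrite ler_wpM2l// lerDr frob_ge0.
apply: (le_trans (frobD _ _)); apply: lerD; last first.
  apply: (le_trans (DL _ _ Kx Kl)).
  by rewrite ler_wpM2l// lerDl frob_ge0.
rewrite frobZ -mulrA; apply: ler_wpM2l => //.
by apply: (le_trans (hM _)); rewrite ler_wpM2l.
Qed.

(** Since increments vanish, [a (k n)] and its successor have the same limit [l], so both arguments
    of [scheme_vector] converge to it and the step inequality passes to the limit on the
    diagonal. *)
Lemma scheme_limit : exists (k : nat -> nat) (l : 'rV[R]_s),
  [/\ {homo k : m n / (m < n)%N >-> (m < n)%N}, K l,
      frob (a (k n) - l) @[n --> \oo] --> (0 : R) &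
      forall w, K w -> 0 <= ddot (scheme_vector l l) (w - l)].
Proof.
have [k [l [kh kl]]] := bounded_subsequence (fun n => K_bounded (aK n)).
have Kl : K l by apply: (K_closed _ kl) => n; exact: aK.
exists k, l; split => // w Kw.
have [C C0 SC] := scheme_vector_lipschitz.
have kl' : frob (a (k n).+1 - l) @[n --> \oo] --> (0 : R).
  have inc : frob (a (k n).+1 - a (k n)) @[n --> \oo] --> (0 : R).
    by apply: (cvg_comp k (fun n => frob (a n.+1 - a n))) increments_vanish; exact: increasing_cvg.
  apply: (@squeeze_cvgr _ _ _ _ (fun=> 0) (fun n => frob (a (k n).+1 - a (k n)) + frob (a (k n) - l))).
  - near=> n; rewrite frob_ge0/= -{1}(subrK (a (k n)) (a (k n).+1)) -addrA.
    exact: frobD.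
  - exact: cvg_cst.
  - by rewrite -[X in _ --> X](addr0 0); apply: cvgD.
(* First the error of replacing the vector by its value at the limit, then that of replacing
   [a (k n).+1] by [l] in the test direction. *)
pose e n := C * (frob (a (k n) - l) + frob (a (k n).+1 - l)) * (frob w + B) +
  frob (scheme_vector l l) * frob (a (k n).+1 - l).
have e0 : e n @[n --> \oo] --> (0 : R).
  rewrite (_ : 0 = C * (0 + 0) * (frob w + B) + frob (scheme_vector l l) * 0); last by rewrite addr0 !mulr0 mul0r addr0.
  apply: cvgD; last by apply: cvgM => //; exact: cvg_cst.
  by apply: cvgM; [apply: cvgM; [exact: cvg_cst|exact: cvgD]|exact: cvg_cst].
have bound n : - e n <= ddot (scheme_vector l l) (w - l).
  have := step (k n) Kw.
  have -> : ddot (scheme_vector (a (k n)) (a (k n).+1)) (w - a (k n).+1) =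
     ddot (scheme_vector l l) (w - l)
     + ddot (scheme_vector (a (k n)) (a (k n).+1) - scheme_vector l l) (w - a (k n).+1)
     - ddot (scheme_vector l l) (a (k n).+1 - l).
    by rewrite ddotBl !ddotBr; ring.
  have h1 := ddot_le_frob (scheme_vector (a (k n)) (a (k n).+1) - scheme_vector l l) (w - a (k n).+1).
  have h2 := ddot_le_frob (scheme_vector l l) (a (k n).+1 - l).
  have h3 : frob (scheme_vector (a (k n)) (a (k n).+1) - scheme_vector l l) * frob (w - a (k n).+1) <=
      C * (frob (a (k n) - l) + frob (a (k n).+1 - l)) * (frob w + B).
    apply: ler_pM; rewrite ?frob_ge0//; first by apply: SC.
    apply: (le_trans (frobD _ _)); rewrite frobN lerD2l; exact: K_bounded.
  have h4 := ler_norm (ddot (scheme_vector (a (k n)) (a (k n).+1) - scheme_vector l l) (w - a (k n).+1)).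
  have h5 := ler_norm (- ddot (scheme_vector l l) (a (k n).+1 - l)).
  rewrite normrN in h5; rewrite /e; lra.
have : - e n @[n --> \oo] --> (- 0 : R) by apply: cvgN.
rewrite oppr0 => /cvg_lim <-//; apply: limr_le; last exact: nearW.
by apply/cvg_ex; exists (- 0); apply: cvgN.
Unshelve. all: by end_near. Qed.

End limit.

End coordinate_scheme.

Lemma linear_frob_bound (R : realType) r m n (F : 'rV[R]_r -> 'M[R]_(m, n)) :
  (forall k a b, F (k *: a + b) = k *: F a + F b) ->
  exists2 L, 0 <= L & forall b, frob (F b) <= L * frob b.
Proof.
move=> FD; pose v i j : 'rV[R]_r := \row_k F (delta_mx 0 k) i j.
exists (\sum_i \sum_j frob (v i j)) => [|b].
  by do 2 apply: sumr_ge0 => ? _; exact: frob_ge0.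
apply: (le_trans (frob_le_sum _)); rewrite mulr_suml; apply: ler_sum => i _.
rewrite mulr_suml; apply: ler_sum => j _.
rewrite (linear_ddot (f := fun a => F a i j)) => [|k a a']; last by rewrite FD !mxE.
by rewrite mulrC; exact: ddot_le_frob.
Qed.

(** The scalar core of the energy inequality; index 0 is the old iterate, 1 the new one. [ti] is
    [tau^-1], [ei] is [eps^-1]; [m], [g], [i] are masses, Dirichlet products and integrals; [f1] is
    the misfit derivative, [f2] its second-order correction; [sz] and [bz] are the strain and
    boundary energies of the change of [u_h], and [b0] is the old misfit. The recurring combination
    of masses is the squared increment. *)
Lemma energy_arithmetic (R : realFieldType)
    (ti ta ep ei K k q f1 f2 sz b0 bz m11 m00 m01 i0 i1 g11 g01 g00 : R) :
  (1 + (1 + q ^+ 2 / 2 + (1 + K) / 2 * k ^+ 2)) * (m11 - m01 - (m01 - m00)) <=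
    ti * (m11 - m01 - (m01 - m00)) ->
  0 <= ta * ei * (m11 - m01 - (m01 - m00)) ->
  0 <= ta * ep * (g11 - g01 - (g01 - g00)) ->
  0 <= m11 - m01 - (m01 - m00) ->
  sz <= k ^+ 2 * (m11 - m01 - (m01 - m00)) ->
  bz <= K * (k ^+ 2 * (m11 - m01 - (m01 - m00))) ->
  f2 <= 1 / 2 * q ^+ 2 * (m11 - m01 - (m01 - m00)) + (2 * 1)^-1 * sz ->
  0 <= ti * (m01 - m11 - m00 + m01) - f1 + 2 * ta * ep * (g01 - g11) +
    ta * ei * (i0 - i1 - 2 * (m00 - m01)) ->
  m11 - m01 - (m01 - m00) +
    (2^-1 * (b0 + 2 * (f2 + f1) + bz) + ta * (ep * g11 + ei * (i1 - m11))) <=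
  2^-1 * b0 + ta * (ep * g00 + ei * (i0 - m00)).
Proof. lra. Qed.

(** * The mesh: boundary, skeleton and measurability of the domain *)

Section discrete_problem.
Variables (R : realType) (d : nat).
Hypothesis d_gt0 : (0 < d)%N.
Variables (Om : set 'rV[R]_d) (Th : seq 'M[R]_(d.+1, d)).
Hypothesis hOm : polyhedral_domain Om.
Hypothesis hTh : covers_by_simplices Th (closure Om).
Variable SigD : set 'rV[R]_d.
Hypothesis SigD_closure : SigD `<=` closure Om.
Hypothesis SigD_gt0 : (0 < hausdorff d.-1 SigD)%E.
Variable SigN : set 'rV[R]_d.
Hypothesis SigN_meas : (hausdorff d.-1).-cara.-measurable SigN.
Hypothesis SigN_boundary : SigN `<=` boundary Om.

Local Notation leb := (lebesgue_rV R d).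
Local Notation lebT := (lebesgue_measurable_type R d).
Local Notation haus := (hausdorff_measure R d d.-1).

Lemma mesh_independent K : K \in Th -> affinely_independent K.
Proof. by case: hTh => h _; exact: h. Qed.

Lemma mesh_cover x : closure Om x <-> exists2 K, K \in Th & simplex K x.
Proof. by case: hTh => _ {1}->. Qed.

Lemma openOm : open Om. Proof. by case: hOm. Qed.

Lemma boundary_notin x : boundary Om x -> ~ Om x.
Proof.
by move=> [_]; rewrite -(proj1 (closure_id _) (open_closedC openOm)).
Qed.

(* Just below the Lipschitz graph there are points exterior to Om, so the
   boundary is also the boundary of the closure. *)
Lemma boundary_nbhs x : boundary Om x -> ~ nbhs x (closure Om).
Proof.
move=> bx /nbhs_frobP[s s0 sU].
have [_ _ _ _ lip] := hOm; have [r [L [e [gam [r0 e1 gamL gam_e OmE]]]]] := lip _ bx.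
have gx : ddot x e <= gam x.
  rewrite leNgt; apply/negP => h; apply: (boundary_notin bx); apply/OmE => //.
  by rewrite subrr frob0.
pose t := Num.min (s / 2) (r / 2).
have t0 : 0 < t by rewrite lt_min !divr_gt0.
pose y := x + (- t) *: e.
have yx : frob (y - x) = t.
  by rewrite /y addrC addKr frobZ e1 mulr1 normrN ger0_norm// ltW.
have cy : closure Om y by apply: sU; rewrite yx gt_min; apply/orP; left; lra.
(* A displacement below [t / L'] changes the height by at most its length and the graph by at most
   [|L|] times its length, too little to undo the descent by [t]. *)
pose L' := 1 + `|L|; have L'0 : 0 < L' by rewrite ltr_pwDl.
have /cy[z [Omz /= zy]] : nbhs y [set z | frob (z - y) < Num.min (t / L') (r / 2)].
  by apply/nbhs_frobP; exists (Num.min (t / L') (r / 2)) => //; rewrite lt_min !divr_gt0.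
have zx : frob (z - x) < r.
  rewrite -(subrK y z) -addrA; apply: (le_lt_trans (frobD _ _)).
  move: zy; rewrite lt_min yx => /andP[_ zy].
  have : t <= r / 2 by rewrite ge_min lexx orbT.
  lra.
have /OmE := zx; move=> [/(_ Omz)+ _].
have : gam y - gam z <= `|L| * frob (z - y).
  apply: (le_trans (ler_norm _)); apply: (le_trans (gamL _ _)); rewrite frobC.
  by rewrite ler_wpM2r ?frob_ge0// ler_norm.
have : ddot z e - ddot y e <= frob (z - y).
  by rewrite -ddotBl; apply: (le_trans (ler_norm _)); apply: (le_trans (ddot_le_frob _ _)); rewrite e1 mulr1.
have e2 : ddot e e = 1 by rewrite -frob_sqr e1 expr1n.
have -> : ddot y e = ddot x e - t by rewrite /y ddotDl ddotZl e2 mulr1.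
have -> : gam y = gam x by rewrite /y gam_e.
move: zy; rewrite lt_min ltr_pdivlMr// => /andP[+ _].
rewrite /L' mulrDr mulr1 (mulrC _ `|L|); lra.
Qed.

Definition faces : set 'rV[R]_d := [set x | exists2 p : 'M[R]_(d.+1, d) * 'I_d.+1,
  p \in [seq (K, i) | K <- Th, i <- enum 'I_d.+1] &
  face p.1 p.2 x].

(** A boundary point with only positive coordinates in its simplex would be interior to the closure,
    against [boundary_nbhs]. *)
Lemma boundary_faces : boundary Om `<=` faces.
Proof.
move=> x bx; have [/mesh_cover[K KTh Kx] _] := bx.
have indK := mesh_independent KTh.
have [l [l0 l1] xl] := Kx.
have [i li] : exists i, l 0 i = 0.
  apply: contrapT => h; apply: (boundary_nbhs bx).
  apply: (filterS (P := inner_simplex K)).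
    by move=> y /(inner_simplex_sub indK) Ky; apply/mesh_cover; exists K.
  apply: open_nbhs_nbhs; split; first exact: open_inner_simplex.
  move=> i; rewrite xl bary_mulmx// lt_neqAle l0 andbT; apply/eqP => li.
  by apply: h; exists i.
exists (K, i) => /=; first by apply/allpairsP; exists (K, i); rewrite mem_enum.
by exists l.
Qed.

Lemma hausdorff_boundary_lty : (hausdorff d.-1 (boundary Om) < +oo)%E.
Proof.
apply: (le_lt_trans (le_outer_measure _ _ _ boundary_faces)).
by apply: outer_measure_seq_lty => -[K i] _; exact: hausdorff_face_lty.
Qed.

(** Whole hyperplanes instead of faces: still a null set, and off it every point of [Om] lies in an
    open simplex. *)
Definition skeleton : set 'rV[R]_d := [set x | exists2 p : 'M[R]_(d.+1, d) * 'I_d.+1,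
  p \in [seq (K, i) | K <- Th, i <- enum 'I_d.+1] & bary p.1 x p.2 = 0].

Lemma bary_eq0E K i :
  [set x | bary K x i = 0] =
  [set x | ddot x (bary_slope K i) = - (usubmx (invmx (augment K) : 'M[R]_(1 + d, d.+1))) 0 i].
Proof.
apply/seteqP; split => x /= h; last by rewrite /bary h addNr.
by apply/eqP; rewrite -addr_eq0; apply/eqP.
Qed.

Lemma skeleton_negligible : leb.-negligible skeleton.
Proof.
apply: negligible_seq => -[K i] /allpairsP[[K' j] [/= KTh _ [-> ->]]] /=.
exists [set x | bary K' x j = 0]; split => //.
  rewrite bary_eq0E; apply: borel_measurable_lebesgue; exact: borel_hyperplane.
rewrite bary_eq0E; apply: hyperplane_null; apply: bary_slope_neq0 => //.
exact: mesh_independent.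
Qed.

Lemma faces_skeleton : faces `<=` skeleton.
Proof.
move=> x [p /allpairsP[[K' j] [/= KTh _ ->]]] /= [l [[l0 l1] li] ->].
exists (K', j) => /=; first by apply/allpairsP; exists (K', j); rewrite mem_enum.
by rewrite bary_mulmx//; exact: mesh_independent.
Qed.

(** The domain is the union of the closed simplices minus its boundary. The boundary lies in the
    null skeleton, hence is measurable by completeness. *)
Lemma measurableOm : measurable (Om : set (lebesgue_measurable_type R d)).
Proof.
rewrite (_ : Om = [set x | exists2 K, K \in Th & simplex K x] `\` boundary Om).
  apply: measurableD.
    apply: borel_measurable_lebesgue; apply: measurable_union_seq => K KTh.
    by apply: (measurable_simplex (g := id) (@borel_ddot R d)); exact: mesh_independent.
  apply: lebesgue_negligible_measurable.
  apply: (negligibleS _ skeleton_negligible).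
  by apply: subset_trans boundary_faces _; exact: faces_skeleton.
apply/seteqP; split => x.
  move=> Omx; split; first by apply/mesh_cover; exact: subset_closure.
  by move=> /boundary_notin.
move=> [/mesh_cover cx nbx]; apply: contrapT => nx; apply: nbx; split => //.
exact: subset_closure.
Qed.

Lemma lebesgue_Om_lty : (leb Om < +oo)%E.
Proof.
have [_ _ [M [_ bM]] _ _] := hOm.
have M0 : 0 < `|M| + 1 by rewrite ltr_wpDl.
apply: (@le_lt_trans _ _ (leb (box 0 (`|M| + 2)))).
  apply: le_measure; rewrite ?inE; [exact: measurableOm| |].
    by apply: borel_measurable_lebesgue; exact: borel_box.
  move=> x Omx i; rewrite mxE subr0.
  have : M < `|M| + 1 by apply: (le_lt_trans (ler_norm _)); rewrite ltrDl.
  move=> /bM/(_ x Omx) xM; apply: (@le_lt_trans _ _ (`|M| + 1)); last by rewrite ltrD2l ltr1n.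
  by apply: le_trans xM; exact: entry_le_norm.
by rewrite lebesgue_box ?ltey// ltr_wpDl.
Qed.

Lemma good_point x : Om x -> ~ skeleton x -> exists2 K, K \in Th & inner_simplex K x.
Proof.
move=> Omx nsx; have /mesh_cover[K KTh Kx] := subset_closure Omx.
exists K => // i; rewrite lt_neqAle eq_sym andbC.
have /(simplexP x (mesh_independent KTh)) -> := Kx; apply/eqP => b0.
apply: nsx; exists (K, i) => //.
by apply/allpairsP; exists (K, i); rewrite mem_enum.
Qed.

Lemma ae_good : {ae leb, forall x, Om x -> exists2 K, K \in Th & inner_simplex K x}.
Proof.
apply: (negligibleS _ skeleton_negligible) => x /= h; apply: contrapT => nsx.
by apply: h => Omx; exact: good_point.
Qed.

Let mOm : measurable (Om : set lebT) := measurableOm.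
Let Om_lty := lebesgue_Om_lty.

(** * Continuous piecewise affine functions *)

Section P1_functions.
Implicit Types (f g : 'rV[R]_d -> R) (K : 'M[R]_(d.+1, d)) (x y : 'rV[R]_d).

(** The gradient of the affine function that interpolates [f] at the vertices of [K]. *)
Definition slope K f : 'rV[R]_d := \sum_i f (row i K) *: bary_slope K i.

Lemma slope_lin K k f g :
  slope K (fun x => k * f x + g x) = k *: slope K f + slope K g.
Proof.
rewrite /slope scaler_sumr -big_split; apply: eq_bigr => i _.
by rewrite scalerDl scalerA.
Qed.

Lemma vertex_simplex K i : affinely_independent K -> simplex K (row i K).
Proof. by move=> indK; apply/simplexP => // j; rewrite bary_vertex. Qed.

Lemma P1_bary f K x : P1 Om Th f -> K \in Th -> simplex K x ->
  f x = \sum_i bary K x i * f (row i K).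
Proof.
move=> [_ fP] KTh Kx; have indK := mesh_independent KTh.
have [a [b ab]] := fP _ KTh; have [s1 sK] := bary_combination x indK.
rewrite ab// -[in LHS]sK ddot_mulmx ddot_rowE.
under [RHS]eq_bigr => i _ do rewrite (ab _ (vertex_simplex i indK)) mulrDr.
rewrite big_split/= -mulr_suml s1 mul1r; congr (_ + _).
apply: eq_bigr => i _; rewrite mxE; congr (_ * _).
rewrite ddot_rowE mxE; apply: eq_bigr => j _; rewrite !mxE mulrC//.
Qed.

Lemma P1_affine f K x y : P1 Om Th f -> K \in Th -> simplex K x -> simplex K y ->
  f y = f x + ddot (y - x) (slope K f).
Proof.
move=> fP KTh Kx Ky; rewrite (P1_bary fP KTh Kx) (P1_bary fP KTh Ky) ddot_sumr -big_split/=.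
apply: eq_bigr => i _; rewrite ddotZr ddotBl /bary; ring.
Qed.

Lemma P1_partial f K x j : P1 Om Th f -> K \in Th -> inner_simplex K x ->
  partial j f x = slope K f 0 j.
Proof.
move=> fP KTh Kx; have indK := mesh_independent KTh; apply: partial_affine.
apply: (filterS (P := inner_simplex K)).
  by move=> y Ky; apply: (P1_affine fP KTh); exact: inner_simplex_sub.
by apply: open_nbhs_nbhs; split => //; exact: open_inner_simplex.
Qed.

Lemma P1_grad f K x : P1 Om Th f -> K \in Th -> inner_simplex K x ->
  grad f x = slope K f.
Proof. by move=> fP KTh Kx; apply/rowP => j; rewrite mxE (P1_partial j fP KTh Kx). Qed.

Lemma P1_lin k f g : P1 Om Th f -> P1 Om Th g -> P1 Om Th (fun x => k * f x + g x).
Proof.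
move=> [cf fP] [cg gP]; split.
  move=> x; apply: cvgD; last exact: cg.
  by apply: cvgM; [exact: cvg_cst|exact: cf].
move=> K KTh; have [a [b ab]] := fP _ KTh; have [a' [b' ab']] := gP _ KTh.
exists (k *: a + a'), (k * b + b') => x Kx.
by rewrite ab// ab'// ddotDr ddotZr; ring.
Qed.

Lemma P1_cst c : P1 Om Th (fun=> c).
Proof.
split; first by move=> x; exact: cvg_cst.
by move=> K _; exists 0, c => x _; rewrite ddot0r add0r.
Qed.

Definition vertex_sum f : R := \sum_(K <- Th) \sum_i `|f (row i K)|.

Lemma P1_bounded f x : P1 Om Th f -> closure Om x -> `|f x| <= vertex_sum f.
Proof.
move=> fP /mesh_cover[K KTh Kx]; have indK := mesh_independent KTh.
rewrite (P1_bary fP KTh Kx) /vertex_sum (big_rem K)//=.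
have /(simplexP _ indK) b0 := Kx; have [s1 _] := bary_combination x indK.
apply: (@le_trans _ _ (\sum_i `|f (row i K)|)); last first.
  by rewrite lerDl; apply: sumr_ge0 => *; exact: sumr_ge0.
apply: (le_trans (ler_norm_sum _ _ _)); apply: ler_sum => i _.
rewrite normrM ler_piMl// ger0_norm// -s1 (bigD1 i)//= lerDl.
exact: sumr_ge0.
Qed.

Lemma P1_eq0 f : P1 Om Th f -> (forall K i, K \in Th -> f (row i K) = 0) ->
  forall x, closure Om x -> f x = 0.
Proof.
move=> fP f0 x /mesh_cover[K KTh Kx].
rewrite (P1_bary fP KTh Kx) big1// => i _; by rewrite f0// mulr0.
Qed.

Section measurable_P1.
Variable mu : {outer_measure set 'rV[R]_d -> \bar R}.
Hypothesis mu_ddot : forall a : 'rV[R]_d,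
  measurable_fun [set: caratheodory_type mu] (fun x => ddot x a).
Let U := caratheodory_type mu.

(** On each simplex [f] is a combination of barycentric coordinates, measurable as soon as linear
    functionals are. The outer measure is left open so that the lemma covers both volume and
    surface. *)
Lemma measurable_P1 (D : set U) f : measurable D -> D `<=` closure Om ->
  P1 Om Th f -> measurable_fun D f.
Proof.
move=> mD DOm fP _ Y mY.
rewrite (_ : D `&` f @^-1` Y = D `&` [set x | exists2 K, K \in Th &
    (simplex K `&` (fun x => \sum_i bary K x i * f (row i K)) @^-1` Y) x]).
  apply: measurableI => //; apply: measurable_union_seq => K KTh.
  have : measurable_fun [set: U] (fun x => \sum_i bary K x i * f (row i K)).
    apply: measurable_sum => i; apply: measurable_funM => //.
    exact: (measurable_bary (T := U) (g := id) mu_ddot).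
  move=> /(_ measurableT _ mY); rewrite setTI => mK.
  by apply: measurableI => //; exact: (measurable_simplex (T := U) (g := id) mu_ddot (mesh_independent KTh)).
apply/seteqP; split => x [Dx] /=.
  move=> fY; split => //; have /mesh_cover[K KTh Kx] := DOm _ Dx.
  by exists K => //; split => //=; rewrite -(P1_bary fP KTh Kx).
by move=> [K KTh [Kx /= KY]]; split => //=; rewrite (P1_bary fP KTh Kx).
Qed.

End measurable_P1.

Lemma lebesgue_ddot (a : 'rV[R]_d) : measurable_fun [set: lebT] (fun x => ddot x a).
Proof.
move=> _ Y mY; apply: borel_measurable_lebesgue.
by apply: borel_ddot => //.
Qed.

Lemma essbdd_P1 f : P1 Om Th f -> essbdd leb Om f.
Proof.
move=> fP; split.
  exact: (measurable_P1 lebesgue_ddot mOm (@subset_closure _ _) fP).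
exists (vertex_sum f); apply: aeW => x Omx.
by apply: P1_bounded => //; exact: subset_closure.
Qed.

(** Nothing is known of [g] on the skeleton, where it may be a junk derivative; completeness makes
    this harmless. *)
Lemma essbdd_piecewise g :
  (forall K, K \in Th -> exists c, forall x, Om x -> inner_simplex K x -> g x = c) ->
  essbdd leb Om g.
Proof.
move=> gP.
split.
  move=> _ Y mY.
  rewrite (_ : Om `&` g @^-1` Y = [set x | exists2 K, K \in Th &
      (Om `&` (inner_simplex K `&` g @^-1` Y)) x] `|` (Om `&` skeleton `&` g @^-1` Y)).
    apply: measurableU.
      apply: measurable_union_seq => K KTh; have [c gc] := gP _ KTh.
      have [Yc|Yc] := pselect (Y c).
        rewrite (_ : _ `&` _ = Om `&` inner_simplex K).
          apply: measurableI => //; apply: borel_measurable_lebesgue.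
          exact: (measurable_inner_simplex (g := id) (@borel_ddot R d)).
        apply/seteqP; split => x [Omx] => [[]//|Kx].
        by do 2 split => //=; rewrite (gc x).
      rewrite (_ : _ `&` _ = set0); first exact: measurable0.
      by apply/seteqP; split => x //; move=> [Omx [Kx /=]]; rewrite (gc x).
    apply: lebesgue_negligible_measurable.
    apply: (negligibleS _ (skeleton_negligible)).
    by move=> x [[]].
  apply/seteqP; split => x.
    move=> [Omx gY]; have [sx|sx] := pselect (skeleton x); first by right.
    by left; have [K KTh Kx] := good_point Omx sx; exists K.
  by move=> [[K KTh [Omx [_ gY]]]|[[Omx _] gY]].
have /choice[c cP] : forall K, exists c, K \in Th -> forall x, Om x -> inner_simplex K x -> g x = c.
  move=> K; have [KTh|KTh] := boolP (K \in Th); last by exists 0.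
  by have [c gc] := gP _ KTh; exists c.
exists (\sum_(K <- Th) `|c K|).
apply: (ae_lebesgue_imp _ (ae_good)) => x /= h Omx; have [K KTh Kx] := h Omx.
by rewrite (cP K)// (big_rem K)//= lerDl sumr_ge0.
Qed.

Lemma essbdd_partial f j : P1 Om Th f -> essbdd leb Om (partial j f).
Proof.
move=> fP; apply: essbdd_piecewise => K KTh; exists (slope K f 0 j) => x _ Kx.
exact: P1_partial.
Qed.

(** As [Om] is open, small difference quotients at [x] only see values in [Om]. The congruence of
    gradients and strains rests on this. *)
Lemma partial_congr f g x j : Om x -> (forall y, Om y -> f y = g y) ->
  partial j f x = partial j g x.
Proof.
move=> Omx fg; rewrite /partial /derive; congr (lim _).
apply/funext => U; rewrite propeqE.
have near_eq : \forall t \near (0 : R)^', t^-1 *: ((f \o shift x) (t *: delta_mx 0 j) - f x) =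
    t^-1 *: ((g \o shift x) (t *: delta_mx 0 j) - g x).
  have /nbhs_frobP[r r0 rOm] : nbhs x Om by apply: open_nbhs_nbhs; split => //; exact: openOm.
  near=> t; rewrite /= (fg x)// fg//; apply: rOm.
  by rewrite addrK frobZ frob_delta mulr1; near: t; apply: dnbhs0_lt.
by split; move: near_eq; apply: filterS2 => t /= ->.
Unshelve. all: by end_near. Qed.

Lemma grad_congr f g x : Om x -> (forall y, Om y -> f y = g y) -> grad f x = grad g x.
Proof. by move=> Omx fg; apply/rowP => j; rewrite !mxE; exact: partial_congr. Qed.

Lemma ae_grad_lin k f g : P1 Om Th f -> P1 Om Th g ->
  {ae leb, forall x, Om x -> grad (fun x => k * f x + g x) x = k *: grad f x + grad g x}.
Proof.
move=> fP gP; apply: (ae_lebesgue_imp _ (ae_good)) => x /= h Omx.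
have [K KTh Kx] := h Omx.
by rewrite !(P1_grad _ KTh Kx)// ?slope_lin//; exact: P1_lin.
Qed.

End P1_functions.

(** * Traces, rigid motions and Korn's uniqueness *)

Section function_spaces.
Implicit Types (f g : 'rV[R]_d -> R) (u w : 'rV[R]_d -> 'rV[R]_d).

Lemma closure_frob_bounded : exists2 B, 0 <= B & forall x, closure Om x -> frob x <= B.
Proof.
exists (\sum_(K <- Th) \sum_i frob (row i K)) => [|x /mesh_cover[K KTh Kx]].
  by apply: sumr_ge0 => K _; apply: sumr_ge0 => i _; exact: frob_ge0.
rewrite (big_rem K)//=; apply: (@le_trans _ _ (\sum_i frob (row i K))); last first.
  by rewrite lerDl; apply: sumr_ge0 => *; apply: sumr_ge0 => *; exact: frob_ge0.
move: Kx => [l [l0 l1] ->]; rewrite mulmx_sum_row.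
elim/big_ind2: _ => [|x1 x2 y1 y2 h1 h2|i _].
- by rewrite frob0.
- by apply: (le_trans (frobD _ _)); exact: lerD.
- rewrite frobZ ler_piMl ?frob_ge0// ger0_norm// -l1 (bigD1 i)//= lerDl.
  exact: sumr_ge0.
Qed.

Lemma closure_compact : compact (closure Om).
Proof.
have [B _ h] := closure_frob_bounded; apply: (frob_bounded_closed_compact h).
exact: closed_closure.
Qed.

Lemma essbdd_continuous f : continuous f -> essbdd leb Om f.
Proof.
move=> cf; split.
  apply: (@measurable_funS _ _ _ _ setT) => //.
  move=> _ Y mY; apply: borel_measurable_lebesgue.
  exact: continuous_borel.
have cfOm : compact (f @` closure Om).
  apply: continuous_compact; last exact: closure_compact.
  exact: continuous_subspaceT.
have [M [_ hM]] := compact_bounded cfOm; exists (`|M| + 1); apply: aeW => x Omx.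
apply: hM; first by apply: (le_lt_trans (ler_norm _)); rewrite ltrDl.
by exists x => //; exact: subset_closure.
Qed.

Lemma H1_lin k f g : H1 Om f -> H1 Om g -> H1 Om (fun x => k * f x + g x).
Proof.
move=> [Lf wf] [Lg wg]; split; first exact: L2_lin.
move=> j; have [F LF hF] := wf j; have [G LG hG] := wg j.
exists (fun x => k * F x + G x) => [|phi tphi]; first exact: L2_lin.
have [ck _ _] := tphi; have [_ cphi'] := ck 1%N; have cphi := ck 0%N.
have Lphi : L2 leb Om phi by apply: essbdd_L2 => //; exact: essbdd_continuous.
have Lphi' : L2 leb Om (partial j phi).
  by apply: essbdd_L2 => //; apply: essbdd_continuous; exact: cphi'.
have lin (a b c : 'rV[R]_d -> R) : L2 leb Om a -> L2 leb Om b -> L2 leb Om c ->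
    \int[leb]_(x in Om) ((k * a x + b x) * c x) =
    k * \int[leb]_(x in Om) (a x * c x) + \int[leb]_(x in Om) (b x * c x).
  move=> La Lb Lc; have I1 := L2_integrableM mOm La Lc; have I2 := L2_integrableM mOm Lb Lc.
  rewrite -RintegralZl// -RintegralD//.
    by apply: eq_Rintegral => x _; rewrite mulrDl mulrA.
  by have := integrableZl mOm k I1; apply: eq_integrable.
by rewrite !lin// hF// hG//; ring.
Qed.

Lemma H1_0 : H1 Om (fun=> 0).
Proof.
have L0 : L2 leb Om (fun=> 0 : R) by apply: essbdd_L2 => //; exact: essbdd_cst.
split => // j; exists (fun=> 0) => // phi _.
rewrite (_ : \int[_]_(x in _) _ = 0); last first.
  by rewrite /Rintegral integral0_eq// => x _; rewrite mul0r.
by rewrite (_ : \int[_]_(x in _) _ = 0) ?oppr0// /Rintegral integral0_eq// => x _; rewrite mul0r.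
Qed.

Definition P1_vec u : Prop := forall i, P1 Om Th (fun x => u x 0 i).

Lemma P1_vec_lin k u w : P1_vec u -> P1_vec w -> P1_vec (fun x => k *: u x + w x).
Proof.
by move=> hu hw i; under eq_fun do rewrite !mxE; exact: P1_lin.
Qed.

Lemma P1_vec_near u x e : P1_vec u -> closure Om x -> 0 < e ->
  exists2 r, 0 < r & forall y, closure Om y -> frob (y - x) < r -> frob (u y - u x) <= e.
Proof.
move=> hu cx e0.
have e1 : 0 < e / (d%:R + 1) by rewrite divr_gt0// ltr_wpDl.
have : \forall y \near x, forall i, closure Om y -> `|u y 0 i - u x 0 i| <= e / (d%:R + 1).
  apply: (@filter_forall _ _ _ _ (nbhs_filter (x : 'rV[R]_d))) => i; have [/subspace_continuousP/(_ x cx) ci _] := hu i.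
  have /cvgrPdist_le/(_ _ e1) hi := ci.
  have {}hi : nbhs (x : 'rV[R]_d) [set y | closure Om y -> `|u x 0 i - u y 0 i| <= e / (d%:R + 1)] := hi.
  by apply: (filterS _ hi) => y h cy; rewrite distrC; exact: h.
move=> /nbhs_frobP[r r0 h]; exists r => // y cy yx.
apply: (@le_trans _ _ (1%:R * d%:R * (e / (d%:R + 1)))).
  by apply: frob_le_entries => i j; rewrite (ord1 i) !mxE; exact: h.
rewrite mul1r mulrCA ler_piMr ?(ltW e0)// ler_pdivrMr ?ltr_wpDl// mul1r; lra.
Qed.

(** P1 fields are continuous up to the boundary, so the means tend to the value. The sets averaged
    over are open and nonempty, hence of positive measure. *)
Lemma mean_cvg u x : P1_vec u -> closure Om x ->
  \int[leb]_(y in Om `&` [set y | (frob (y - x) < r)%R]) frob (u y - 0) /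
  fine (leb (Om `&` [set y | (frob (y - x) < r)%R])) @[r --> 0^'+] --> frob (u x).
Proof.
move=> hu cx; apply/cvgrPdist_le => e e0.
have [r0 r00 h] := P1_vec_near hu cx e0.
near=> r.
have rr0 : r < r0 by near: r; exact: nbhs_right_lt.
have r_gt0 : 0 < r by near: r; exact: nbhs_right_gt.
set A := Om `&` _.
have oA : open A.
  apply: openI; first exact: openOm.
  rewrite openE => y /= yr; apply/nbhs_frobP; exists (r - frob (y - x)) => [|z zy].
    by rewrite subr_gt0.
  rewrite /= -(subrK y z) -addrA; apply: (le_lt_trans (frobD _ _)); lra.
have mA : measurable (A : set lebT) by apply: borel_measurable_lebesgue; exact: open_borel.
have A_neq0 : A !=set0.
  have : nbhs x [set y | frob (y - x) < r] by apply/nbhs_frobP; exists r.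
  by move=> /cx[y [Omy yr]]; exists y.
have A_gt0 : (0 < leb A)%E := lebesgue_open_gt0 mA oA A_neq0.
have A_lty : (leb A < +oo)%E.
  apply: le_lt_trans Om_lty; apply: le_measure; rewrite ?inE//.
  by move=> y [].
have mu0 : 0 < fine (leb A) by apply: fine_gt0; rewrite A_gt0.
have fA y : A y -> `|frob (u y - 0) - frob (u x)| <= e.
  move=> [Omy yr]; rewrite subr0.
  have : frob (u y - u x) <= e by apply: h; [exact: subset_closure|exact: lt_trans rr0].
  rewrite ler_norml; have := frobD (u y - u x) (u x); have := frobD (u x - u y) (u y).
  rewrite !subrK (frobC (u x)); lra.
have intf : (leb : {measure set lebT -> \bar R}).-integrable A (EFin \o (fun y => frob (u y - 0))).
  apply: (essbdd_integrable mA A_lty); split; last first.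
    exists (frob (u x) + e); apply: aeW => y /fA h'; rewrite ger0_norm ?frob_ge0//.
    by move: h'; rewrite ler_norml; lra.
  apply: measurable_frob => i j.
  apply: (measurable_funS mOm); first by move=> y [].
  rewrite (_ : (fun y => _) = (fun y => u y 0 j)); first by case: (essbdd_P1 (hu j)).
  by apply/funext => y; rewrite (ord1 i) !mxE subr0.
have intc c : (leb : {measure set lebT -> \bar R}).-integrable A (EFin \o (fun y => c)).
  by apply: (essbdd_integrable mA A_lty); exact: essbdd_cst.
have up : \int[leb]_(y in A) frob (u y - 0) <= (frob (u x) + e) * fine (leb A).
  rewrite -Rintegral_cst//; apply: le_Rintegral => // y /fA; rewrite ler_norml; lra.
have lo : (frob (u x) - e) * fine (leb A) <= \int[leb]_(y in A) frob (u y - 0).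
  rewrite -Rintegral_cst//; apply: le_Rintegral => // y /fA; rewrite ler_norml; lra.
rewrite ler_norml; apply/andP; split.
  by rewrite lerBDl addrC -lerBDl opprK ler_pdivrMr// addrC.
by rewrite lerBlDl addrC -lerBlDl ler_pdivlMr.
Unshelve. all: by end_near. Qed.

Lemma has_traceP u x : P1_vec u -> closure Om x -> has_trace Om u x 0 <-> u x = 0.
Proof.
move=> hu cx; have hm := mean_cvg hu cx; rewrite /has_trace; split => [h|ux].
  by apply: frob_eq0; apply: (cvg_unique _ hm h).
by move: hm; rewrite ux frob0.
Qed.

(** Turns the trace condition into one on point values, which is visibly stable under linear
    combinations and can be used with the explicit form of a rigid motion. *)
Lemma P1_zero_traceP u : P1_zero_trace Om SigD Th u <->
  [/\ P1_vec u, forall i, H1 Om (fun x => u x 0 i) &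
      hausdorff d.-1 (SigD `&` [set x | u x <> 0]) = 0%E].
Proof.
have E : P1_vec u -> SigD `&` [set x | ~ has_trace Om u x 0] = SigD `&` [set x | u x <> 0].
  move=> hu; apply/seteqP; split => x [Sx h]; split => //; move: h => /=.
    by move=> h ux; apply: h; apply/has_traceP => //; exact: SigD_closure.
  by move=> h ux; apply: h; apply/(has_traceP hu) => //; exact: SigD_closure.
split; first by move=> [hu [h1 h2]]; split => //; rewrite -E.
by move=> [hu h1 h2]; split => //; split => //; rewrite E.
Qed.

Lemma P1_zero_trace_lin k u w : P1_zero_trace Om SigD Th u -> P1_zero_trace Om SigD Th w ->
  P1_zero_trace Om SigD Th (fun x => k *: u x + w x).
Proof.
move=> /P1_zero_traceP[u1 u2 u3] /P1_zero_traceP[w1 w2 w3]; apply/P1_zero_traceP.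
split; first exact: P1_vec_lin.
  by move=> i; under eq_fun do rewrite !mxE; exact: H1_lin.
apply/eqP; rewrite eq_le outer_measure_ge0 andbT.
apply: (@le_trans _ _ (hausdorff d.-1 ((SigD `&` [set x | u x <> 0]) `|` (SigD `&` [set x | w x <> 0])))).
  apply: le_outer_measure => x [Sx /= h].
  have [ux|] := pselect (u x = 0); last by left.
  by right; split => // wx; apply: h; rewrite ux wx scaler0 addr0.
apply: (le_trans (outer_measureU2 _ _ _)).
rewrite -[leRHS]adde0; apply: leeD; apply: eq_le_ereal; [exact: u3|exact: w3].
Qed.

Lemma P1_zero_trace_0 : P1_zero_trace Om SigD Th (fun=> 0).
Proof.
apply/P1_zero_traceP; split.
- by move=> i; under eq_fun do rewrite mxE; exact: P1_cst.
- by move=> i; under eq_fun do rewrite mxE; exact: H1_0.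
- by rewrite (_ : _ `&` _ = set0) ?outer_measure0//; apply/seteqP; split => x // [].
Qed.

Definition jac_slope K u : 'M[R]_d := \matrix_(i, j) slope K (fun x => u x 0 i) 0 j.

Lemma P1_jac u K x : P1_vec u -> K \in Th -> inner_simplex K x -> jac u x = jac_slope K u.
Proof.
move=> hu KTh Kx; apply/matrixP => i j; rewrite !mxE.
by rewrite (P1_partial _ (hu i) KTh Kx).
Qed.

Lemma quadratic_symm (A : 'M[R]_d) (z : 'rV[R]_d) : ddot (z *m A) z = ddot (z *m symm A) z.
Proof.
rewrite /symm -scalemxAr mulmxDr ddotZl ddotDl.
by rewrite (ddot_mulmx z A^T) trmxK (ddotC z); lra.
Qed.

Lemma P1_diff_simplex u K x y : P1_vec u -> K \in Th -> simplex K x -> simplex K y ->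
  u y - u x = (y - x) *m (jac_slope K u)^T.
Proof.
move=> hu KTh Kx Ky; apply/rowP => i.
rewrite [LHS]mxE [X in _ + X]mxE (P1_affine (hu i) KTh Kx Ky) addrAC subrr add0r.
by rewrite ddot_rowE mxE; apply: eq_bigr => j _; rewrite !mxE.
Qed.

Section rigid.
Variable u : 'rV[R]_d -> 'rV[R]_d.
Hypothesis hu : P1_vec u.
Hypothesis symm0 : forall K, K \in Th -> symm (jac_slope K u) = 0.

Lemma orthogonal_simplex K x y : K \in Th -> simplex K x -> simplex K y ->
  ddot (u y - u x) (y - x) = 0.
Proof.
move=> KTh Kx Ky; rewrite (P1_diff_simplex hu KTh Kx Ky) ddot_mulmx trmxK ddotC.
by rewrite quadratic_symm symm0// mulmx0 ddot0l.
Qed.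

(* Along a segment, (u . (y - x)) is continuous and constant on each simplex, so
   it takes finitely many values, hence one value. *)
Lemma orthogonal_segment x y : (forall t, 0 <= t <= 1 -> closure Om (x + t *: (y - x))) ->
  ddot (u y - u x) (y - x) = 0.
Proof.
move=> seg; pose z t := x + t *: (y - x); pose phi t := ddot (u (z t) - u x) (y - x).
have z0 : z 0 = x by rewrite /z scale0r addr0.
have z1 : z 1 = y by rewrite /z scale1r addrC subrK.
suff : phi 1 = 0 by rewrite /phi z1.
have phi0 : phi 0 = 0 by rewrite /phi z0 subrr ddot0l.
have zB s t : z s - z t = (s - t) *: (y - x).
  by rewrite /z opprD addrACA subrr add0r scalerBl.
have phi_const K s t : K \in Th -> simplex K (z s) -> simplex K (z t) -> phi s = phi t.
  move=> KTh Ks Kt; have [->//|st] := eqVneq s t.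
  have := orthogonal_simplex KTh Kt Ks; rewrite zB ddotZr => /eqP.
  rewrite mulf_eq0 subr_eq0 (negPf st)/= => /eqP h.
  by apply/eqP; rewrite -subr_eq0 /phi -ddotBl opprB addrA subrK h.
have cphi : {within `[0, 1], continuous phi}.
  apply/subspace_continuousP => t; rewrite /= in_itv/= => t01.
  apply/cvgrPdist_le => e e0; rewrite /within/=.
  have c1 : 0 < frob (y - x) + 1 by rewrite ltr_wpDl ?frob_ge0.
  have [|r r0 h] := P1_vec_near hu (seg _ t01) (e := e / (frob (y - x) + 1)).
    by rewrite divr_gt0.
  have rc : 0 < r / (frob (y - x) + 1) by rewrite divr_gt0.
  apply: filterS (nbhsx_ballx t _ rc) => s; rewrite /ball/= => sr; rewrite in_itv/= => s01.
  rewrite /phi -ddotBl opprB addrA subrK; apply: (le_trans (ddot_le_frob _ _)).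
  apply: (@le_trans _ _ (e / (frob (y - x) + 1) * (frob (y - x) + 1))); last by rewrite divfK ?lt0r_neq0.
  apply: ler_pM; rewrite ?frob_ge0 ?lerDl// frobC; apply: h; first exact: seg.
  rewrite -/(z s) -/(z t) zB frobZ distrC.
  move: sr; rewrite ltr_pdivlMr//; apply: le_lt_trans.
  by rewrite ler_wpM2l ?normr_ge0// lerDl.
apply/eqP; apply: contraT => phi1.
(* Pigeonhole: [n + 1] distinct values strictly between 0 and [phi 1] are taken at points that lie
   in only [n] simplices. *)
pose n := size Th; pose value (j : 'I_n.+1) := phi 1 * (j.+1%:R / n.+2%:R).
have /choice[t tP] : forall j, exists t, (0 <= t <= 1) /\ phi t = value j.
  move=> j; have [|t] := @IVT R phi 0 1 (value j) ler01 cphi.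
    have f0 : 0 <= j.+1%:R / n.+2%:R :> R by rewrite divr_ge0.
    have f1 : j.+1%:R / n.+2%:R <= 1 :> R.
      by rewrite ler_pdivrMr ?ltr0n// mul1r ler_nat ltnS ltnW.
    rewrite phi0 /value; case: (leP 0 (phi 1)) => p1.
      by rewrite mulr_ge0//= ler_piMr.
    by rewrite andbC mulr_le0_ge0 ?(ltW p1)//= ler_niMr ?(ltW p1).
  by rewrite in_itv/= => t01 phit; exists t.
have /choice[K KP] : forall j, exists K, K \in Th /\ simplex K (z (t j)).
  move=> j; have [t01 _] := tP j; have /mesh_cover[K KTh Kz] := seg _ t01.
  by exists K.
have idx j : (index (K j) Th < n)%N by rewrite index_mem; case: (KP j).
have : injective (fun j => Ordinal (idx j)).
  move=> j k /(congr1 val)/= jk; have [Kj zj] := KP j; have [Kk zk] := KP k.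
  have Kjk : K j = K k by rewrite -(nth_index 0 Kj) -(nth_index 0 Kk) jk.
  have := phi_const _ _ _ Kj zj; rewrite Kjk => /(_ _ zk).
  have [_ ->] := tP j; have [_ ->] := tP k; rewrite /value => /(mulfI phi1).
  move=> /(mulIf _) h; apply/val_inj/eqP; rewrite -eqSS -(eqr_nat R); apply/eqP.
  by apply: h; rewrite invr_eq0 pnatr_eq0.
by move=> /leq_card; rewrite !card_ord ltnn.
Qed.

(** Orthogonality of all differences makes [U z . z'] antisymmetric in [z] and [z']. Testing with
    multiples of basis vectors that fit into the box expresses [U z] linearly in [z]. *)
Lemma rigid_box x0 r : 0 < r -> box x0 r `<=` Om ->
  exists W : 'M[R]_d, (forall z : 'rV[R]_d, ddot (z *m W) z = 0) /\
    forall x, box x0 r x -> u x = u x0 + (x - x0) *m W.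
Proof.
move=> r0 bOm; pose U z := u (x0 + z) - u x0.
pose small (z : 'rV[R]_d) := forall i, `|z 0 i| < r.
have inb z : small z -> box x0 r (x0 + z).
  by move=> sz i; rewrite mxE addrAC subrr add0r.
have s0 : small 0 by move=> i; rewrite mxE normr0.
have orth z z' : small z -> small z' -> ddot (U z - U z') (z - z') = 0.
  move=> sz sz'; have := @orthogonal_segment (x0 + z') (x0 + z).
  rewrite (_ : x0 + z - (x0 + z') = z - z'); last by rewrite opprD addrACA subrr add0r.
  rewrite (_ : U z - U z' = u (x0 + z) - u (x0 + z')); last by rewrite /U opprB addrA subrK.
  apply=> t t01; apply: subset_closure; apply: bOm; rewrite -addrA; apply: inb => i.
  rewrite !mxE; have := sz i; have := sz' i; rewrite !ltr_norml => h1 h2.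
  rewrite (_ : _ + _ = (1 - t) * z' 0 i + t * z 0 i); last by ring.
  move: t01 h1 h2 => /andP[t0 t1] /andP[a1 a2] /andP[b1 b2].
  have [t1'|t1'] := ltP t 1.
    have : 0 < 1 - t by lra.
    move=> q0; apply/andP; split; nra.
  have -> : t = 1 by apply/eqP; rewrite eq_le t1 t1'.
  by rewrite subrr mul0r add0r mul1r b1.
have U0 : U 0 = 0 by rewrite /U addr0 subrr.
have orth0 z : small z -> ddot (U z) z = 0.
  by move=> sz; have := orth _ _ sz s0; rewrite U0 !subr0.
have anti z z' : small z -> small z' -> ddot (U z) z' = - ddot (U z') z.
  move=> sz sz'; have := orth _ _ sz sz'; rewrite ddotBl !ddotBr (orth0 z)// (orth0 z')//; lra.
pose b j : 'rV[R]_d := (r / 2) *: delta_mx 0 j.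
have sb j : small (b j).
  move=> i; rewrite !mxE eqxx/=; case: (i == j); rewrite ?mulr1 ?mulr0 ?normr0//.
  by rewrite ger0_norm ?divr_ge0 ?(ltW r0)//; lra.
pose W : 'M[R]_d := \matrix_(i, j) (- (r / 2)^-1 * U (b j) 0 i).
have r2 : r / 2 != 0 by rewrite lt0r_neq0// divr_gt0.
have UW z : small z -> U z = z *m W.
  move=> sz; apply/rowP => j; have := anti _ _ sz (sb j).
  rewrite {1}/b ddotZr ddotC ddot_delta => /(canRL (mulKf r2)) ->; rewrite ddot_rowE mxE mulrN mulr_sumr -sumrN.
  by apply: eq_bigr => i _; rewrite !mxE; ring.
exists W; split => [z|x bx].
  have fz : 0 < frob z + 1 by rewrite ltr_wpDl ?frob_ge0.
  pose t := r / (frob z + 1); have t0 : 0 < t by rewrite divr_gt0.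
  have stz : small (t *: z).
    move=> i; rewrite mxE normrM (ger0_norm (ltW t0)) /t mulrAC ltr_pdivrMr// ltr_pM2l//.
    by apply: (le_lt_trans (entry_le_frob z 0 i)); rewrite ltrDl.
  have := orth0 _ stz; rewrite UW// -scalemxAl ddotZl ddotZr => /eqP.
  by rewrite mulf_eq0 (gt_eqF t0)/= mulf_eq0 (gt_eqF t0)/= => /eqP.
have /UW : small (x - x0) by move=> i; rewrite !mxE; have := bx i.
by rewrite /U [x0 + _]addrC subrK => <-; rewrite addrC subrK.
Qed.

Lemma affine_nbhs_eq (W W' : 'M[R]_d) (b b' x : 'rV[R]_d) :
  (\forall y \near x, y *m W + b = y *m W' + b') -> W = W' /\ b = b'.
Proof.
move=> /nbhs_frobP[r r0 h].
have hx : x *m W + b = x *m W' + b' by apply: h; rewrite subrr frob0.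
have WW : W = W'.
  apply/row_matrixP => i; rewrite !rowE.
  pose z : 'rV[R]_d := delta_mx 0 i.
  have fz : 0 < frob z + 1 by rewrite ltr_wpDl ?frob_ge0.
  pose t := r / (frob z + 1); have t0 : 0 < t by rewrite divr_gt0.
  have := h (x + t *: z); rewrite addrAC subrr add0r frobZ (ger0_norm (ltW t0)).
  have -> : t * frob z < r.
    by rewrite /t mulrAC ltr_pdivrMr// ltr_pM2l// ltrDl.
  move=> /(_ isT); rewrite !mulmxDl addrAC hx addrAC => /addIr /addrI.
  rewrite -!scalemxAl => /(congr1 (fun v => t^-1 *: v)).
  by rewrite !scalerA mulVf ?lt0r_neq0// !scale1r.
by split => //; move: hx; rewrite WW => /addrI.
Qed.

(** Near each point [u] is affine by [rigid_box], and affine maps that agree on an open set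
    coincide. Hence the interior of the set where [u] equals one of these maps is also closed in
    [Om], and [Om] is connected. *)
Lemma rigid_domain : exists (W : 'M[R]_d) (b : 'rV[R]_d),
  (forall z : 'rV[R]_d, ddot (z *m W) z = 0) /\ forall x, closure Om x -> u x = x *m W + b.
Proof.
have local x : Om x -> exists W b, (forall z : 'rV[R]_d, ddot (z *m W) z = 0) /\
    \forall y \near x, u y = y *m W + b.
  move=> Omx; have /nbhs_ballP[r /= r0 rOm] : nbhs x Om.
    by apply: open_nbhs_nbhs; split => //; exact: openOm.
  rewrite ballE_box// in rOm; have [W [W0 hW]] := rigid_box r0 rOm.
  exists W, (u x - x *m W); split => //; apply/nbhs_ballP; exists r => //= y.
  rewrite ballE_box// => /hW ->; rewrite mulmxBl addrCA.
  by rewrite addrA.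
have [Om0|/set0P[x1 Omx1]] := eqVneq Om set0.
  exists 0, 0; split => [z|x]; first by rewrite mulmx0 ddot0l.
  by rewrite Om0 closure0.
have [W [b [W0 near1]]] := local _ Omx1.
exists W, b; split => //.
pose Q := [set y | u y = y *m W + b].
have SOm : Om `&` Q° = Om.
  have [_ cOm _ _ _] := hOm; apply: cOm.
  - by exists x1; split.
  - by exists Q°; [exact: open_interior|].
  - exists (closure (Om `&` Q°)); first exact: closed_closure.
    apply/seteqP; split => x [Omx Qx]; split => //; first by apply: subset_closure.
    have [W' [b' [_ near']]] := local _ Omx.
    have [y [[Omy Qy] ny]] := Qx _ (nbhs_interior near').
    have [WW bb] : W = W' /\ b = b'.
      by apply: (@affine_nbhs_eq _ _ _ _ y); apply: filterS2 Qy ny => z /= <- <-.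
    by rewrite /Q WW bb; exact: near'.
have uOm x : Om x -> u x = x *m W + b.
  by rewrite -{1}SOm => -[_ /interior_subset].
(* Continuity carries the formula from [Om] to its closure. *)
move=> x cx; apply/eqP; rewrite -subr_eq0; apply/eqP; apply: frob_eq0.
apply/eqP; rewrite eq_le frob_ge0 andbT; apply/ler_addgt0Pl => e e0; rewrite addr0.
have [L L0 hL] := frob_mulmx_le W.
have [|r r0 h] := P1_vec_near hu cx (e := e / 2); first by rewrite divr_gt0.
pose r' := Num.min r (e / 2 / (L + 1)).
have r'0 : 0 < r' by rewrite lt_min r0 !divr_gt0// ltr_wpDl.
have : nbhs x [set y | frob (y - x) < r'] by apply/nbhs_frobP; exists r'.
move=> /cx[y [Omy /= ]]; rewrite lt_min => /andP[yr yL].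
have -> : u x - (x *m W + b) = - (u y - u x) + (y - x) *m W.
  by rewrite (uOm _ Omy) mulmxBl; apply/rowP => i; rewrite !mxE; ring.
apply: (le_trans (frobD _ _)); rewrite frobN.
have h1 : frob (u y - u x) <= e / 2 by apply: h => //; exact: subset_closure.
have h2 : frob ((y - x) *m W) <= e / 2.
  apply: (le_trans (hL _ (frob (y - x)) _)) => [i|]; first exact: entry_le_frob.
  move: yL; rewrite ltr_pdivlMr ?ltr_wpDl// => /ltW; apply: le_trans.
  by rewrite mulrC ler_wpM2l ?frob_ge0// lerDl.
lra.
Qed.

End rigid.

(** A rank one matrix has entries [c i * r j]; a zero diagonal together with antisymmetry makes all
    of them vanish. *)
Lemma antisymmetric_rank (W : 'M[R]_d) : (forall z : 'rV[R]_d, ddot (z *m W) z = 0) ->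
  W != 0 -> (1 < \rank W)%N.
Proof.
move=> W0 Wn0; have WE i j : W i j = - W j i.
  have e (k l : 'I_d) : ddot ((delta_mx 0 k : 'rV[R]_d) *m W) (delta_mx 0 l) = W k l.
    by rewrite -rowE ddotC ddot_delta mxE.
  have := W0 (delta_mx 0 i + delta_mx 0 j); rewrite mulmxDl ddotDl !ddotDr !W0 !e; lra.
rewrite ltnNge; apply/negP => r1.
have {}r1 : \rank W = 1%N.
  by apply/eqP; rewrite eqn_leq r1 lt0n mxrank_eq0.
have := mulmx_base W; move: (col_base W) (row_base W); rewrite r1 => c r cr.
have E i j : W i j = c i 0 * r 0 j by rewrite -cr mxE big_ord1.
move/negP: Wn0; apply; apply/eqP/matrixP => i j; rewrite mxE E.
have := WE i i; rewrite E => cri.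
have : c i 0 * r 0 i = 0 by lra.
move=> /eqP; rewrite mulf_eq0 => /orP[/eqP->|/eqP ri]; first by rewrite mul0r.
by rewrite -E WE E ri mulr0 oppr0.
Qed.

Lemma korn_uniqueness u : P1_zero_trace Om SigD Th u ->
  (forall K, K \in Th -> symm (jac_slope K u) = 0) ->
  forall x, closure Om x -> u x = 0.
Proof.
move=> /P1_zero_traceP[hu _ u0] symm0.
have [W [b [W0 uE]]] := rigid_domain hu symm0.
pose Z := SigD `&` [set x | u x = 0].
(* The part of [SigD] where [u] is nonzero is null, so its zero set there keeps positive measure. *)
have Z_gt0 : (0 < hausdorff d.-1 Z)%E.
  apply: (lt_le_trans SigD_gt0).
  apply: (@le_trans _ _ (hausdorff d.-1 (Z `|` (SigD `&` [set x | u x <> 0])))).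
    apply: le_outer_measure => x Sx; have [ux|ux] := pselect (u x = 0); [by left|by right].
  apply: (le_trans (outer_measureU2 _ _ _)).
  by rewrite -[leRHS]adde0; apply: leeD => //; apply: eq_le_ereal; exact: u0.
have [x0 [Sx0 ux0]] : Z !=set0.
  apply: contrapT => h; move: Z_gt0; rewrite (_ : Z = set0) ?outer_measure0 ?ltxx//.
  by apply/seteqP; split => x // Zx; apply: h; exists x.
have E0 : x0 *m W + b = 0 by rewrite -uE//; exact: SigD_closure.
have [W00|Wn0] := eqVneq W 0.
  have b0 : b = 0 by rewrite -E0 W00 mulmx0 add0r.
  by move=> x cx; rewrite uE// W00 b0 mulmx0 addr0.
exfalso; pose D := row_base (kermx W).
have [B B0 hB] := closure_frob_bounded.
have [L L0 hL] := frob_mulmx_lip (pinvmx D).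
(* Rank at least 2 leaves a kernel of dimension at most [d - 2]. *)
have m_lt : (\rank (kermx W) < d.-1)%N.
  have := antisymmetric_rank W0 Wn0; rewrite mxrank_ker; have := rank_leq_row W.
  by move: (\rank W) => k; case: d => [|[|n]]; case: k => [|[|k]]//= _ _; rewrite !subSS ltnS leq_subr.
have rho0 : 0 <= L * (2 * B) by rewrite mulr_ge0// mulr_ge0.
have := hausdorff_piece0 x0 D rho0 m_lt; apply/eqP; rewrite gt_eqF//.
apply: (lt_le_trans Z_gt0); apply: le_outer_measure => x [Sx ux].
(* Zeros of [u] differ from [x0] by kernel vectors of bounded length; the pseudo-inverse of the
   kernel basis gives parameters in a bounded cube. *)
exists ((x - x0) *m pinvmx D) => [i|].
  apply: (le_trans (entry_le_frob _ _ _)); apply: (le_trans (hL _)); apply: ler_wpM2l => //.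
  apply: (le_trans (frobD _ _)); rewrite frobN.
  have := hB _ (SigD_closure Sx); have := hB _ (SigD_closure Sx0); lra.
rewrite mulmxKpV; first by rewrite addrC subrK.
rewrite eq_row_base; apply/sub_kermxP; rewrite mulmxBl.
have : x *m W + b = 0 by rewrite -uE//; exact: SigD_closure.
by rewrite -E0 => /addIr ->; rewrite subrr.
Qed.

End function_spaces.

(** * Volume forms, strain energy and essential bounds *)

Section forms.
Implicit Types (f g : 'rV[R]_d -> R) (u w phi : 'rV[R]_d -> 'rV[R]_d).

Definition mbdd m n (A : 'rV[R]_d -> 'M[R]_(m, n)) : Prop :=
  forall i j, essbdd leb Om (fun x => A x i j).

Lemma essbdd_intable f : essbdd leb Om f ->
  (leb : {measure set lebT -> \bar R}).-integrable Om (EFin \o f).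
Proof. by move=> bf; exact: (essbdd_integrable mOm Om_lty bf). Qed.

Lemma Rintegral_lin k f g : essbdd leb Om f -> essbdd leb Om g ->
  \int[leb]_(x in Om) (k * f x + g x) =
  k * \int[leb]_(x in Om) f x + \int[leb]_(x in Om) g x.
Proof.
move=> bf bg; rewrite -(RintegralZl k mOm (essbdd_intable bf)).
exact: (RintegralD mOm (essbdd_intable (essbddZ k bf)) (essbdd_intable bg)).
Qed.

Lemma essbdd_ddot m n (A B : 'rV[R]_d -> 'M[R]_(m, n)) : mbdd A -> mbdd B ->
  essbdd leb Om (fun x => ddot (A x) (B x)).
Proof.
move=> hA hB; apply: essbdd_sum => i; apply: essbdd_sum => j.
exact: essbddM.
Qed.

Lemma mbdd_tapp (C : 'rV[R]_d -> tensor4 R d) (A : 'rV[R]_d -> 'M[R]_d) :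
  (forall i j k h, essbdd leb Om (fun x => C x i j k h)) -> mbdd A ->
  mbdd (fun x => tapp (C x) (A x)).
Proof.
move=> hC hA i j; under eq_fun do rewrite mxE.
by do 2 (apply: essbdd_sum => ?); exact: essbddM.
Qed.

Lemma mbdd_grad f : P1 Om Th f -> mbdd (grad f).
Proof.
by move=> fP i j; under eq_fun do rewrite mxE; exact: essbdd_partial.
Qed.

Lemma mbdd_symgrad u : P1_vec u -> mbdd (symgrad u).
Proof.
move=> hu i j; under eq_fun do rewrite !mxE.
by apply: essbddZ; apply: essbddD; exact: essbdd_partial.
Qed.

Lemma jac_slope_lin K k u w :
  jac_slope K (fun x => k *: u x + w x) = k *: jac_slope K u + jac_slope K w.
Proof.
apply/matrixP => i j; rewrite !mxE; under eq_fun do rewrite !mxE.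
by rewrite slope_lin !mxE.
Qed.

Lemma ae_jac : {ae leb, forall x, Om x -> exists2 K, K \in Th &
  forall u, P1_vec u -> jac u x = jac_slope K u}.
Proof.
apply: (ae_lebesgue_imp _ (ae_good)) => x h Omx.
have [K KTh Kx] := h Omx; exists K => // u hu; exact: P1_jac.
Qed.

Lemma symm_lin k (A B : 'M[R]_d) : symm (k *: A + B) = k *: symm A + symm B.
Proof. by apply/matrixP => i j; rewrite !mxE; ring. Qed.

Lemma ae_symgrad_lin k u w : P1_vec u -> P1_vec w ->
  {ae leb, forall x, Om x ->
    symgrad (fun x => k *: u x + w x) x = k *: symgrad u x + symgrad w x}.
Proof.
move=> hu hw; apply: (ae_lebesgue_imp _ ae_jac) => x h Omx.
have [K KTh KE] := h Omx; rewrite /symgrad !KE//; last exact: P1_vec_lin.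
by rewrite jac_slope_lin symm_lin.
Qed.

Lemma jac_congr u w x : Om x -> (forall y, Om y -> u y = w y) -> jac u x = jac w x.
Proof.
move=> Omx uw; apply/matrixP => i j; rewrite !mxE.
by apply: partial_congr => // y Omy; rewrite uw.
Qed.

Lemma symgradE u x : symgrad u x = symm (jac u x).
Proof. by []. Qed.

Lemma symgrad_congr u w x : Om x -> (forall y, Om y -> u y = w y) ->
  symgrad u x = symgrad w x.
Proof. by move=> Omx uw; rewrite /symgrad (jac_congr Omx uw). Qed.

Lemma tapp_lin (C : tensor4 R d) k (A B : 'M[R]_d) :
  tapp C (k *: A + B) = k *: tapp C A + tapp C B.
Proof.
apply/matrixP => i j; rewrite !mxE mulr_sumr -big_split/=; apply: eq_bigr => a _.
rewrite mulr_sumr -big_split/=; apply: eq_bigr => b _.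
by rewrite !mxE; ring.
Qed.

Lemma tapp_scale (C : tensor4 R d) k (A : 'M[R]_d) :
  tapp (fun i j a b => k * C i j a b) A = k *: tapp C A.
Proof.
apply/matrixP => i j; rewrite !mxE mulr_sumr; apply: eq_bigr => a _.
by rewrite mulr_sumr; apply: eq_bigr => b _; rewrite mulrA.
Qed.

Lemma ddot_tapp_le (C : tensor4 R d) (A B : 'M[R]_d) :
  `|ddot (tapp C A) B| <= tnorm C * frob A * frob B.
Proof.
apply: (le_trans (ddot_le_frob _ _)); rewrite ler_wpM2r ?frob_ge0//.
have s0 : 0 <= \sum_i \sum_j \sum_k \sum_h C i j k h ^+ 2.
  by do 4 apply: sumr_ge0 => ? _; exact: sqr_ge0.
rewrite -(@ler_pXn2r _ 2) ?nnegrE ?mulr_ge0 ?frob_ge0 ?sqrtr_ge0//.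
rewrite exprMn !frob_sqr /tnorm sqr_sqrtr// {1}/ddot mulr_suml.
apply: ler_sum => i _; rewrite mulr_suml; apply: ler_sum => j _; rewrite mxE -expr2.
pose M : 'M[R]_d := \matrix_(k, h) C i j k h.
have E1 : \sum_k \sum_h C i j k h * A k h = ddot M A.
  by apply: eq_bigr => k _; apply: eq_bigr => h _; rewrite mxE.
have E2 : \sum_k \sum_h C i j k h ^+ 2 = ddot M M.
  by apply: eq_bigr => k _; apply: eq_bigr => h _; rewrite mxE.
rewrite E1 E2 -[leLHS]real_normK ?num_real// -!frob_sqr -exprMn.
by rewrite ler_pXn2r ?nnegrE ?mulr_ge0 ?frob_ge0// ddot_le_frob.
Qed.

Lemma ddot_tapp_sym (C : tensor4 R d) (A B : 'M[R]_d) :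
  (forall i j k h, C i j k h = C k h i j) -> ddot (tapp C A) B = ddot (tapp C B) A.
Proof.
move=> sC; have E (A' B' : 'M[R]_d) : ddot (tapp C A') B' =
    \sum_(p : 'I_d * 'I_d) \sum_(q : 'I_d * 'I_d) C p.1 p.2 q.1 q.2 * A' q.1 q.2 * B' p.1 p.2.
  rewrite /ddot pair_big/=; apply: eq_bigr => -[i j] _ /=.
  rewrite mxE pair_big/= mulr_suml; apply: eq_bigr => -[k h] _ /=.
  by [].
rewrite !E exchange_big/=; apply: eq_bigr => p _; apply: eq_bigr => q _.
by rewrite sC; ring.
Qed.

Lemma frob_symm_le (A : 'M[R]_d) : frob (symm A) <= frob A.
Proof.
have trA : frob A^T = frob A.
  rewrite /frob /ddot exchange_big/=; congr Num.sqrt; apply: eq_bigr => i _.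
  by apply: eq_bigr => j _; rewrite mxE.
rewrite /symm frobZ ger0_norm ?invr_ge0//.
have := frobD A A^T; rewrite trA => h.
rewrite mulrC ler_pdivrMr//; lra.
Qed.

#[local] Opaque ddot tapp symgrad.

Section tform.
Variable C : 'rV[R]_d -> tensor4 R d.
Hypothesis bC : forall i j k h, essbdd leb Om (fun x => C x i j k h).

(** A weighted elastic form. Since [C1] is [delta * C0], the stiffness form and the misfit
    derivative are instances of it with [C0], up to a factor; the strain energy is the instance with
    the identity tensor. *)
Definition tform f u phi : R :=
  \int[leb]_(x in Om) (f x * ddot (tapp (C x) (symgrad u x)) (symgrad phi x)).

Lemma tform_essbdd f u phi : essbdd leb Om f -> P1_vec u -> P1_vec phi ->
  essbdd leb Om (fun x => f x * ddot (tapp (C x) (symgrad u x)) (symgrad phi x)).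
Proof.
move=> bf hu hphi.
exact: (essbddM bf (essbdd_ddot (mbdd_tapp bC (mbdd_symgrad hu)) (mbdd_symgrad hphi))).
Qed.

Lemma tform_congr f g u w phi psi : (forall x, Om x -> f x = g x) ->
  (forall x, Om x -> u x = w x) -> (forall x, Om x -> phi x = psi x) ->
  tform f u phi = tform g w psi.
Proof.
move=> fg uw pp; apply: eq_Rintegral => x; rewrite inE => Omx.
by rewrite (fg x Omx) (symgrad_congr Omx uw) (symgrad_congr Omx pp).
Qed.

Lemma tform_lin k f g u phi : essbdd leb Om f -> essbdd leb Om g ->
  P1_vec u -> P1_vec phi ->
  tform (fun x => k * f x + g x) u phi = k * tform f u phi + tform g u phi.
Proof.
move=> bf bg hu hphi.
rewrite /tform -(Rintegral_lin k (tform_essbdd bf hu hphi) (tform_essbdd bg hu hphi)).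
by apply: eq_Rintegral => x _; ring.
Qed.

Lemma tform_linl k f u w phi : essbdd leb Om f ->
  P1_vec u -> P1_vec w -> P1_vec phi ->
  tform f (fun x => k *: u x + w x) phi = k * tform f u phi + tform f w phi.
Proof.
move=> bf hu hw hphi.
have b1 := tform_essbdd bf hu hphi; have b2 := tform_essbdd bf hw hphi.
rewrite /tform -(Rintegral_lin k b1 b2).
have [m1 _] := tform_essbdd bf (P1_vec_lin k hu hw) hphi.
have [m2 _] := essbddD (essbddZ k b1) b2.
apply: (ae_eq_Rintegral mOm m1 m2).
apply: (ae_lebesgue_imp _ (ae_symgrad_lin k hu hw)) => x h Omx.
by rewrite (h Omx) tapp_lin ddotDl ddotZl mulrDr mulrCA.
Qed.

Lemma tform_sym f u phi : (forall x, Om x -> forall i j k h, C x i j k h = C x k h i j) ->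
  tform f u phi = tform f phi u.
Proof.
move=> sC; apply: eq_Rintegral => x; rewrite inE => Omx.
by rewrite ddot_tapp_sym// => *; exact: sC.
Qed.

End tform.

Definition strain_energy u : R := \int[leb]_(x in Om) (frob (symgrad u x) ^+ 2).

Lemma strain_energy_ge0 u : 0 <= strain_energy u.
Proof. by apply: Rintegral_ge0 => x _; rewrite sqr_ge0. Qed.

Lemma essbdd_strain u : P1_vec u -> essbdd leb Om (fun x => frob (symgrad u x) ^+ 2).
Proof.
move=> hu; under eq_fun do rewrite frob_sqr.
by apply: essbdd_ddot; exact: mbdd_symgrad.
Qed.

Lemma inner_simplex_Om K : K \in Th -> Om `&` inner_simplex K !=set0.
Proof.
move=> KTh; have indK := mesh_independent KTh.
have [x Kx] := inner_simplex_neq0 indK.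
have cx : closure Om x by apply/mesh_cover; exists K => //; exact: inner_simplex_sub.
by have [|y [Omy Ky]] := cx (inner_simplex K); [apply: open_nbhs_nbhs; split => //; exact: open_inner_simplex|exists y].
Qed.

(** The integrand vanishes almost everywhere, hence at some point of each open simplex, where the
    strain is constant. *)
Lemma strain_energy_eq0 u : P1_vec u -> strain_energy u = 0 ->
  forall K, K \in Th -> symm (jac_slope K u) = 0.
Proof.
move=> hu u0 K KTh.
have ae0 := Rintegral_eq0_ae mOm (essbdd_intable (essbdd_strain hu)) (fun x _ => sqr_ge0 _) u0.
have mK : measurable (Om `&` inner_simplex K : set lebT).
  apply: measurableI => //; apply: borel_measurable_lebesgue; exact: (measurable_inner_simplex (g := id) (@borel_ddot R d)).
have K0 : (0 < leb (Om `&` inner_simplex K))%E.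
  apply: (lebesgue_open_gt0 mK); last exact: inner_simplex_Om.
  by apply: openI; [exact: openOm|exact: open_inner_simplex].
have [x [Omx Kx] h] := ae_exists mK K0 ae0.
have /eqP := h Omx; rewrite sqrf_eq0 => /eqP/frob_eq0.
by rewrite symgradE (P1_jac hu KTh Kx).
Qed.

Lemma P1_near f x e : P1 Om Th f -> closure Om x -> 0 < e ->
  exists2 r, 0 < r & forall y, closure Om y -> frob (y - x) < r -> `|f y - f x| <= e.
Proof.
move=> fP cx e0.
have fv : P1_vec (fun x => const_mx (f x)) by move=> i; under eq_fun do rewrite mxE.
have [r r0 h] := P1_vec_near fv cx e0; exists r => // y cy yx.
apply: le_trans (h y cy yx).
have := entry_le_frob (const_mx (f y) - const_mx (f x) : 'rV[R]_d) 0 (Ordinal d_gt0).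
by rewrite !mxE.
Qed.

(** Continuity would keep a nonzero value away from 0 on a nonempty open part of [Om], which has
    positive measure. *)
Lemma P1_ae0 f : P1 Om Th f -> {ae leb, forall x, Om x -> f x = 0} ->
  forall x, closure Om x -> f x = 0.
Proof.
move=> fP f0 x cx; apply/eqP; apply: contraT => fx0.
have fx : 0 < `|f x| / 2 by rewrite divr_gt0// normr_gt0.
have [r r0 h] := P1_near fP cx fx.
have : exists2 r', 0 < r' & forall y, ball x r' y -> frob (y - x) < r.
  have /nbhs_ballP[r' /= r'0 hr'] : nbhs x [set y | frob (y - x) < r].
    by apply/nbhs_frobP; exists r.
  by exists r'.
move=> [r' r'0 hr'].
have oB' : open (Om `&` ball x r').
  by apply: openI; [exact: openOm|exact: ball_open].
have mB' : measurable (Om `&` ball x r' : set lebT).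
  by apply: borel_measurable_lebesgue; exact: open_borel.
have B0 : Om `&` ball x r' !=set0.
  by have [y [Omy By]] := cx _ (nbhsx_ballx x _ r'0); exists y.
have [y [Omy By] fy] := ae_exists mB' (lebesgue_open_gt0 mB' oB' B0) f0.
have := h y (subset_closure Omy) (hr' _ By); rewrite fy// sub0r normrN.
rewrite ler_pdivlMr//; have : 0 < `|f x| by rewrite normr_gt0.
lra.
Qed.

Section essential_bounds.

Lemma lebesgue_setT_gt0 : (0 < leb setT)%E.
Proof. by apply: lebesgue_open_gt0 => //; [exact: openT|exists 0]. Qed.

(** [Linf] is an essential supremum over the whole space of the extension by 0; it is nonnegative
    because the whole space is not null. *)
Lemma Linf_ge0 f : (0 <= Linf Om f)%E.
Proof.
apply: (ess_sup_gee lebesgue_setT_gt0); apply: aeW => x; rewrite /patch; case: ifP => // _.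
Qed.

Lemma Linf_le f M : 0 <= M -> {ae leb, forall x, Om x -> `|f x| <= M} -> (Linf Om f <= M%:E)%E.
Proof.
move=> M0 fM; apply/ess_supP; apply: (ae_lebesgue_imp _ fM) => x h.
rewrite /patch; case: ifPn => [|_]; last by rewrite lee_fin.
by rewrite inE => /h; rewrite lee_fin.
Qed.

Lemma Linf_fin f : essbdd leb Om f -> Linf Om f \is a fin_num.
Proof.
move=> [_ [M fM]]; rewrite ge0_fin_numE ?Linf_ge0//.
apply: (@le_lt_trans _ _ `|M|%:E); last exact: ltey.
apply: Linf_le => //; apply: (ae_lebesgue_imp _ fM) => x h Omx.
by apply: (le_trans (h Omx)); exact: ler_norm.
Qed.

Lemma ae_le_Linf f : Linf Om f \is a fin_num -> {ae leb, forall x, Om x -> `|f x| <= fine (Linf Om f)}.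
Proof.
move=> fin; have := ess_sup_ge (lebesgue_rV R d) ((fun x => `|f x|%:E) \_ Om).
apply: ae_lebesgue_imp => x h Omx; rewrite -lee_fin fineK//.
by move: h; rewrite /patch mem_set.
Qed.

Lemma mbdd_jac u : P1_vec u -> mbdd (jac u).
Proof.
by move=> hu i j; under eq_fun do rewrite mxE; exact: essbdd_partial.
Qed.

Lemma mbdd_P1 u : P1_vec u -> mbdd u.
Proof.
by move=> hu i j; rewrite (ord1 i); exact: essbdd_P1.
Qed.

Lemma essbdd_frob m n (A : 'rV[R]_d -> 'M[R]_(m, n)) : mbdd A -> essbdd leb Om (fun x => frob (A x)).
Proof.
move=> bA; split.
  by apply: measurable_frob => i j; case: (bA i j).
have [_ [M hM]] := essbdd_ddot bA bA; exists (1 + `|M|).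
apply: (ae_lebesgue_imp _ hM) => x h Omx; rewrite ger0_norm ?frob_ge0//.
have := h Omx; rewrite -frob_sqr ger0_norm ?sqr_ge0// => h1.
have := frob_ge0 (A x); have := ler_norm M; have := sqr_ge0 (frob (A x) - 1).
rewrite sqrrB1; lra.
Qed.

Lemma W1inf_vec_bounds u : P1_vec u ->
  0 <= fine (W1inf_vec Om u) /\
  {ae leb, forall x, Om x -> frob (symgrad u x) <= fine (W1inf_vec Om u)}.
Proof.
move=> hu.
have f1 := Linf_fin (essbdd_frob (mbdd_P1 hu)); have f2 := Linf_fin (essbdd_frob (mbdd_jac hu)).
rewrite /W1inf_vec fineD//.
have g1 := fine_ge0 (Linf_ge0 (fun x => frob (u x))).
have g2 := fine_ge0 (Linf_ge0 (fun x => frob (jac u x))).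
split; first exact: addr_ge0.
apply: (ae_lebesgue_imp _ (ae_le_Linf f2)) => x h Omx.
rewrite symgradE; apply: (le_trans (frob_symm_le _)); have := h Omx.
rewrite ger0_norm ?frob_ge0//; lra.
Qed.

End essential_bounds.

End forms.

(** * Bases of the discrete spaces and norms of their combinations *)

Let vertex (p : 'I_(size Th) * 'I_d.+1) : 'rV[R]_d := row p.2 (nth 0 Th p.1).

Let vertexE K i : K \in Th -> exists k, row i K = vertex (k, i).
Proof.
by move=> KTh; have lt : (index K Th < size Th)%N := (etrans (index_mem K Th) KTh);
  exists (Ordinal lt); rewrite /vertex/= nth_index.
Qed.

Let vertex_closure p : closure Om (vertex p).
Proof.
have pTh := mem_nth (0 : 'M[R]_(d.+1, d)) (ltn_ord p.1).
apply/mesh_cover; exists (nth 0 Th p.1) => //.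
by apply: vertex_simplex; exact: mesh_independent.
Qed.

Lemma scalar_basis : exists s (e : 'I_s -> 'rV[R]_d -> R),
  [/\ forall i, P1 Om Th (e i) /\ H1 Om (e i),
      forall f, P1 Om Th f /\ H1 Om f -> exists c, forall x, closure Om x -> f x = lincomb e c x &
      forall c, (forall x, closure Om x -> lincomb e c x = 0) -> c = 0].
Proof.
apply: (function_basis (V := fun f => P1 Om Th f /\ H1 Om f) (pt := vertex)) => //.
- by split; [exact: P1_cst|exact: H1_0].
- by move=> k f g [f1 f2] [g1 g2]; split; [exact: P1_lin|exact: H1_lin].
- move=> f [fP _] f0; apply: (P1_eq0 fP) => K i KTh.
  by have [k ->] := vertexE i KTh.
Qed.

Lemma vector_basis : exists r (E : 'I_r -> 'rV[R]_d -> 'rV[R]_d),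
  [/\ forall i, P1_zero_trace Om SigD Th (E i),
      forall u, P1_zero_trace Om SigD Th u -> exists b, forall x, closure Om x -> u x = vcomb E b x &
      forall b, (forall x, closure Om x -> vcomb E b x = 0) -> b = 0].
Proof.
(* A vector field is read as a scalar function of a point and a component, so that [function_basis]
   applies. *)
pose vec (f : 'rV[R]_d * 'I_d -> R) x : 'rV[R]_d := \row_j f (x, j).
have [||||r [e [Ve sp fr]]] := function_basis (V := fun f => P1_zero_trace Om SigD Th (vec f))
    (A := [set p | closure Om p.1]) (pt := fun p => (vertex p.1, p.2)).
- rewrite (_ : vec _ = fun=> 0); first exact: P1_zero_trace_0.
  by apply/funext => x; apply/rowP => j; rewrite !mxE.
- move=> k f g f1 g1; rewrite (_ : vec _ = fun x => k *: vec f x + vec g x).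
    exact: (P1_zero_trace_lin k f1 g1).
  by apply/funext => x; apply/rowP => j; rewrite !mxE.
- by move=> p; exact: vertex_closure.
- move=> f [fP _] f0 [x j] /= cx; have := P1_eq0 (fP j) _ cx; rewrite mxE; apply.
  by move=> K i KTh; have [k ->] := vertexE i KTh; rewrite mxE; exact: (f0 (k, i, j)).
have vecE b : vcomb (fun i => vec (e i)) b = vec (lincomb e b).
  by apply/funext => x; apply/rowP => j; rewrite summxE mxE; apply: eq_bigr => i _; rewrite !mxE.
exists r, (fun i => vec (e i)); split => // [u uV|b b0].
  have [|c uc] := sp (fun p => u p.1 0 p.2).
    by rewrite (_ : vec _ = u)//; apply/funext => x; apply/rowP => j; rewrite !mxE.
  by exists c => x cx; rewrite vecE; apply/rowP => j; rewrite mxE -uc.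
by apply: fr => -[x j] /= /b0; rewrite vecE => /rowP/(_ j); rewrite !mxE.
Qed.

(** Vertex values and slopes on the simplices depend linearly on [b] and control the norm; their
    finitely many bounds are added up. *)
Lemma P1_vec_comb_bound r (E : 'I_r -> 'rV[R]_d -> 'rV[R]_d) : (forall b, P1_vec (vcomb E b)) ->
  exists2 L, 0 <= L & forall b, (W1inf_vec Om (vcomb E b) <= (L * frob b)%:E)%E.
Proof.
move=> hE.
have /choice[LJ LJP] : forall K : 'M[R]_(d.+1, d), exists L, 0 <= L /\ forall b, frob (jac_slope K (vcomb E b)) <= L * frob b.
  move=> K; have [|L L0 h] := @linear_frob_bound _ r _ _ (fun b => jac_slope K (vcomb E b)).
    by move=> k a b; rewrite vcomb_lin jac_slope_lin.
  by exists L.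
have /choice[LV LVP] : forall x : 'rV[R]_d, exists L, 0 <= L /\ forall b, frob (vcomb E b x) <= L * frob b.
  move=> x; have [|L L0 h] := @linear_frob_bound _ r _ _ (fun b => vcomb E b x).
    by move=> k a b; rewrite vcomb_lin.
  by exists L.
pose L1 := 1%:R * d%:R * (\sum_(K <- Th) \sum_i LV (row i K)).
pose L2 := \sum_(K <- Th) LJ K.
have L10 : 0 <= L1.
  rewrite mulr_ge0//; apply: sumr_ge0 => K _; apply: sumr_ge0 => i _.
  by have [] := LVP (row i K).
have L20 : 0 <= L2 by apply: sumr_ge0 => K _; have [] := LJP K.
exists (L1 + L2) => [|b]; first exact: addr_ge0.
rewrite mulrDl EFinD; apply: leeD.
  apply: (Linf_le (mulr_ge0 L10 (frob_ge0 b))); apply: aeW => x Omx.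
  rewrite ger0_norm ?frob_ge0// /L1 -(mulrA (1%:R * d%:R)).
  apply: frob_le_entries => i j; rewrite (ord1 i).
  apply: (le_trans (P1_bounded (hE b j) (subset_closure Omx))).
  rewrite /vertex_sum mulr_suml; apply: ler_sum => K _; rewrite mulr_suml; apply: ler_sum => k _.
  by apply: (le_trans (entry_le_frob _ _ _)); have [_] := LVP (row k K).
apply: (Linf_le (mulr_ge0 L20 (frob_ge0 b))); apply: (ae_lebesgue_imp _ (ae_jac)) => x h Omx.
have [K KTh KE] := h Omx; rewrite ger0_norm ?frob_ge0// KE//.
have [_ hK] := LJP K; apply: (le_trans (hK b)); apply: ler_wpM2r; first exact: frob_ge0.
by rewrite /L2 (big_rem K)//= lerDl; apply: sumr_ge0 => K' _; have [] := LJP K'.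
Qed.

Lemma P1_comb_bound s (e : 'I_s -> 'rV[R]_d -> R) : (forall a, P1 Om Th (lincomb e a)) ->
  exists2 L, 0 <= L & forall a, (W1inf Om (lincomb e a) <= (L * frob a)%:E)%E.
Proof.
move=> he.
have /choice[LJ LJP] : forall K : 'M[R]_(d.+1, d), exists L, 0 <= L /\ forall a, frob (slope K (lincomb e a)) <= L * frob a.
  move=> K; have [|L L0 h] := @linear_frob_bound _ s _ _ (fun a => slope K (lincomb e a)).
    by move=> k a b; rewrite lincomb_lin slope_lin.
  by exists L.
have /choice[LV LVP] : forall x : 'rV[R]_d, exists L, 0 <= L /\ forall a, `|lincomb e a x| <= L * frob a.
  move=> x; exists (frob (\row_i lincomb e (delta_mx 0 i) x)); split; first exact: frob_ge0.
  move=> a; rewrite (linear_ddot (f := fun a => lincomb e a x)) => [|k b b']; last by rewrite lincomb_lin.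
  by rewrite mulrC; exact: ddot_le_frob.
pose L1 := \sum_(K <- Th) \sum_i LV (row i K).
pose L2 := \sum_(K <- Th) LJ K.
have L10 : 0 <= L1.
  apply: sumr_ge0 => K _; apply: sumr_ge0 => i _.
  by have [] := LVP (row i K).
have L20 : 0 <= L2 by apply: sumr_ge0 => K _; have [] := LJP K.
exists (L1 + L2) => [|a]; first exact: addr_ge0.
rewrite mulrDl EFinD; apply: leeD.
  apply: (Linf_le (mulr_ge0 L10 (frob_ge0 a))); apply: aeW => x Omx.
  apply: (le_trans (P1_bounded (he a) (subset_closure Omx))).
  rewrite /vertex_sum mulr_suml; apply: ler_sum => K _; rewrite mulr_suml; apply: ler_sum => k _.
  by have [_] := LVP (row k K).
apply: (Linf_le (mulr_ge0 L20 (frob_ge0 a))); apply: (ae_lebesgue_imp _ (ae_good)) => x h Omx.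
have [K KTh Kx] := h Omx; rewrite ger0_norm ?frob_ge0// (P1_grad (he a) KTh Kx).
have [_ hK] := LJP K; apply: (le_trans (hK a)); apply: ler_wpM2r; first exact: frob_ge0.
by rewrite /L2 (big_rem K)//= lerDl; apply: sumr_ge0 => K' _; have [] := LJP K'.
Qed.

(** * Integrals over the Neumann boundary *)

Section boundary_form.
Implicit Types (u w : 'rV[R]_d -> 'rV[R]_d).

(** The boundary is covered by finitely many faces of finite measure. *)
Lemma SigN_lty : (haus SigN < +oo)%E.
Proof.
apply: le_lt_trans hausdorff_boundary_lty.
exact: le_outer_measure.
Qed.

Definition L2_vec u : Prop := forall i, L2 haus SigN (fun x => u x 0 i).

Definition boundary_form u w : R := \int[haus]_(x in SigN) ddot (u x) (w x).

Lemma L2_vec_lin k u w : L2_vec u -> L2_vec w -> L2_vec (fun x => k *: u x + w x).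
Proof.
by move=> hu hw i; under eq_fun do rewrite !mxE; apply: L2_lin => //; exact: SigN_meas.
Qed.

Lemma L2_vec_P1 u : P1_vec u -> L2_vec u.
Proof.
move=> hu i; have SigNc : SigN `<=` closure Om by move=> x /SigN_boundary[].
apply: (essbdd_L2 SigN_meas SigN_lty); split.
  exact: (measurable_P1 (@hausdorff_ddot R d d.-1) SigN_meas SigNc (hu i)).
exists (vertex_sum (fun x => u x 0 i)); apply: aeW => x Sx.
by apply: (P1_bounded (hu i)); exact: SigNc.
Qed.

Lemma boundary_integrable u w : L2_vec u -> L2_vec w ->
  (haus : {measure set (caratheodory_type (@hausdorff R d d.-1)) -> \bar R}).-integrable SigN
    (EFin \o (fun x => ddot (u x) (w x))).
Proof.
move=> hu hw.
have := integrable_sum SigN_meas (index_enum 'I_d) (P := xpredT)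
  (h := fun i x => (u x 0 i * w x 0 i)%:E)
  (fun i _ => L2_integrableM SigN_meas (hu i) (hw i)).
apply: (eq_integrable SigN_meas) => x _.
by rewrite /= sumEFin ddot_rowE.
Qed.

Lemma boundary_form_linl k u u' w : L2_vec u -> L2_vec u' -> L2_vec w ->
  boundary_form (fun x => k *: u x + u' x) w = k * boundary_form u w + boundary_form u' w.
Proof.
move=> hu hu' hw.
have I1 := boundary_integrable hu hw; have I2 := boundary_integrable hu' hw.
rewrite /boundary_form -(RintegralZl k SigN_meas I1).
have I3 := integrableZl SigN_meas k I1.
have I3' : (haus : {measure set (caratheodory_type (@hausdorff R d d.-1)) -> \bar R}).-integrable
  SigN (EFin \o (fun x => k * ddot (u x) (w x))) := I3.
by rewrite -(RintegralD SigN_meas I3' I2); apply: eq_Rintegral => x _; rewrite ddotDl ddotZl.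
Qed.

Lemma boundary_form_sym u w : boundary_form u w = boundary_form w u.
Proof. by apply: eq_Rintegral => x _; rewrite ddotC. Qed.

Lemma boundary_form_congr u u' w w' : (forall x, closure Om x -> u x = u' x) ->
  (forall x, closure Om x -> w x = w' x) -> boundary_form u w = boundary_form u' w'.
Proof.
move=> uu ww; apply: eq_Rintegral => x; rewrite inE => /SigN_boundary[cx _].
by rewrite uu// ww.
Qed.

Lemma boundary_form_ge0 u : 0 <= boundary_form u u.
Proof. by apply: Rintegral_ge0 => x _; exact: ddot_ge0. Qed.

End boundary_form.

Implicit Types (f g v w : 'rV[R]_d -> R) (u phi : 'rV[R]_d -> 'rV[R]_d).

(** * Mass, Dirichlet, strain and stiffness matrices *)

Section basis.
Variables (s : nat) (e : 'I_s -> 'rV[R]_d -> R).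
Hypothesis e_space : forall i, P1 Om Th (e i) /\ H1 Om (e i).
Hypothesis e_span : forall f, P1 Om Th f /\ H1 Om f ->
  exists c, forall x, closure Om x -> f x = lincomb e c x.
Hypothesis e_free : forall c, (forall x, closure Om x -> lincomb e c x = 0) -> c = 0.
Variables (r : nat) (E : 'I_r -> 'rV[R]_d -> 'rV[R]_d).
Hypothesis E_space : forall i, P1_zero_trace Om SigD Th (E i).
Hypothesis E_span : forall u, P1_zero_trace Om SigD Th u ->
  exists b, forall x, closure Om x -> u x = vcomb E b x.
Hypothesis E_free : forall b, (forall x, closure Om x -> vcomb E b x = 0) -> b = 0.

Lemma lincomb_P1 a : P1 Om Th (lincomb e a).
Proof.
apply: lincomb_closed => [|k f g fP gP|i]; last by case: (e_space i).
  exact: P1_cst.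
exact: P1_lin.
Qed.

Lemma lincomb_H1 a : H1 Om (lincomb e a).
Proof.
apply: lincomb_closed => [|k f g fP gP|i]; last by case: (e_space i).
  exact: H1_0.
exact: H1_lin.
Qed.

Lemma vcomb_space b : P1_zero_trace Om SigD Th (vcomb E b).
Proof.
apply: vcomb_closed => [|k f g fP gP|i]; last exact: E_space.
  exact: P1_zero_trace_0.
exact: P1_zero_trace_lin.
Qed.

Lemma vcomb_P1 b : P1_vec (vcomb E b).
Proof. by case: (vcomb_space b). Qed.

Lemma essbdd_lincomb a : essbdd leb Om (lincomb e a).
Proof. exact: (essbdd_P1 (lincomb_P1 a)). Qed.

Definition mass f g : R := \int[leb]_(x in Om) (f x * g x).

Lemma mass_lin k f g h : essbdd leb Om f -> essbdd leb Om g -> essbdd leb Om h ->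
  mass (fun x => k * f x + g x) h = k * mass f h + mass g h.
Proof.
move=> bf bg bh; have := Rintegral_lin k (essbddM bf bh) (essbddM bg bh).
by move=> <-; apply: eq_Rintegral => x _; rewrite mulrDl mulrA.
Qed.

Lemma massC f g : mass f g = mass g f.
Proof. by apply: eq_Rintegral => x _; rewrite mulrC. Qed.

(** Definite because a combination of zero mass vanishes almost everywhere, hence on the closure by
    continuity, so that its coordinates are 0. *)
Lemma mass_matrix : exists M : 'M[R]_s,
  (forall a b, mass (lincomb e a) (lincomb e b) = ddot (a *m M) b) /\
  exists2 k, 0 < k & forall a : 'rV[R]_s, k * frob a ^+ 2 <= ddot (a *m M) a.
Proof.
have [||M ME] := symmetric_form_matrix (f := fun a b => mass (lincomb e a) (lincomb e b)).
- by move=> a b; exact: massC.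
- by move=> k a a' b; rewrite lincomb_lin; apply: mass_lin; exact: essbdd_lincomb.
exists M; split => //.
apply: posdef_coercive => b b0; rewrite -ME lt_neqAle.
have sq_ge0 : 0 <= mass (lincomb e b) (lincomb e b).
  by apply: Rintegral_ge0 => x _; rewrite -expr2 sqr_ge0.
rewrite sq_ge0 andbT; apply: contra_neq b0 => /esym m0; apply: e_free.
have i2 := essbdd_intable (essbddM (essbdd_lincomb b) (essbdd_lincomb b)).
apply: (P1_ae0 (lincomb_P1 b)).
have nn x : Om x -> 0 <= lincomb e b x * lincomb e b x by rewrite -expr2 sqr_ge0.
apply: (ae_lebesgue_imp _ (Rintegral_eq0_ae mOm i2 nn m0)) => x h Omx.
by have := h Omx => /eqP; rewrite mulf_eq0 orbb => /eqP.
Qed.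

Definition dirichlet f g : R := \int[leb]_(x in Om) ddot (grad f x) (grad g x).

Lemma dirichlet_lin k f g h : P1 Om Th f -> P1 Om Th g -> P1 Om Th h ->
  dirichlet (fun x => k * f x + g x) h = k * dirichlet f h + dirichlet g h.
Proof.
move=> fP gP hP.
have b1 := essbdd_ddot (mbdd_grad fP) (mbdd_grad hP).
have b2 := essbdd_ddot (mbdd_grad gP) (mbdd_grad hP).
rewrite /dirichlet -(Rintegral_lin k b1 b2).
have [m1 _] := essbdd_ddot (mbdd_grad (P1_lin k fP gP)) (mbdd_grad hP).
have [m2 _] := essbddD (essbddZ k b1) b2.
apply: (ae_eq_Rintegral mOm m1 m2).
apply: (ae_lebesgue_imp _ (ae_grad_lin k fP gP)) => x hx Omx.
by rewrite (hx Omx) ddotDl ddotZl.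
Qed.

Lemma dirichletC f g : dirichlet f g = dirichlet g f.
Proof. by apply: eq_Rintegral => x _; rewrite ddotC. Qed.

Lemma dirichlet_matrix : exists G : 'M[R]_s,
  forall a b, dirichlet (lincomb e a) (lincomb e b) = ddot (a *m G) b.
Proof.
apply: (symmetric_form_matrix (f := fun a b => dirichlet (lincomb e a) (lincomb e b))).
  by move=> a b; exact: dirichletC.
by move=> k a a' b; rewrite lincomb_lin; apply: dirichlet_lin; exact: lincomb_P1.
Qed.

(** Makes the strain energy a [tform], so that linearity and symmetry need not be proved again. *)
Definition identity_tensor (x : 'rV[R]_d) : tensor4 R d :=
  fun i j k h => ((i == k) && (j == h))%:R.

Lemma tapp_identity x (A : 'M[R]_d) : tapp (identity_tensor x) A = A.
Proof.
apply/matrixP => i j; rewrite mxE (bigD1 i)//= (bigD1 j)//= /identity_tensor !eqxx mul1r.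
rewrite !big1 ?addr0// => [k ki|h hj]; last by rewrite eq_sym (negPf hj) mul0r.
by apply: big1 => h _; rewrite eq_sym (negPf ki) mul0r.
Qed.

Lemma strain_energyE u : strain_energy u = tform identity_tensor (fun=> 1) u u.
Proof. by apply: eq_Rintegral => x _; rewrite mul1r tapp_identity frob_sqr. Qed.

(** A discrete Korn inequality: [korn_uniqueness] makes the form definite, and in finite dimension
    definite means coercive. *)
Lemma strain_energy_coercive : exists2 k, 0 < k & forall b, k * frob b ^+ 2 <= strain_energy (vcomb E b).
Proof.
have bI i j k h : essbdd leb Om (fun x => identity_tensor x i j k h) by exact: essbdd_cst.
have b1 : essbdd leb Om (fun=> 1) by exact: essbdd_cst.
have symI x : Om x -> forall i j k h, identity_tensor x i j k h = identity_tensor x k h i j.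
  by move=> _ i j k h; rewrite /identity_tensor (eq_sym i) (eq_sym j).
have [||M ME] := symmetric_form_matrix (f := fun a b => tform identity_tensor (fun=> 1) (vcomb E a) (vcomb E b)).
- by move=> a b; exact: tform_sym.
- move=> k a a' b; rewrite vcomb_lin.
  exact: (tform_linl bI k b1 (vcomb_P1 a) (vcomb_P1 a') (vcomb_P1 b)).
have [|k k0 kE] := @posdef_coercive _ _ M.
  move=> b b0; rewrite -ME -strain_energyE lt_neqAle strain_energy_ge0 andbT.
  apply: contra_neq b0 => /esym u0; apply: E_free.
  apply: (korn_uniqueness (vcomb_space b)).
  exact: (strain_energy_eq0 (vcomb_P1 b) u0).
by exists k => // b; rewrite strain_energyE ME.
Qed.

Lemma boundary_matrix : exists S : 'M[R]_r, forall a b,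
  boundary_form (vcomb E a) (vcomb E b) = ddot (a *m S) b.
Proof.
have L2v b := L2_vec_P1 (vcomb_P1 b).
apply: (symmetric_form_matrix (f := fun a b => boundary_form (vcomb E a) (vcomb E b))).
  by move=> a b; exact: boundary_form_sym.
by move=> k a a' b; rewrite vcomb_lin; exact: boundary_form_linl.
Qed.

(** Both sides are quadratic forms in the coordinates and the right one is coercive. No elastic
    coefficient enters, so [K] is available before [C0] is given. *)
Lemma trace_inequality : exists2 K, 0 <= K & forall u, P1_zero_trace Om SigD Th u ->
  boundary_form u u <= K * strain_energy u.
Proof.
have [S SE] := boundary_matrix; have [k k0 kE] := strain_energy_coercive.
have [L L0 hL] := ddot_mulmx_le S.
exists (L / k) => [|u uV]; first by rewrite divr_ge0// ltW.
have [b ub] := E_span uV.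
rewrite (boundary_form_congr ub ub) SE.
have -> : strain_energy u = strain_energy (vcomb E b).
  apply: eq_Rintegral => x; rewrite inE => Omx; congr (frob _ ^+ 2).
  by apply: symgrad_congr => // y Omy; apply: ub; exact: subset_closure.
apply: (le_trans (ler_norm _)); apply: (le_trans (hL _ _)).
rewrite -mulrA -expr2 mulrAC ler_pdivlMr// -mulrA; apply: ler_wpM2l => //.
by rewrite mulrC.
Qed.

Variables (d0 delta eps alpha xi0 : R) (C0 : 'rV[R]_d -> tensor4 R d).
Variables (gh um : 'rV[R]_d -> 'rV[R]_d).
Hypotheses (delta0 : 0 < delta) (xi00 : 0 < xi0) (eps0 : 0 < eps) (alpha0 : 0 < alpha).
Hypothesis elas : elasticity_tensor Om xi0 C0.
Hypothesis gh_L2 : L2_vec gh.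
Hypothesis um_L2 : L2_vec um.

Let P := Problem Om SigD SigN Th d0 C0 delta eps alpha gh um.

Lemma C0_essbdd i j k h : essbdd leb Om (fun x => C0 x i j k h).
Proof.
have [_ mC [M hM] _] := elas; split; first exact: mC.
by exists M; apply: aeW => x Omx; exact: hM.
Qed.

Lemma C0_sym x : Om x -> forall i j k h, C0 x i j k h = C0 x k h i j.
Proof. by have [sC _ _ _] := elas; move=> Omx i j k h; have [] := sC x Omx i j k h. Qed.

Lemma tapp_Cdelta v x (A : 'M[R]_d) :
  tapp (Cdelta P v x) A = ((delta - 1) * v x + 1) *: tapp (C0 x) A.
Proof.
rewrite -tapp_scale; congr tapp.
by do 4 (apply/funext => ?); rewrite /Cdelta /C1 /=; ring.
Qed.

Lemma tapp_C0_sub_C1 x (A : 'M[R]_d) :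
  tapp (C0_sub_C1 P x) A = (1 - delta) *: tapp (C0 x) A.
Proof.
rewrite -tapp_scale; congr tapp.
by do 4 (apply/funext => ?); rewrite /C0_sub_C1 /C1 /=; ring.
Qed.

Local Notation T := (tform C0).

Lemma bilinearE v u phi : Defs.bilinear P v u phi = T (fun x => (delta - 1) * v x + 1) u phi.
Proof. by apply: eq_Rintegral => x _; rewrite tapp_Cdelta ddotZl. Qed.

Definition misfit_form w u phi : R :=
  \int[leb]_(x in Om) (w x * ddot (tapp (C0_sub_C1 P x) (symgrad u x)) (symgrad phi x)).

Lemma misfit_formE w u phi : essbdd leb Om w -> P1_vec u -> P1_vec phi ->
  misfit_form w u phi = (1 - delta) * T w u phi.
Proof.
move=> bw hu hphi; have bt := tform_essbdd C0_essbdd bw hu hphi.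
rewrite /tform -(RintegralZl (1 - delta) mOm (essbdd_intable bt)).
by apply: eq_Rintegral => x _; rewrite tapp_C0_sub_C1 ddotZl mulrCA.
Qed.

Lemma Kh_essbdd v : Kh P v -> essbdd leb Om v.
Proof. by move=> [vP _]; exact: (essbdd_P1 vP). Qed.

(** Pointwise, [C_delta(v) - C_delta(v') = (C0 - C1) (v' - v)]: a change of stiffness is a misfit
    derivative, with the order of [v] and [v'] reversed. *)
Lemma bilinear_diff v v' u phi : essbdd leb Om v -> essbdd leb Om v' ->
  P1_vec u -> P1_vec phi ->
  Defs.bilinear P v u phi - Defs.bilinear P v' u phi = misfit_form (fun x => v' x - v x) u phi.
Proof.
move=> bv bv' hu hphi; have b1 : essbdd leb Om (fun=> 1) by exact: essbdd_cst.
rewrite (misfit_formE (essbddB bv' bv) hu hphi).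
rewrite !bilinearE (tform_lin C0_essbdd (delta - 1) bv b1 hu hphi).
rewrite (tform_lin C0_essbdd (delta - 1) bv' b1 hu hphi).
have -> : T (fun x => v' x - v x) u phi = T (fun x => (- 1) * v x + v' x) u phi.
  by apply: tform_congr => // x _; rewrite mulN1r addrC.
rewrite (tform_lin C0_essbdd _ bv bv' hu hphi); ring.
Qed.

(** Coercivity constant of the stiffness: the weight [1 + (delta - 1) v] is at least the smaller of
    1 and [delta] when [v] is between 0 and 1. *)
Definition xi : R := xi0 * Num.min 1 delta.

Lemma xi_gt0 : 0 < xi.
Proof. by rewrite mulr_gt0// lt_min ltr01. Qed.

Lemma bilinear_coercive v u : Kh P v -> P1_vec u ->
  xi * strain_energy u <= Defs.bilinear P v u u.
Proof.
move=> Kv hu; have bv := Kh_essbdd Kv; have [_ [_ v01 _]] := Kv.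
have [_ _ _ coer] := elas; have b1 : essbdd leb Om (fun=> 1) by exact: essbdd_cst.
have bs := essbdd_strain hu.
have bt := tform_essbdd C0_essbdd (essbddD (essbddZ (delta - 1) bv) b1) hu hu.
rewrite bilinearE /tform /strain_energy -(RintegralZl xi mOm (essbdd_intable bs)).
apply: (ae_le_Rintegral mOm).
- exact: (essbdd_intable (essbddZ xi bs)).
- exact: (essbdd_intable bt).
apply: (ae_lebesgue_imp2 _ v01 coer) => x h1 h2 Omx.
have /andP[v0 v1] := h1 Omx; have := h2 Omx (jac u x); rewrite -symgradE.
set q := ddot _ _; set f := frob _ ^+ 2 => qf.
have f0 : 0 <= f by rewrite sqr_ge0.
have q0 : 0 <= q by apply: le_trans qf; rewrite mulr_ge0// ltW.
have m1 : Num.min 1 delta <= 1 by rewrite ge_min lexx.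
have m2 : Num.min 1 delta <= delta by rewrite ge_min lexx orbT.
apply: (@le_trans _ _ (Num.min 1 delta * q)).
  by rewrite /xi mulrAC mulrC ler_wpM2l// le_min ler01 ltW.
apply: ler_wpM2r => //; move: (Num.min 1 delta) m1 m2 => m m1 m2.
(* The weight is a convex combination of 1 and [delta], each of which is at least [m]. *)
have : 0 <= (1 - v x) * (1 - m) + v x * (delta - m).
  by rewrite addr_ge0// mulr_ge0// subr_ge0.
by rewrite -subr_ge0; congr (0 <= _); ring.
Qed.

Lemma bilinear_sym v u phi : Defs.bilinear P v u phi = Defs.bilinear P v phi u.
Proof. by rewrite !bilinearE; apply: tform_sym; exact: C0_sym. Qed.

Lemma bilinear_linl v k u u' phi : essbdd leb Om v -> P1_vec u -> P1_vec u' ->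
  P1_vec phi ->
  Defs.bilinear P v (fun x => k *: u x + u' x) phi = k * Defs.bilinear P v u phi + Defs.bilinear P v u' phi.
Proof.
move=> bv hu hu' hphi; rewrite !bilinearE.
have bw := essbddD (essbddZ (delta - 1) bv) (essbdd_cst leb Om 1).
exact: (tform_linl C0_essbdd k bw hu hu' hphi).
Qed.

Lemma bilinear_congr v v' u u' phi phi' : (forall x, Om x -> v x = v' x) ->
  (forall x, Om x -> u x = u' x) -> (forall x, Om x -> phi x = phi' x) ->
  Defs.bilinear P v u phi = Defs.bilinear P v' u' phi'.
Proof.
move=> vv uu pp; rewrite !bilinearE; apply: tform_congr => // x Omx.
by rewrite vv.
Qed.

(** The two problems have the same set of solutions, so [xget] picks the same one; the equality
    therefore holds on the whole space. *)
Lemma uh_congr v v' : (forall x, Om x -> v x = v' x) -> uh P v = uh P v'.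
Proof.
move=> vv; rewrite /uh; congr xget; apply/funext => u; apply/propext; rewrite /= /forward_problem.
have BE u' phi : Defs.bilinear P v u' phi = Defs.bilinear P v' u' phi by apply: bilinear_congr.
by split=> -[uV h]; split => // phi hphi; rewrite -h// BE.
Qed.

Lemma ph_congr v v' : (forall x, Om x -> v x = v' x) -> ph P v = ph P v'.
Proof.
move=> vv; have uu := uh_congr vv.
have BE u phi : Defs.bilinear P v u phi = Defs.bilinear P v' u phi by apply: bilinear_congr.
have PE : adjoint_problem P v = adjoint_problem P v'.
  apply/funext => p; rewrite /adjoint_problem uu; apply/propext.
  split=> -[pV h]; split => // psi hpsi.
    exact: etrans (esym (BE p psi)) (h psi hpsi).
  exact: etrans (BE p psi) (h psi hpsi).
by rewrite /ph PE.
Qed.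

Definition Kc : set 'rV[R]_s := [set a | Kh P (lincomb e a)].

Lemma Kh_coordinates v : Kh P v -> exists2 a, Kc a & forall x, closure Om x -> v x = lincomb e a x.
Proof.
move=> [vP [vH v01 v0]]; have [a va] := e_span (conj vP vH); exists a => //.
have vOm x : Om x -> v x = lincomb e a x by move=> Omx; apply: va; exact: subset_closure.
split; first exact: lincomb_P1.
split; first exact: lincomb_H1.
  by apply: (ae_lebesgue_imp _ v01) => x h Omx; rewrite -vOm//; exact: h.
by apply: (ae_lebesgue_imp _ v0) => x h Omx hd; rewrite -vOm//; exact: h.
Qed.

(** By [bilinear_diff] the same matrices [Tm] describe the dependence of the stiffness on the phase
    field and, with the opposite sign, the misfit derivative. *)
Lemma stiffness_matrices : exists (A0 : 'M[R]_r) (Tm : 'I_s -> 'M[R]_r),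
  (forall a b b', Defs.bilinear P (lincomb e a) (vcomb E b) (vcomb E b') = ddot (b *m (A0 - trilin Tm a)) b') /\
  forall a b b', misfit_form (lincomb e a) (vcomb E b) (vcomb E b') = ddot a (\row_i ddot (b *m Tm i) b').
Proof.
have mat f : essbdd leb Om f -> exists A : 'M[R]_r,
    forall b b', T f (vcomb E b) (vcomb E b') = ddot (b *m A) b'.
  move=> bf; apply: (symmetric_form_matrix (f := fun a b => T f (vcomb E a) (vcomb E b))).
    by move=> a b; apply: tform_sym; exact: C0_sym.
  move=> k a a' b; rewrite vcomb_lin.
  exact: (tform_linl C0_essbdd k bf (vcomb_P1 a) (vcomb_P1 a') (vcomb_P1 b)).
have [A0 A0E] := mat _ (essbdd_cst leb Om 1).
have /choice[B BE] : forall i, exists A : 'M[R]_r,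
    forall b b', T (e i) (vcomb E b) (vcomb E b') = ddot (b *m A) b'.
  by move=> i; apply: mat; rewrite -lincomb_delta; exact: essbdd_lincomb.
have misE a b b' : misfit_form (lincomb e a) (vcomb E b) (vcomb E b') =
    ddot a (\row_i ddot (b *m ((1 - delta) *: B i)) b').
  rewrite misfit_formE; [|exact: essbdd_lincomb|exact: vcomb_P1|exact: vcomb_P1].
  rewrite (linear_ddot (f := fun a => T (lincomb e a) (vcomb E b) (vcomb E b'))); last first.
    move=> k a1 a2; rewrite lincomb_lin.
    exact: (tform_lin C0_essbdd k (essbdd_lincomb a1) (essbdd_lincomb a2) (vcomb_P1 b) (vcomb_P1 b')).
  rewrite !ddot_rowE mulr_sumr; apply: eq_bigr => i _.
  by rewrite !mxE lincomb_delta BE -scalemxAr ddotZl; ring.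
exists A0, (fun i => (1 - delta) *: B i); split => // a b b'.
have b1 : essbdd leb Om (fun=> 1) by exact: essbdd_cst.
rewrite mulmxBr ddotBl -A0E.
have -> : ddot (b *m trilin (fun i => (1 - delta) *: B i) a) b' =
    misfit_form (lincomb e a) (vcomb E b) (vcomb E b').
  rewrite misE /trilin mulmx_sumr ddot_suml ddot_rowE; apply: eq_bigr => i _.
  by rewrite -scalemxAr ddotZl mxE.
rewrite misfit_formE; [|exact: essbdd_lincomb|exact: vcomb_P1|exact: vcomb_P1].
rewrite bilinearE (tform_lin C0_essbdd _ (essbdd_lincomb a) b1 (vcomb_P1 b) (vcomb_P1 b')).
ring.
Qed.

(** * The discrete forward and adjoint solutions *)

Section coordinates.
Variables (A0 : 'M[R]_r) (Tm : 'I_s -> 'M[R]_r).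
Hypothesis A0E : forall a b b', Defs.bilinear P (lincomb e a) (vcomb E b) (vcomb E b') =
  ddot (b *m (A0 - trilin Tm a)) b'.
Hypothesis TmE : forall a b b', misfit_form (lincomb e a) (vcomb E b) (vcomb E b') =
  ddot a (\row_i ddot (b *m Tm i) b').
Variable kap : R.
Hypothesis kap_gt0 : 0 < kap.
Hypothesis kapE : forall b, kap * frob b ^+ 2 <= strain_energy (vcomb E b).
Variable S : 'M[R]_r.
Hypothesis SE : forall a b, boundary_form (vcomb E a) (vcomb E b) = ddot (a *m S) b.

Definition stiff a : 'M[R]_r := A0 - trilin Tm a.

Lemma stiff_coercive a (b : 'rV[R]_r) : Kc a -> xi * kap * frob b ^+ 2 <= ddot (b *m stiff a) b.
Proof.
move=> Ka; rewrite -A0E; apply: le_trans (bilinear_coercive Ka (vcomb_P1 b)).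
by rewrite -mulrA ler_wpM2l ?kapE// ltW// xi_gt0.
Qed.

Lemma stiff_unit a : Kc a -> stiff a \in unitmx.
Proof.
move=> Ka; rewrite -row_free_unit; apply: row_free_injective => c c0.
have := stiff_coercive c Ka; rewrite c0 ddot0l => h.
apply: frob_eq0; apply/eqP; rewrite -sqrf_eq0 eq_le sqr_ge0 andbT.
by rewrite -(pmulr_rle0 _ (mulr_gt0 xi_gt0 kap_gt0)).
Qed.

Lemma P1_L2 u : P1_vec u -> L2_vec u.
Proof. by move=> hu; exact: (L2_vec_P1 hu). Qed.

Definition load (g : 'rV[R]_d -> 'rV[R]_d) : 'rV[R]_r := \row_i boundary_form g (E i).

Lemma loadE (g : 'rV[R]_d -> 'rV[R]_d) b : L2_vec g -> boundary_form g (vcomb E b) = ddot (load g) b.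
Proof.
move=> hg; rewrite boundary_form_sym (linear_ddot (f := fun b => boundary_form (vcomb E b) g)).
  rewrite ddotC; congr ddot; apply/rowP => i.
  by rewrite !mxE vcomb_delta boundary_form_sym.
move=> k b1 b2; rewrite vcomb_lin.
exact: (boundary_form_linl k (P1_L2 (vcomb_P1 b1)) (P1_L2 (vcomb_P1 b2)) hg).
Qed.

Lemma loadB (u g : 'rV[R]_d -> 'rV[R]_d) : L2_vec u -> L2_vec g ->
  load (fun x => u x - g x) = load u - load g.
Proof.
move=> hu hg; apply/rowP => i; rewrite !mxE.
have hE : L2_vec (E i).
  by rewrite -vcomb_delta; exact: (P1_L2 (vcomb_P1 (delta_mx 0 i))).
have := boundary_form_linl (-1) hg hu hE; rewrite mulN1r addrC => <-.
by apply: eq_Rintegral => x _; rewrite scaleN1r addrC.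
Qed.

Definition weak_solution v (g u : 'rV[R]_d -> 'rV[R]_d) : Prop := P1_zero_trace Om SigD Th u /\
  forall phi, P1_zero_trace Om SigD Th phi -> Defs.bilinear P v u phi = boundary_form g phi.

Lemma weak_solution_congr v v' (g u : 'rV[R]_d -> 'rV[R]_d) : (forall x, Om x -> v x = v' x) ->
  weak_solution v g u -> weak_solution v' g u.
Proof.
move=> vv [uV h]; split => // phi hphi; rewrite -(h _ hphi).
by apply: bilinear_congr => // x Omx; rewrite vv.
Qed.

Lemma weak_solution_exists a (g : 'rV[R]_d -> 'rV[R]_d) : Kc a -> L2_vec g ->
  weak_solution (lincomb e a) g (vcomb E (load g *m invmx (stiff a))).
Proof.
move=> Ka hg; split=> [|phi hphi]; first exact: vcomb_space.
have [b pb] := E_span hphi.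
rewrite (boundary_form_congr (fun _ _ => erefl) pb) loadE//.
rewrite -[in RHS](mulmxKV (stiff_unit Ka) (load g)) -A0E.
by apply: bilinear_congr => // x Omx; apply: pb; exact: subset_closure.
Qed.

Lemma weak_solution_unique a (g u : 'rV[R]_d -> 'rV[R]_d) : Kc a -> L2_vec g -> weak_solution (lincomb e a) g u ->
  forall x, closure Om x -> u x = vcomb E (load g *m invmx (stiff a)) x.
Proof.
move=> Ka hg [uV h] x cx; have [b ub] := E_span uV; rewrite ub//; congr vcomb.
apply: (canRL (mulmxK (stiff_unit Ka))).
suff : forall b', ddot (b *m stiff a - load g) b' = 0.
  by move=> /(_ (b *m stiff a - load g)) /ddot_eq0/eqP; rewrite subr_eq0 => /eqP.
move=> b'; rewrite ddotBl; apply/eqP; rewrite subr_eq0; apply/eqP.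
rewrite -A0E -loadE// -(h _ (vcomb_space b')).
by apply: bilinear_congr => // y Omy; apply/esym/ub; exact: subset_closure.
Qed.

Definition uc a : 'rV[R]_r := load gh *m invmx (stiff a).

(** The vector in parentheses is the load of the residual, see [load_residual]. *)
Definition pc a : 'rV[R]_r := (uc a *m S - load um) *m invmx (stiff a).

(** Solving the linear system shows that a solution exists, so [xget] does not fall back on its
    default 0. *)
Lemma forward_uh v : Kh P v -> weak_solution v gh (uh P v).
Proof.
move=> Kv; have [a Ka va] := Kh_coordinates Kv.
have ex := weak_solution_exists Ka gh_L2.
apply: (xgetPex (fun=> 0)); exists (vcomb E (uc a)).
by apply: weak_solution_congr ex => x Omx; rewrite va//; exact: subset_closure.
Qed.

Lemma uh_coord a x : Kc a -> closure Om x -> uh P (lincomb e a) x = vcomb E (uc a) x.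
Proof. by move=> Ka; exact: (weak_solution_unique Ka gh_L2 (forward_uh Ka)). Qed.

Lemma uh_space v : Kh P v -> P1_zero_trace Om SigD Th (uh P v).
Proof. by move=> /forward_uh[]. Qed.

Definition residual v x := uh P v x - um x.

Lemma residual_L2 v : Kh P v -> L2_vec (residual v).
Proof.
move=> Kv; have [uP _] := uh_space Kv; have uL := P1_L2 uP.
have := L2_vec_lin (-1) um_L2 uL; congr L2_vec.
by apply/funext => x; rewrite scaleN1r addrC.
Qed.

Lemma load_residual a : Kc a -> load (residual (lincomb e a)) = uc a *m S - load um.
Proof.
move=> Ka; have [uP _] := uh_space Ka.
rewrite (loadB (P1_L2 uP) um_L2).
congr (_ - _); apply/rowP => i; rewrite mxE -(ddot_delta (uc a *m S)) ddotC -SE vcomb_delta.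
by apply: boundary_form_congr => // x cx; exact: uh_coord.
Qed.

Lemma adjoint_ph v : Kh P v -> weak_solution v (residual v) (ph P v).
Proof.
move=> Kv; have [a Ka va] := Kh_coordinates Kv.
have ex := weak_solution_exists Ka (residual_L2 Kv).
apply: (xgetPex (fun=> 0)); exists (vcomb E (load (residual v) *m invmx (stiff a))).
by apply: weak_solution_congr ex => x Omx; rewrite va//; exact: subset_closure.
Qed.

Lemma ph_coord a x : Kc a -> closure Om x -> ph P (lincomb e a) x = vcomb E (pc a) x.
Proof.
move=> Ka; rewrite /pc -(load_residual Ka).
exact: (weak_solution_unique Ka (residual_L2 Ka) (adjoint_ph Ka)).
Qed.

Lemma ph_space v : Kh P v -> P1_zero_trace Om SigD Th (ph P v).
Proof. by move=> /adjoint_ph[]. Qed.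

Lemma misfit_coord a b : Kc a ->
  misfit_form (lincomb e b) (uh P (lincomb e a)) (ph P (lincomb e a)) =
  ddot b (\row_i ddot (uc a *m Tm i) (pc a)).
Proof.
move=> Ka; rewrite -TmE; apply: tform_congr => // x Omx.
  by apply: uh_coord => //; exact: subset_closure.
by apply: ph_coord => //; exact: subset_closure.
Qed.

Lemma solutions_lipschitz : [/\ bounded_on Kc uc, lipschitz_on Kc uc,
  bounded_on Kc pc & lipschitz_on Kc pc].
Proof.
have k0 := mulr_gt0 xi_gt0 kap_gt0.
have coer a (b : 'rV[R]_r) : Kc a -> xi * kap * frob b ^+ 2 <= ddot (b *m (A0 - trilin Tm a)) b.
  by move=> Ka; exact: stiff_coercive.
have bcst : bounded_on Kc (fun=> load gh) by exists (frob (load gh)); rewrite ?frob_ge0.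
have lcst : lipschitz_on Kc (fun=> load gh).
  by exists 0 => // a b _ _; rewrite subrr frob0 mul0r.
have [bu lu] : bounded_on Kc uc /\ lipschitz_on Kc uc.
  apply: (lipschitz_solution k0 coer bcst lcst) => a Ka.
  exact: (mulmxKV (stiff_unit Ka)).
have [bp lp] : bounded_on Kc pc /\ lipschitz_on Kc pc.
  apply: (lipschitz_solution k0 coer (bounded_on_affine S (load um) bu) (lipschitz_on_affine S (load um) lu)) => a Ka.
  exact: (mulmxKV (stiff_unit Ka)).
by [].
Qed.

Lemma Linf_congr f g : (forall x, Om x -> f x = g x) -> Linf Om f = Linf Om g.
Proof.
move=> fg; rewrite /Linf (_ : (fun x => `|f x|%:E) \_ Om = (fun x => `|g x|%:E) \_ Om)//.
by apply/funext => x; rewrite /patch; case: ifPn => //; rewrite inE => Omx; rewrite fg.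
Qed.

Lemma W1inf_congr f g : (forall x, Om x -> f x = g x) -> W1inf Om f = W1inf Om g.
Proof.
move=> fg; rewrite /W1inf (Linf_congr fg).
rewrite (@Linf_congr (fun x => frob (grad f x)) (fun x => frob (grad g x)))// => x Omx.
by rewrite (grad_congr Omx fg).
Qed.

Lemma W1inf_vec_congr u phi : (forall x, Om x -> u x = phi x) -> W1inf_vec Om u = W1inf_vec Om phi.
Proof.
move=> uw; rewrite /W1inf_vec.
rewrite (@Linf_congr (fun x => frob (u x)) (fun x => frob (phi x))) => [|x Omx]; last by rewrite uw.
rewrite (@Linf_congr (fun x => frob (jac u x)) (fun x => frob (jac phi x)))// => x Omx.
by rewrite (jac_congr Omx uw).
Qed.

Lemma solutions_W1inf_bounded : exists U Q : R, [/\ 0 <= U, 0 <= Q,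
  forall v, Kh P v -> fine (W1inf_vec Om (uh P v)) <= U &
  forall v, Kh P v -> fine (W1inf_vec Om (ph P v)) <= Q].
Proof.
have [[U U0 bU] _ [Q Q0 bQ] _] := solutions_lipschitz.
have [L L0 hL] := P1_vec_comb_bound vcomb_P1.
have fin (b : 'rV[R]_r) B : frob b <= B -> fine (W1inf_vec Om (vcomb E b)) <= L * B.
  move=> bB; rewrite -lee_fin fineK; last first.
    rewrite ge0_fin_numE; last by apply: adde_ge0; exact: Linf_ge0.
    exact: (le_lt_trans (hL b) (ltey _)).
  by apply: (le_trans (hL b)); rewrite lee_fin ler_wpM2l.
exists (L * U), (L * Q); split; rewrite ?mulr_ge0// => v Kv.
- have [a Ka va] := Kh_coordinates Kv.
  rewrite (@uh_congr v (lincomb e a)) => [|x Omx]; last by apply: va; exact: subset_closure.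
  rewrite (@W1inf_vec_congr _ (vcomb E (uc a))) => [|x Omx]; first by apply: fin; exact: bU.
  by apply: uh_coord => //; exact: subset_closure.
- have [a Ka va] := Kh_coordinates Kv.
  rewrite (@ph_congr v (lincomb e a)) => [|x Omx]; last by apply: va; exact: subset_closure.
  rewrite (@W1inf_vec_congr _ (vcomb E (pc a))) => [|x Omx]; first by apply: fin; exact: bQ.
  by apply: ph_coord => //; exact: subset_closure.
Qed.

Lemma essbdd_tnorm : essbdd leb Om (fun x => tnorm (C0_sub_C1 P x)).
Proof.
pose q x := \sum_i \sum_j \sum_k \sum_h C0_sub_C1 P x i j k h ^+ 2.
have bq : essbdd leb Om q.
  do 4 (apply: essbdd_sum => ?); apply: essbdd_sqr.
  exact: (essbddB (C0_essbdd _ _ _ _) (essbddZ delta (C0_essbdd _ _ _ _))).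
have [mq [B hB]] := bq; split.
  exact: (measurable_fun_sqrt mq).
exists (1 + B); apply: (ae_lebesgue_imp _ hB) => x h Omx; have := h Omx.
have q0 : 0 <= q x by do 4 apply: sumr_ge0 => ? _; exact: sqr_ge0.
rewrite (ger0_norm q0) ger0_norm ?sqrtr_ge0// /tnorm -[in X in X <= _ -> _](sqr_sqrtr q0) -/(q x).
by have := sqr_ge0 (Num.sqrt (q x) - 1); rewrite sqrrB1; have := sqrtr_ge0 (q x); lra.
Qed.

Definition contrast : R := fine (Linf Om (fun x => tnorm (C0_sub_C1 P x))).

(* Young's inequality: [2 t A B <= t^2 A^2 + B^2] with [A = |w| contrast |u|] and
   [B = |symgrad phi|]. *)
Lemma misfit_young t w u phi : 0 < t -> essbdd leb Om w ->
  P1_vec u -> P1_vec phi ->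
  misfit_form w u phi <= t / 2 * (contrast * fine (W1inf_vec Om u)) ^+ 2 * mass w w +
    (2 * t)^-1 * strain_energy phi.
Proof.
move=> t0 bw hu hphi; have [U0 aeU] := W1inf_vec_bounds hu.
set U := fine _ in U0 aeU *.
have finN := Linf_fin essbdd_tnorm.
have N0 : 0 <= contrast by apply/fine_ge0/Linf_ge0.
have aeN := ae_le_Linf finN.
have bs := essbdd_strain hphi.
have bs' := essbddZ (2 * t)^-1 bs.
have bm : essbdd leb Om (fun x => w x * w x) by exact: essbddM.
have bt : essbdd leb Om (fun x => w x *
    ddot (tapp (C0_sub_C1 P x) (symgrad u x)) (symgrad phi x)).
  apply: (tform_essbdd _ bw hu hphi) => i j k h.
  exact: (essbddB (C0_essbdd _ _ _ _) (essbddZ delta (C0_essbdd _ _ _ _))).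
rewrite /mass /strain_energy -(RintegralZl _ mOm (essbdd_intable bs)).
rewrite -(Rintegral_lin _ bm bs').
apply: (ae_le_Rintegral mOm (essbdd_intable bt)
  (essbdd_intable (essbddD (essbddZ _ bm) bs'))).
apply: (ae_lebesgue_imp2 _ aeU aeN) => x h1 h2 Omx.
have := ddot_tapp_le (C0_sub_C1 P x) (symgrad u x) (symgrad phi x).
have {h1} := h1 Omx; have {h2} := h2 Omx; rewrite -/contrast.
rewrite ger0_norm ?sqrtr_ge0//.
have := frob_ge0 (symgrad phi x); have := frob_ge0 (symgrad u x).
have tn0 : 0 <= tnorm (C0_sub_C1 P x) by exact: sqrtr_ge0.
move: (ddot _ _) (frob (symgrad u x)) (frob (symgrad phi x)) (tnorm _) tn0 (w x) contrast N0 {aeU aeN bt bs bs' bm}.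
move=> D a b c c0 y N N0 a0 b0 cN aU Dle.
have le1 : y * D <= (N * U * `|y|) * b.
  apply: (le_trans (ler_norm _)); rewrite normrM mulrC (mulrAC _ `|y|).
  apply: ler_wpM2r => //; apply: (le_trans Dle); apply: ler_wpM2r => //.
  exact: ler_pM.
apply: (le_trans le1); set A := N * U * `|y|.
have AE : t / 2 * (N * U) ^+ 2 * (y * y) = t / 2 * A ^+ 2.
  by rewrite /A [in RHS]exprMn real_normK ?num_real// (expr2 y) -mulrA.
rewrite AE.
have := sqr_ge0 (t * A - b); rewrite -(pmulr_rge0 _ (_ : 0 < (2 * t)^-1)); last by rewrite invr_gt0 mulr_gt0.
move=> h; rewrite -subr_ge0; congr (0 <= _) : h; field; rewrite gt_eqF//.
Qed.

(** * The energy inequality *)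

Variable K : R.
Hypothesis K_ge0 : 0 <= K.
Hypothesis KE : forall u, P1_zero_trace Om SigD Th u ->
  boundary_form u u <= K * strain_energy u.

(** The first 1 only makes the constant positive. The term with [Q] is the increment part of Young's
    inequality for the second-order misfit term. In the factor [(1 + K) / 2], the 1 pays for its
    strain part and [K] for the boundary energy of the change of [u_h]; both are controlled by
    [strain_uh_diff]. *)
Definition step_bound (N Q U : R) : R :=
  1 + (N * Q) ^+ 2 / 2 + (1 + K) * (N * U) ^+ 2 / (2 * xi ^+ 2).

Lemma step_boundE N Q U :
  step_bound N Q U = 1 + (N * Q) ^+ 2 / 2 + (1 + K) / 2 * (N * U / xi) ^+ 2.
Proof. by rewrite /step_bound; field; rewrite gt_eqF// xi_gt0. Qed.

Lemma C0_sub_C1_essbdd i j k h : essbdd leb Om (fun x => C0_sub_C1 P x i j k h).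
Proof. exact: (essbddB (C0_essbdd _ _ _ _) (essbddZ delta (C0_essbdd _ _ _ _))). Qed.

Lemma misfit_form_sym w u phi : misfit_form w u phi = misfit_form w phi u.
Proof.
apply: tform_sym => x Omx i j k h.
by rewrite /C0_sub_C1 /C1 /= (C0_sym Omx).
Qed.

Lemma misfit_formB f g u phi : essbdd leb Om f -> essbdd leb Om g ->
  P1_vec u -> P1_vec phi ->
  misfit_form (fun x => f x - g x) u phi = misfit_form f u phi - misfit_form g u phi.
Proof.
move=> bf bg hu hphi.
have := tform_lin C0_sub_C1_essbdd (-1) bg bf hu hphi.
rewrite mulN1r addrC => <-; apply: tform_congr => // x _.
by rewrite mulN1r addrC.
Qed.

Lemma massB f g h : essbdd leb Om f -> essbdd leb Om g -> essbdd leb Om h ->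
  mass (fun x => f x - g x) h = mass f h - mass g h.
Proof.
move=> bf bg bh; have := mass_lin (-1) bg bf bh; rewrite mulN1r addrC => <-.
by apply: eq_Rintegral => x _; rewrite mulN1r (addrC (f x)).
Qed.

Lemma dirichletB f g h : P1 Om Th f -> P1 Om Th g -> P1 Om Th h ->
  dirichlet (fun x => f x - g x) h = dirichlet f h - dirichlet g h.
Proof.
move=> fP gP hP; have := dirichlet_lin (-1) gP fP hP; rewrite mulN1r addrC => <-.
have -> // : (fun x => f x - g x) = (fun x => -1 * g x + f x).
by apply/funext => x; rewrite mulN1r addrC.
Qed.

Lemma P1_sub f g : P1 Om Th f -> P1 Om Th g -> P1 Om Th (fun x => f x - g x).
Proof.
move=> fP gP; have := P1_lin (-1) gP fP.
have -> // : (fun x => f x - g x) = (fun x => -1 * g x + f x).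
by apply/funext => x; rewrite mulN1r addrC.
Qed.

Lemma dirichlet_ge0 f : 0 <= dirichlet f f.
Proof. by apply: Rintegral_ge0 => x _; exact: ddot_ge0. Qed.

Lemma mass_ge0 f : 0 <= mass f f.
Proof. by apply: Rintegral_ge0 => x _; rewrite -expr2 sqr_ge0. Qed.

Definition uh_diff v v' : 'rV[R]_d -> 'rV[R]_d := fun x => (-1) *: uh P v x + uh P v' x.

Lemma uh_diff_space v v' : Kh P v -> Kh P v' -> P1_zero_trace Om SigD Th (uh_diff v v').
Proof.
move=> Kv Kv'.
exact: (P1_zero_trace_lin (-1) (uh_space Kv) (uh_space Kv')).
Qed.

Lemma uh_P1 v : Kh P v -> P1_vec (uh P v).
Proof. by move=> /uh_space[]. Qed.

Lemma ph_P1 v : Kh P v -> P1_vec (ph P v).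
Proof. by move=> /ph_space[]. Qed.

(** Testing the two forward problems with the difference [z] itself shows that the stiffness form of
    [z] at [v'] is the misfit derivative of [v' - v] at [uh v] and [z]. Young's inequality with
    [t = 1 / xi] absorbs half of the left-hand side. *)
Lemma strain_uh_diff v v' : Kh P v -> Kh P v' ->
  strain_energy (uh_diff v v') <=
  (contrast * fine (W1inf_vec Om (uh P v)) / xi) ^+ 2 *
    mass (fun x => v' x - v x) (fun x => v' x - v x).
Proof.
move=> Kv Kv'; have zV := uh_diff_space Kv Kv'; have [zP _] := zV.
have bv := Kh_essbdd Kv; have bv' := Kh_essbdd Kv'.
have uP := uh_P1 Kv; have uP' := uh_P1 Kv'.
have [_ fu] := forward_uh Kv; have [_ fu'] := forward_uh Kv'.
have x0 := xi_gt0.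
have := bilinear_coercive Kv' zP; rewrite {2}/uh_diff.
rewrite (bilinear_linl (-1) bv' uP uP' zP) (fu' _ zV) -(fu _ zV) mulN1r addrC.
rewrite (bilinear_diff bv bv' uP zP) => h1.
have xV : 0 < xi^-1 by rewrite invr_gt0.
have := misfit_young xV (essbddB bv' bv) uP zP.
have -> : (2 * xi^-1)^-1 = xi / 2 by rewrite invfM invrK mulrC.
move=> h2; have {h1 h2} h3 := le_trans h1 h2.
move: (strain_energy _) (mass _ _) (contrast * _) h3 => X Y A h3.
have : xi / 2 * X <= xi^-1 / 2 * A ^+ 2 * Y by lra.
have xi2 : 0 < 2 / xi by rewrite divr_gt0.
rewrite -(ler_pM2l xi2) => h; apply: (le_trans _ (le_trans h _)).
  by rewrite le_eqVlt; apply/orP; left; apply/eqP; field; rewrite gt_eqF.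
by rewrite le_eqVlt; apply/orP; left; apply/eqP; field; rewrite gt_eqF.
Qed.

(** An exact expansion. The cross term of the residual with [z] is the adjoint problem tested with
    [z]; by symmetry and the two forward problems, tested with [ph v], it becomes a misfit
    derivative. *)
Lemma misfit_expansion v v' : Kh P v -> Kh P v' ->
  boundary_form (residual v') (residual v') =
  boundary_form (residual v) (residual v) +
  2 * misfit_form (fun x => v' x - v x) (uh P v') (ph P v) +
  boundary_form (uh_diff v v') (uh_diff v v').
Proof.
move=> Kv Kv'; have zV := uh_diff_space Kv Kv'; have [zP _] := zV.
have bv := Kh_essbdd Kv; have bv' := Kh_essbdd Kv'.
have uP := uh_P1 Kv; have uP' := uh_P1 Kv'; have pP := ph_P1 Kv; have pV := ph_space Kv.
have [_ fu] := forward_uh Kv; have [_ fu'] := forward_uh Kv'; have [_ fp] := adjoint_ph Kv.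
have zL := P1_L2 zP; have rL := residual_L2 Kv.
have rE : residual v' = (fun x => 1 *: uh_diff v v' x + residual v x).
  by apply/funext => x; apply/rowP => i; rewrite !mxE; ring.
have rzE : boundary_form (residual v) (uh_diff v v') =
    misfit_form (fun x => v' x - v x) (uh P v') (ph P v).
  rewrite -(fp _ zV) bilinear_sym /uh_diff (bilinear_linl (-1) bv uP uP' pP).
  rewrite (fu _ pV) -(fu' _ pV) mulN1r addrC.
  exact: (bilinear_diff bv bv' uP' pP).
have rL' : L2_vec (fun x => 1 *: uh_diff v v' x + residual v x) by rewrite -rE; exact: residual_L2.
rewrite rE (boundary_form_linl 1 zL rL rL').
rewrite (boundary_form_sym (uh_diff v v')) (boundary_form_linl 1 zL rL zL).
rewrite (boundary_form_sym (residual v) (fun x => 1 *: uh_diff v v' x + residual v x)).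
rewrite (boundary_form_linl 1 zL rL rL).
rewrite (boundary_form_sym (uh_diff v v') (residual v)) rzE.
by move: (boundary_form _ _) (boundary_form _ _) (misfit_form _ _ _) => X Y Z; ring.
Qed.

Lemma mass_cst_essbdd c : essbdd leb Om (fun=> c).
Proof. exact: essbdd_cst. Qed.

Lemma JhE v : Kh P v -> Jh P v = 2^-1 * boundary_form (residual v) (residual v) +
  talpha P * (eps * dirichlet v v + eps^-1 * (mass (fun=> 1) v - mass v v)).
Proof.
move=> Kv; have bv := Kh_essbdd Kv; have [vP _] := Kv.
have b1 := mass_cst_essbdd 1.
have bg := essbdd_ddot (mbdd_grad vP) (mbdd_grad vP).
have bw : essbdd leb Om (fun x => (1 - v x) * v x) by exact: (essbddM (essbddB b1 bv) bv).
rewrite -(massB b1 bv bv) /Jh; congr (_ * _ + _ * _).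
  by apply: eq_Rintegral => x _; rewrite frob_sqr.
rewrite /mass -(RintegralZl eps^-1 mOm (essbdd_intable bw)).
rewrite /dirichlet -(Rintegral_lin eps bg (essbddZ eps^-1 bw)).
by apply: eq_Rintegral => x _; rewrite frob_sqr (mulrC (v x)).
Qed.

(* The left-hand side of the inequality in [scheme_step]. *)
Definition step_form (tau : R) v v' w : R :=
  tau^-1 * mass (fun x => v' x - v x) (fun x => w x - v' x) +
  misfit_form (fun x => w x - v' x) (uh P v) (ph P v) +
  2 * talpha P * eps * dirichlet v' (fun x => w x - v' x) +
  talpha P / eps * mass (fun x => 1 - 2 * v x) (fun x => w x - v' x).

(** Expands the inequality into separate products of the three functions, the scalars of
    [energy_arithmetic] and of the matrix form. *)
Lemma step_formE (tau : R) v v' w : Kh P v -> Kh P v' -> Kh P w ->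
  step_form tau v v' w =
  tau^-1 * (mass v' w - mass v' v' - mass v w + mass v v') +
  misfit_form (fun x => w x - v' x) (uh P v) (ph P v) +
  2 * talpha P * eps * (dirichlet v' w - dirichlet v' v') +
  talpha P / eps * (mass (fun=> 1) w - mass (fun=> 1) v' - 2 * (mass v w - mass v v')).
Proof.
move=> Kv Kv' Kw; have bv := Kh_essbdd Kv; have bv' := Kh_essbdd Kv'; have bw := Kh_essbdd Kw.
have [v'P _] := Kv'; have [wP _] := Kw.
have b1 := mass_cst_essbdd 1; have bd := essbddB bw bv'.
rewrite /step_form; congr (_ * _ + _ + _ * _ + _ * _).
- rewrite (massB bv' bv bd).
  rewrite !(massC _ (fun x => w x - v' x)) !(massB bw bv') //.
  by rewrite !(massC w) (massC v' v); ring.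
- by rewrite dirichletC (dirichletB wP v'P v'P) (dirichletC w).
- rewrite (massB b1 (essbddZ 2 bv) bd) !(massC _ (fun x => w x - v' x)).
  rewrite (massB bw bv' b1) (massB bw bv' (essbddZ 2 bv)) (massC w (fun=> 1)) (massC v' (fun=> 1)).
  have b0 := mass_cst_essbdd 0.
  have Z f : essbdd leb Om f -> mass f (fun x => 2 * v x) = 2 * mass v f.
    move=> bf; rewrite massC /mass -(RintegralZl 2 mOm (essbdd_intable (essbddM bv bf))).
    by apply: eq_Rintegral => x _; rewrite mulrA.
  by rewrite (Z _ bw) (Z _ bv'); ring.
Qed.

Lemma talpha_gt0 : 0 < talpha P.
Proof. by rewrite mulr_gt0// divr_gt0// pi_gt0. Qed.

Lemma step_energy v : Kh P v -> energy_monotone P v (step_constant P step_bound v).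
Proof.
move=> Kv tau v' /andP[tau0 tauc] Kv' step.
have [k kE] : exists k, k = contrast * fine (W1inf_vec Om (uh P v)) / xi by eexists.
have [q qE] : exists q, q = contrast * fine (W1inf_vec Om (ph P v)) by eexists.
have cE : step_constant P step_bound v = 1 + q ^+ 2 / 2 + (1 + K) / 2 * k ^+ 2.
  by rewrite qE kE; exact: step_boundE.
rewrite cE in tauc.
have bv := Kh_essbdd Kv; have bv' := Kh_essbdd Kv'.
have [vP _] := Kv; have [v'P _] := Kv'.
have zV := uh_diff_space Kv Kv'; have [zP _] := zV.
have bD := essbddB bv' bv.
(* The old iterate is the competitor. *)
have := step v Kv; rewrite -/(step_form tau v v' v) (step_formE _ Kv Kv' Kv).
have XE : \int[leb]_(x in Om) ((v' x - v x) ^+ 2) =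
    mass (fun x => v' x - v x) (fun x => v' x - v x).
  by apply: eq_Rintegral => x _; rewrite expr2.
rewrite XE (JhE Kv) (JhE Kv') (misfit_expansion Kv Kv').
(* Replacing [uh v'] by [uh v] gives the first-order term, which the scheme controls, and a
   correction with the change of [u_h], which Young's inequality controls. *)
have uE : misfit_form (fun x => v' x - v x) (uh P v') (ph P v) =
    misfit_form (fun x => v' x - v x) (ph P v) (uh_diff v v') +
    misfit_form (fun x => v' x - v x) (uh P v) (ph P v).
  rewrite [in X in _ = X + _]misfit_form_sym.
  have := tform_linl C0_sub_C1_essbdd 1 bD zP (uh_P1 Kv) (ph_P1 Kv).
  rewrite mul1r => <-; apply: tform_congr => // x _.
  by apply/rowP => i; rewrite !mxE; ring.
have nE : misfit_form (fun x => v x - v' x) (uh P v) (ph P v) =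
    - misfit_form (fun x => v' x - v x) (uh P v) (ph P v).
  by rewrite (misfit_formB bv bv' (uh_P1 Kv) (ph_P1 Kv)) (misfit_formB bv' bv (uh_P1 Kv) (ph_P1 Kv)) opprB.
rewrite uE nE.
have young : misfit_form (fun x => v' x - v x) (ph P v) (uh_diff v v') <=
    1 / 2 * q ^+ 2 * mass (fun x => v' x - v x) (fun x => v' x - v x) +
    (2 * 1)^-1 * strain_energy (uh_diff v v').
  by rewrite qE; exact: (misfit_young ltr01 bD (ph_P1 Kv) zP).
have strain : strain_energy (uh_diff v v') <=
    k ^+ 2 * mass (fun x => v' x - v x) (fun x => v' x - v x).
  by rewrite kE; exact: strain_uh_diff.
have trace := KE zV.
have gD := dirichlet_ge0 (fun x => v' x - v x).
rewrite (dirichletB v'P vP (P1_sub v'P vP)) !(dirichletC _ (fun x => v' x - v x)) in gD.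
rewrite (dirichletB v'P vP v'P) (dirichletB v'P vP vP) (dirichletC v v') in gD.
have X0 := mass_ge0 (fun x => v' x - v x).
have XD : mass (fun x => v' x - v x) (fun x => v' x - v x) = mass v' v' - mass v v' - (mass v v' - mass v v).
  rewrite (massB bv' bv bD) !(massC _ (fun x => v' x - v x)) (massB bv' bv bv') (massB bv' bv bv).
  by rewrite (massC v' v).
rewrite (massC v' v).
have tX : (1 + (1 + q ^+ 2 / 2 + (1 + K) / 2 * k ^+ 2)) * mass (fun x => v' x - v x) (fun x => v' x - v x) <=
    tau^-1 * mass (fun x => v' x - v x) (fun x => v' x - v x).
  (* The hypothesis [0 < tau <= c^-1] itself shows that this [c], which includes the outer 1, is
     positive. *)
  apply: ler_wpM2r => //; set c := 1 + (_ + _) in tauc *; have c0 : 0 < c.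
    by rewrite -invr_gt0; exact: lt_le_trans tauc.
  by rewrite -[leLHS]invrK lef_pV2// posrE invr_gt0.
have eX : 0 <= talpha P / eps * mass (fun x => v' x - v x) (fun x => v' x - v x).
  by rewrite mulr_ge0// divr_ge0 ?ltW// talpha_gt0.
have eG := mulr_ge0 (ltW (mulr_gt0 talpha_gt0 eps0)) gD.
have trace2 := le_trans trace (ler_wpM2l K_ge0 strain).
rewrite XD in tX eX X0 strain trace2 young *.
by move=> h; exact: (energy_arithmetic _ tX eX eG X0 strain trace2 young h).
Qed.

(** * The admissible coordinates, the iteration and its limit *)

Variables (M G : 'M[R]_s) (kM : R).
Hypothesis ME : forall a b, mass (lincomb e a) (lincomb e b) = ddot (a *m M) b.
Hypothesis kM_gt0 : 0 < kM.
Hypothesis kME : forall a : 'rV[R]_s, kM * frob a ^+ 2 <= ddot (a *m M) a.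
Hypothesis GE : forall a b, dirichlet (lincomb e a) (lincomb e b) = ddot (a *m G) b.

Definition ell : 'rV[R]_s := \row_i mass (fun=> 1) (e i).

(** The gradient of the misfit in coordinates: by [misfit_coord], pairing it with [b] gives the
    misfit derivative in the direction [lincomb e b]. *)
Definition sensitivity a : 'rV[R]_s := \row_i ddot (uc a *m Tm i) (pc a).

Lemma ellE b : mass (fun=> 1) (lincomb e b) = ddot ell b.
Proof.
rewrite massC (linear_ddot (f := fun b => mass (lincomb e b) (fun=> 1))).
  by rewrite ddotC; congr ddot; apply/rowP => i; rewrite !mxE lincomb_delta massC.
move=> k a a'; rewrite lincomb_lin.
exact: (mass_lin k (essbdd_lincomb a) (essbdd_lincomb a') (mass_cst_essbdd 1)).
Qed.

Lemma lincombB a b : (fun x => lincomb e a x - lincomb e b x) = lincomb e (a - b).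
Proof.
rewrite (addrC a) -scaleN1r lincomb_lin; apply/funext => x.
by rewrite mulN1r addrC.
Qed.

Local Notation vector := (scheme_vector M G sensitivity).

Lemma step_form_coord (tau : R) a a' c : Kc a -> Kc a' -> Kc c ->
  step_form tau (lincomb e a) (lincomb e a') (lincomb e c) =
  ddot (vector tau (2 * talpha P * eps) (talpha P / eps) ell a a') (c - a').
Proof.
move=> Ka Ka' Kc'; rewrite step_formE// lincombB misfit_coord// !ME !GE !ellE.
rewrite /scheme_vector !(ddotDl, ddotZl, ddotBl) !mulmxBl !ddotBl !ddotBr.
rewrite -/(sensitivity a) !ddotNl !ddotZl (ddotC c (sensitivity a)) (ddotC a' (sensitivity a)).
by move: (talpha P / eps) (2 * talpha P * eps) tau^-1 => k2 k1 ti; ring.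
Qed.

Lemma mass_congr f f' g g' : (forall x, Om x -> f x = f' x) ->
  (forall x, Om x -> g x = g' x) -> mass f g = mass f' g'.
Proof.
move=> ff gg; apply: eq_Rintegral => x; rewrite inE => Omx.
by rewrite ff// gg.
Qed.

Lemma dirichlet_congr f f' g g' : (forall x, Om x -> f x = f' x) ->
  (forall x, Om x -> g x = g' x) -> dirichlet f g = dirichlet f' g'.
Proof.
move=> ff gg; apply: eq_Rintegral => x; rewrite inE => Omx.
by rewrite (grad_congr Omx ff) (grad_congr Omx gg).
Qed.

Lemma step_form_congr (tau : R) v v' w f f' g : (forall x, Om x -> v x = f x) ->
  (forall x, Om x -> v' x = f' x) -> (forall x, Om x -> w x = g x) ->
  step_form tau v v' w = step_form tau f f' g.
Proof.
move=> vf vf' wg; rewrite /step_form (uh_congr vf) (ph_congr vf).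
have wv x : Om x -> w x - v' x = g x - f' x by move=> Omx; rewrite wg// vf'.
rewrite (mass_congr (f' := fun x => f' x - f x) _ wv) => [|x Omx]; last by rewrite vf'// vf.
rewrite (mass_congr (f' := fun x => 1 - 2 * f x) _ wv) => [|x Omx]; last by rewrite vf.
rewrite (dirichlet_congr vf' wv); congr (_ + _ + _ + _).
exact: (tform_congr _ wv (fun _ _ => erefl) (fun _ _ => erefl)).
Qed.

(** With no increment the time difference vanishes, so a fixed point of the scheme satisfies the
    optimality condition whatever the time step. *)
Lemma step_form_diag (tau : R) v w : Kh P v -> Kh P w ->
  step_form tau v v w = Jh_derivative P v (w \- v).
Proof.
move=> Kv Kw; have bv := Kh_essbdd Kv; have bw := Kh_essbdd Kw.
rewrite /step_form (massB bv bv (essbddB bw bv)) subrr mulr0 add0r.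
by [].
Qed.

(** Values between 0 and 1 bound the mass by the volume of [Om], and the mass matrix is coercive;
    [f^2 <= V] is then weakened to [f <= 1 + V]. *)
Lemma Kc_bounded : exists B, forall a, Kc a -> frob a <= B.
Proof.
pose vol := mass (fun=> 1) (fun=> 1); exists (1 + vol / kM) => a Ka.
have [_ [_ a01 _]] := Ka; have ba := essbdd_lincomb a; have b1 := mass_cst_essbdd 1.
have : mass (lincomb e a) (lincomb e a) <= vol.
  apply: (ae_le_Rintegral mOm (essbdd_intable (essbddM ba ba))
    (essbdd_intable (essbddM b1 b1))).
  apply: (ae_lebesgue_imp _ a01) => x h Omx; have /andP[x0 x1] := h Omx.
  exact: ler_pM.
rewrite ME => /(le_trans (kME a)); rewrite mulrC -ler_pdivlMr//.
move: (vol / kM) (frob a) => V f fV.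
by have := sqr_ge0 (f - 1); rewrite sqrrB1; have := sqr_ge0 f; lra.
Qed.

Lemma lincomb_cvg (a : nat -> 'rV[R]_s) l x : frob (a n - l) @[n --> \oo] --> (0 : R) ->
  lincomb e (a n) x @[n --> \oo] --> lincomb e l x.
Proof.
move=> al; pose q := \row_i lincomb e (delta_mx 0 i) x.
have lin b : lincomb e b x = ddot b q.
  by apply: (linear_ddot (f := fun b => lincomb e b x)) => k b1 b2; rewrite lincomb_lin.
apply/cvgrPdist_le => t t0; have qt : 0 < t / (frob q + 1).
  by rewrite divr_gt0// ltr_wpDl ?frob_ge0.
have /cvgrPdist_le/(_ _ qt) := al; apply: filterS => n.
rewrite sub0r normrN ger0_norm ?frob_ge0// => h.
rewrite !lin -ddotBl; apply: (le_trans (ddot_le_frob _ _)); rewrite frobC.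
have := frob_ge0 q; have := frob_ge0 (a n - l) => f0 q0.
have qp : 0 < frob q + 1 by rewrite ltr_wpDl.
apply: (@le_trans _ _ (frob (a n - l) * (frob q + 1))); first by rewrite ler_wpM2l// lerDl.
by rewrite -ler_pdivlMr.
Qed.

(** Convergent coordinates give convergence at every point, and countably many exceptional null sets
    still form a null set. *)
Lemma Kc_closed (a : nat -> 'rV[R]_s) l : (forall n, Kc (a n)) ->
  frob (a n - l) @[n --> \oo] --> (0 : R) -> Kc l.
Proof.
move=> Ka al; split; first exact: lincomb_P1.
split; first exact: lincomb_H1.
- have /ae_foralln h : forall n, {ae leb, forall x, Om x -> 0 <= lincomb e (a n) x <= 1}.
    by move=> n; have [_ []] := Ka n.
  apply: (ae_lebesgue_imp _ h) => x hx Omx; have xl := @lincomb_cvg a l x al.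
  have cx : cvgn (fun n => lincomb e (a n) x) by apply/cvg_ex; exists (lincomb e l x).
  rewrite -(cvg_lim _ xl)//; apply/andP; split.
    by apply: limr_ge => //; apply: nearW => n; have /andP[] := hx n Omx.
  by apply: limr_le => //; apply: nearW => n; have /andP[] := hx n Omx.
- have /ae_foralln h : forall n, {ae leb, forall x, Om x ->
      distance x (boundary Om) <= d0 / 2 -> lincomb e (a n) x = 0}.
    by move=> n; have [_ []] := Ka n.
  apply: (ae_lebesgue_imp _ h) => x hx Omx dx; have xl := @lincomb_cvg a l x al.
  rewrite -(cvg_lim _ xl)//; apply: cvg_lim => //.
  rewrite (_ : (fun n => _) = (fun=> 0)); first exact: cvg_cst.
  by apply/funext => n; exact: hx.
Qed.

Lemma Kc_convex a b t : Kc a -> Kc b -> 0 <= t <= 1 -> Kc (a + t *: (b - a)).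
Proof.
move=> [_ [_ a01 a0]] [_ [_ b01 b0]] /andP[t0 t1].
have E' x : lincomb e (a + t *: (b - a)) x = t * (lincomb e b x - lincomb e a x) + lincomb e a x.
  by rewrite addrC lincomb_lin -lincombB.
split; first exact: lincomb_P1.
split; first exact: lincomb_H1.
- apply: (ae_lebesgue_imp2 _ a01 b01) => x h1 h2 Omx; rewrite E'.
  have /andP[x0 x1] := h1 Omx; have /andP[y0 y1] := h2 Omx.
  have {}t1 : 0 <= 1 - t by rewrite subr_ge0.
  have -> : t * (lincomb e b x - lincomb e a x) + lincomb e a x =
      t * lincomb e b x + (1 - t) * lincomb e a x by ring.
  rewrite addr_ge0 ?mulr_ge0//=.
  have := ler_wpM2l t0 y1; have := ler_wpM2l t1 x1; lra.
- apply: (ae_lebesgue_imp2 _ a0 b0) => x h1 h2 Omx dx.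
  by rewrite E' h1// h2// subrr mulr0 addr0.
Qed.

Lemma Kc_compact : compact Kc.
Proof.
have [B KB] := Kc_bounded; apply: (frob_bounded_closed_compact KB).
exact: (seq_closed_closed Kc_closed).
Qed.

(** Misfit and potential are explicit, hence fixed vectors here. The step is the first-order
    condition for a quadratic function with matrix [tau^-1 *: M + k1 *: G] on the compact convex set
    [Kc]. *)
Lemma next_iterate (tau k1 k2 : R) a : Kc a -> exists a', Kc a' /\
  forall c, Kc c -> 0 <= ddot (vector tau k1 k2 ell a a') (c - a').
Proof.
move=> Ka.
pose l := - (tau^-1 *: (a *m M)) + sensitivity a + k2 *: (ell - 2 *: (a *m M)).
have symM (x y : 'rV[R]_s) : ddot (x *m M) y = ddot (y *m M) x by rewrite -!ME massC.
have symG (x y : 'rV[R]_s) : ddot (x *m G) y = ddot (y *m G) x by rewrite -!GE dirichletC.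
have K0 : Kc !=set0 by exists a.
have symQ (x y : 'rV[R]_s) :
    ddot (x *m (tau^-1 *: M + k1 *: G)) y = ddot (y *m (tau^-1 *: M + k1 *: G)) x.
  by rewrite !mulmxDr !ddotDl -!scalemxAr !ddotZl (symM y x) (symG y x).
have [a' Ka' h] := quadratic_minimum l Kc_compact K0 Kc_convex symQ.
exists a'; split => // c Kc'; have := h c Kc'; congr (0 <= ddot _ _).
rewrite /scheme_vector /l mulmxDr -!scalemxAr mulmxBl scalerBr.
move: (a' *m G) (a' *m M) (a *m M) => x y z.
by apply/rowP => i; rewrite !mxE; ring.
Qed.

Local Notation k1 := (2 * talpha P * eps).
Local Notation k2 := (talpha P / eps).

Lemma scheme_stepP (tau : R) v v' a a' : Kc a -> Kc a' ->
  (forall x, closure Om x -> v x = lincomb e a x) ->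
  (forall x, closure Om x -> v' x = lincomb e a' x) ->
  scheme_step P tau v v' <->
  forall c, Kc c -> 0 <= ddot (vector tau k1 k2 ell a a') (c - a').
Proof.
move=> Ka Ka' va va'.
have vO x : Om x -> v x = lincomb e a x by move=> Omx; exact: va (subset_closure Omx).
have vO' x : Om x -> v' x = lincomb e a' x by move=> Omx; exact: va' (subset_closure Omx).
have stepE w c : Kc c -> (forall x, Om x -> w x = lincomb e c x) ->
    step_form tau v v' w = ddot (vector tau k1 k2 ell a a') (c - a').
  by move=> cK wc; rewrite (step_form_congr tau vO vO' wc) step_form_coord.
split=> [h c cK|h w Kw].
  by rewrite -(stepE (lincomb e c) c cK (fun _ _ => erefl)); exact: h.
have [c cK wc] := Kh_coordinates Kw.
have := h c cK; rewrite -(stepE w c cK)// => x Omx.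
exact: wc (subset_closure Omx).
Qed.

Lemma step_constant_gt0 v : 0 < step_constant P step_bound v.
Proof.
have K1 : 0 <= (1 + K) / 2 by rewrite divr_ge0// addr_ge0.
rewrite /step_constant step_boundE -addrA ltr_wpDr// addr_ge0//.
  by rewrite divr_ge0// sqr_ge0.
by rewrite mulr_ge0// sqr_ge0.
Qed.

Lemma step_bound_le N Q U Q' U' : 0 <= N -> 0 <= Q <= Q' -> 0 <= U <= U' ->
  step_bound N Q U <= step_bound N Q' U'.
Proof.
move=> N0 /andP[Q0 QQ] /andP[U0 UU]; rewrite !step_boundE.
have x0 := xi_gt0.
apply: lerD.
  rewrite lerD2l; apply: ler_wpM2r; first by rewrite invr_ge0.
  rewrite ler_pXn2r// ?nnegrE; first exact: ler_wpM2l.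
    exact: mulr_ge0.
  by rewrite mulr_ge0// (le_trans Q0).
apply: ler_wpM2l; first by rewrite divr_ge0// addr_ge0.
have xV : 0 <= xi^-1 by rewrite invr_ge0 ltW.
have NU : N * U <= N * U' by exact: ler_wpM2l.
have NU0 : 0 <= N * U by exact: mulr_ge0.
rewrite ler_pXn2r// ?nnegrE; first exact: ler_wpM2r.
  exact: mulr_ge0.
by rewrite mulr_ge0// (le_trans NU0).
Qed.

Lemma Jh_ge0 v : Kh P v -> 0 <= Jh P v.
Proof.
move=> Kv; have bv := Kh_essbdd Kv; have [_ [_ v01 _]] := Kv.
rewrite (JhE Kv) addr_ge0//; first by rewrite mulr_ge0// boundary_form_ge0.
rewrite mulr_ge0 ?(ltW talpha_gt0)// addr_ge0//.
  by rewrite mulr_ge0 ?(ltW eps0)// dirichlet_ge0.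
rewrite mulr_ge0 ?invr_ge0 ?(ltW eps0)// subr_ge0.
apply: (ae_le_Rintegral mOm (essbdd_intable (essbddM bv bv))
  (essbdd_intable (essbddM (mass_cst_essbdd 1) bv))).
apply: (ae_lebesgue_imp _ v01) => x h Omx; have /andP[x0 x1] := h Omx.
exact: ler_wpM2r.
Qed.

Lemma Jh_congr v w : Kh P v -> Kh P w -> (forall x, Om x -> v x = w x) -> Jh P v = Jh P w.
Proof.
move=> Kv Kw vw; rewrite (JhE Kv) (JhE Kw) /residual (uh_congr vw).
rewrite (dirichlet_congr vw vw) (mass_congr vw vw).
by rewrite (mass_congr (f := fun=> 1) (fun _ _ => erefl) vw).
Qed.

Lemma generated_exists (tau : nat -> R) v0 : Kh P v0 -> exists v : nat -> 'rV[R]_d -> R, generated P tau v0 v.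
Proof.
move=> Kv0; have [a0 Ka0 va0] := Kh_coordinates Kv0.
(* The index is part of the argument because the time step may vary with it; outside [Kc] the value
   0 is arbitrary. *)
have /choice[nx nxP] : forall na : nat * 'rV[R]_s, exists a', Kc na.2 -> Kc a' /\
    forall c, Kc c -> 0 <= ddot (vector (tau na.1) k1 k2 ell na.2 a') (c - a').
  move=> [n a]; have [Ka|nKa] := pselect (Kc a); last by exists 0.
  by have [a' [Ka' h]] := next_iterate (tau n) k1 k2 Ka; exists a'.
pose a := fix a n := if n is m.+1 then nx (m, a m) else a0.
have aK n : Kc (a n) by elim: n => // n /(nxP (n, a n))[].
(* The sequence has to start with [v0] itself, which agrees with its combination on the closure
   only. *)
exists (fun n => if n is m.+1 then lincomb e (a m.+1) else v0).
have vE n x : closure Om x ->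
  (if n is m.+1 then lincomb e (a m.+1) else v0) x = lincomb e (a n) x.
  by case: n => // cx; exact: va0.
split => // [|n]; first by case=> // n; exact: aK.
apply/(scheme_stepP (tau n) (aK n) (aK n.+1) (vE n) (vE n.+1)).
by have [_] := nxP (n, a n) (aK n).
Qed.

Lemma generated_converges (t : R) v0 (v : nat -> 'rV[R]_d -> R) :
  (forall n, 0 < t <= (1 + step_constant P step_bound (v n))^-1) ->
  generated P (fun=> t) v0 v ->
  exists (k : nat -> nat) (vlim : 'rV[R]_d -> R),
    [/\ {homo k : m n / (m < n)%N >-> (m < n)%N}, Kh P vlim,
        W1inf Om (v (k n) \- vlim) @[n --> \oo] --> (0 : \bar R)%E & optimal P vlim].
Proof.
move=> tc [_ Kv stepv].
have /choice[a aP] : forall n, exists a, Kc a /\ forall x, closure Om x -> v n x = lincomb e a x.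
  by move=> n; have [a Ka va] := Kh_coordinates (Kv n); exists a.
have aK n : Kc (a n) by case: (aP n).
have va n x : closure Om x -> v n x = lincomb e (a n) x by case: (aP n) => _; exact.
have vO n x : Om x -> v n x = lincomb e (a n) x by move=> Omx; exact: va (subset_closure Omx).
have [B KB] := Kc_bounded.
have [bu lu bp lp] := solutions_lipschitz.
have lD : lipschitz_on Kc sensitivity := lipschitz_on_forms Tm bu lu bp lp.
have energy n : ddot ((a n.+1 - a n) *m M) (a n.+1 - a n) + Jh P (lincomb e (a n.+1)) <=
    Jh P (lincomb e (a n)).
  have := step_energy (Kv n) (tc n) (Kv n.+1) (stepv n).
  rewrite (Jh_congr (Kv n) (aK n) (vO n)) (Jh_congr (Kv n.+1) (aK n.+1) (vO n.+1)).
  apply: le_trans; rewrite lerD2r -ME -lincombB le_eqVlt; apply/orP; left; apply/eqP.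
  apply: eq_Rintegral => x; rewrite inE => Omx.
  by rewrite vO// vO// expr2.
have step n c : Kc c -> 0 <= ddot (vector t k1 k2 ell (a n) (a n.+1)) (c - a n.+1).
  by move: c; apply/(scheme_stepP t (aK n) (aK n.+1) (va n) (va n.+1)); exact: stepv.
have [k [l [kh Kl kl opt]]] :=
  scheme_limit KB Kc_closed lD kM_gt0 kME (fun b Kb => Jh_ge0 Kb) aK energy step.
have [L L0 hL] := P1_comb_bound lincomb_P1.
exists k, (lincomb e l); split => //.
- apply: (@squeeze_cvge _ _ _ _ (fun=> 0%E) _ (fun n => (L * frob (a (k n) - l))%:E)).
  + apply: nearW => n; apply/andP; split; first by apply: adde_ge0; exact: Linf_ge0.
    rewrite (@W1inf_congr _ (lincomb e (a (k n) - l))) => [|x Omx]; first exact: hL.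
    by rewrite -lincombB /= vO.
  + exact: cvg_cst.
  + apply/fine_cvgP; split; first exact: nearW.
    by rewrite -(mulr0 L); apply: cvgM => //; exact: cvg_cst.
- move=> w Kw; have [c cK wc] := Kh_coordinates Kw.
  rewrite -(step_form_diag t Kl Kw).
  have wO x : Om x -> w x = lincomb e c x by move=> Omx; exact: wc (subset_closure Omx).
  rewrite (step_form_congr t (fun _ _ => erefl) (fun _ _ => erefl) wO).
  by rewrite (step_form_coord t Kl Kl cK); exact: opt.
Qed.

Lemma scheme_converges v0 : Kh P v0 -> exists (tau : nat -> R) (gamma : R),
  [/\ 0 < gamma, exists v : nat -> 'rV[R]_d -> R, generated P tau v0 v &
      forall v : nat -> 'rV[R]_d -> R, generated P tau v0 v ->
        (forall n, gamma <= tau n <= (1 + step_constant P step_bound (v n))^-1) /\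
        exists (k : nat -> nat) (vlim : 'rV[R]_d -> R),
        [/\ {homo k : m n / (m < n)%N >-> (m < n)%N}, Kh P vlim,
            W1inf Om (v (k n) \- vlim) @[n --> \oo] --> (0 : \bar R)%E & optimal P vlim]].
Proof.
move=> Kv0; have [U [Q [U0 Q0 hU hQ]]] := solutions_W1inf_bounded.
have N0 : 0 <= contrast by apply/fine_ge0/Linf_ge0.
(* The bound increases with the norms of [p_h] and [u_h], so its value at their uniform bounds
   dominates every [c^n]; the resulting constant step also serves as [gamma]. *)
pose c := step_bound contrast Q U.
have cmax v : Kh P v -> step_constant P step_bound v <= c.
  move=> Kv; have [u0 _] := W1inf_vec_bounds (uh_P1 Kv).
  have [p0 _] := W1inf_vec_bounds (ph_P1 Kv).
  have pQ : 0 <= fine (W1inf_vec Om (ph P v)) <= Q by rewrite p0 hQ.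
  have uU : 0 <= fine (W1inf_vec Om (uh P v)) <= U by rewrite u0 hU.
  exact: (step_bound_le N0 pQ uU).
have c1 : 0 < 1 + c.
  by apply: (@lt_le_trans _ _ (1 + step_constant P step_bound v0)); rewrite ?lerD2l ?cmax// addr_gt0// step_constant_gt0.
have t0 : 0 < (1 + c)^-1 by rewrite invr_gt0.
have tc v : Kh P v -> (1 + c)^-1 <= (1 + step_constant P step_bound v)^-1.
  move=> Kv; rewrite lef_pV2 ?posrE ?lerD2l//; first exact: cmax.
  by rewrite addr_gt0// step_constant_gt0.
exists (fun=> (1 + c)^-1), (1 + c)^-1; split => // [|v gv]; first exact: generated_exists.
have [_ Kv _] := gv; split => [n|]; first by rewrite lexx tc.
by apply: (generated_converges _ gv) => n; rewrite t0 tc.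
Qed.

End coordinates.
End basis.

End discrete_problem.

Theorem theorem4p6 (R : realType) (d : nat) (hd : d = 2%N \/ d = 3%N)
  (Om SigN SigD : set 'rV[R]_d)
  (hOm : polyhedral_domain Om)
  (hbd : boundary Om = SigN `|` SigD)
  (hSigNm : (hausdorff d.-1).-cara.-measurable SigN)
  (hSigD : closed SigD)
  (hSigN0 : (0 < hausdorff d.-1 SigN)%E)
  (hSigD0 : (0 < hausdorff d.-1 SigD)%E)
  (h0 : R) (hh0 : 0 < h0) (T : R -> seq 'M[R]_(d.+1, d))
  (hT : regular_triangulations Om h0 T)
  (h : R) (hh : 0 < h <= h0)
  (delta : R) (hdelta : 0 < delta) (xi0 : R) (hxi0 : 0 < xi0) :
  exists c : R -> R -> R -> R,
  forall (d0 : R) (C0 : 'rV[R]_d -> tensor4 R d) (eps alpha : R)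
    (gh umeas : 'rV[R]_d -> 'rV[R]_d) (v0 : 'rV[R]_d -> R),
  let P := Problem Om SigD SigN (T h) d0 C0 delta eps alpha gh umeas in
  0 < d0 -> elasticity_tensor Om xi0 C0 -> 0 < eps -> 0 < alpha ->
  (forall i, L2 (hausdorff_measure R d d.-1) SigN (fun x => gh x 0 i)) ->
  (forall i, L2 (hausdorff_measure R d d.-1) SigN (fun x => umeas x 0 i)) ->
  Kh P v0 ->
  (forall v, Kh P v ->
     0 < step_constant P c v /\ energy_monotone P v (step_constant P c v)) /\
  exists (tau : nat -> R) (gamma : R),
  [/\ 0 < gamma,
      exists v, generated P tau v0 v &
      forall v, generated P tau v0 v ->
        (forall n, gamma <= tau n <= (1 + step_constant P c (v n))^-1) /\
        exists (k : nat -> nat) (vlim : 'rV[R]_d -> R),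
        [/\ {homo k : m n / (m < n)%N >-> (m < n)%N},
            Kh P vlim,
            W1inf Om (v (k n) \- vlim) @[n --> \oo] --> (0 : \bar R)%E &
            optimal P vlim]].
Proof.
have d_gt0 : (0 < d)%N by case: hd => ->.
have [sigma _ hreg] := hT; have [[hTh _] _] := hreg h hh.
have NB : SigN `<=` boundary Om by rewrite hbd; exact: subsetUl.
have DB : SigD `<=` closure Om.
  by move=> x Dx; have [] : boundary Om x by rewrite hbd; right.
(* Bases, trace constant and the mass, Dirichlet and boundary matrices depend on the geometry and
   the mesh only, so they are fixed before [c] is chosen; the stiffness matrices come after [C0]. *)
have [s [e [e_space e_span e_free]]] := scalar_basis d_gt0 hOm hTh.
have [r [E [E_space E_span E_free]]] := vector_basis d_gt0 hOm hTh DB.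
have [K K0 KE] := trace_inequality d_gt0 hOm hTh DB hSigD0 hSigNm NB E_space E_span E_free.
have [kap kap0 kapE] := strain_energy_coercive d_gt0 hOm hTh DB hSigD0 E_space E_free.
have [S SE] := boundary_matrix d_gt0 hOm hTh DB hSigNm NB E_space.
have [M [ME [kM kM0 kME]]] := mass_matrix d_gt0 hOm hTh e_space e_free.
have [G GE] := dirichlet_matrix d_gt0 hOm hTh e_space.
exists (step_bound delta xi0 K) => d0 C0 eps alpha gh umeas v0 P hd0 hC heps halpha hgh hum Kv0.
have [A0 [Tm [A0E TmE]]] :=
  stiffness_matrices d_gt0 hOm hTh DB SigN e_space E_space d0 delta eps alpha gh umeas hC.
split=> [v Kv|].
  split; first exact: step_constant_gt0.
  exact: (step_energy d_gt0 hOm hTh DB hSigNm NB e_space e_span E_space E_span hdelta hxi0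
    heps halpha hC hgh hum A0E kap0 kapE K0 KE Kv).
exact: (scheme_converges d_gt0 hOm hTh DB hSigNm NB e_space e_span E_space E_span hdelta hxi0
  heps halpha hC hgh hum A0E TmE kap0 kapE SE K0 KE ME kM0 kME GE Kv0).
Qed.
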